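(* Let $(M,g)$ be a compact oriented Riemannian 4-manifold endowed with a $C^r$-metric $g$, and $S$ a Hermitian line bundle on $M$ endowed with a non-flat anti-selfdual (ASD) unitary connection $\sigma$. Suppose that the vanishing locus of the curvature $F_\sigma$ has Hausdorff dimension $\le2$. Let $\beta\in A^1(S)$ be such that 1. $d_\sigma^*\beta=0$, $d_\sigma^+\beta=0$, 2. the anti-selfdual $S$-valued form $d_\sigma\beta$ is a tensor multiple of $F_\sigma$ at any point $x\in M$ for which $F_{\sigma,x}\ne0$ (that is, $(d_\sigma\beta)_x=F_{\sigma,x}\otimes\zeta_x$ for some $\zeta_x\in S_x$). Then $\beta=0$.
   Context: $A^1(S)$ is the space of $S$-valued 1-forms; $d_\sigma^+$ is the composition of $d_\sigma:A^1(S)\to A^2(S)$ with the projection on selfdual forms; $d_\sigma^*$ is the formal adjoint of $d_\sigma:A^0(S)\to A^1(S)$. $\sigma$ is ASD if the selfdual part of $F_\sigma$ vanishes. $r$ is a large regularity index. *)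

(* Defs.v *)
From HB Require Import structures.
From mathcomp Require Import all_boot all_order all_algebra all_fingroup.
From mathcomp Require Import complex.
From mathcomp Require Import all_classical all_reals all_analysis.

Set Implicit Arguments.
Unset Strict Implicit.
Unset Printing Implicit Defensive.

Import Order.TTheory GRing.Theory Num.Theory.
Import numFieldNormedType.Exports.

Local Open Scope classical_set_scope.
Local Open Scope complex_scope.
Local Open Scope ring_scope.

Section Calculus.
Variable R : realType.
Local Notation E := 'rV[R]_4.
Local Notation C := R[i].

Definition pd (a : 'I_4) (f : E -> R) (y : E) : R :=
  'D_(delta_mx 0 a) f y.

Definition pdC (a : 'I_4) (f : E -> C) (y : E) : C :=
  (pd a (fun z => complex.Re (f z)) y +i* pd a (fun z => complex.Im (f z)) y)%C.

(* [U] is meant to be open, so that the partial derivatives at the points of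
   [U] do not depend on the values of [f] outside [U]. *)
Fixpoint Cn (n : nat) (U : set E) (f : E -> R) : Prop :=
  (forall y, U y -> {for y, continuous f}) /\
  (if n is m.+1 then
     (forall a y, U y -> derivable f y (delta_mx 0 a)) /\
     (forall a, Cn m U (pd a f))
   else True).

(* [Some n] stands for class C^n, [None] for class C^oo. *)
Definition regularity := option nat.

Definition at_least (n : nat) (k : regularity) : bool :=
  if k is Some m then (n <= m)%N else true.

Definition Ck (k : regularity) (U : set E) (f : E -> R) : Prop :=
  forall n, at_least n k -> Cn n U f.

Definition CkC (k : regularity) (U : set E) (f : E -> C) : Prop :=
  Ck k U (fun y => complex.Re (f y)) /\ Ck k U (fun y => complex.Im (f y)).

Definition RtoC_mx m n (A : 'M[R]_(m, n)) : 'M[C]_(m, n) :=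
  map_mx (fun t : R => t%:C) A.

End Calculus.

(* The norm of 'rV[R]_4 is the sup norm; it is equivalent to the Euclidean one,
   hence gives the same Hausdorff dimension. *)
Section Hausdorff.
Variable R : realType.
Local Notation E := 'rV[R]_4.
Local Open Scope ereal_scope.

Definition ediam (A : set E) : \bar R :=
  ereal_sup (0 |` [set (`|x - y|%R)%:E | x in A & y in A]).

Definition hausdorff_content (s d : R) (A : set E) : \bar R :=
  ereal_inf [set \sum_(0 <= n <oo) (ediam (U n) `^ s) |
    U in [set U : nat -> set E |
            (forall n, ediam (U n) <= d%:E) /\ A `<=` \bigcup_n U n]].

Definition hausdorff_measure (s : R) (A : set E) : \bar R :=
  ereal_sup [set hausdorff_content s d A | d in [set d : R | (0 < d)%R]].

Definition hausdorff_dim (A : set E) : \bar R :=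
  ereal_inf [set s%:E | s in
    [set s : R | (0 < s)%R /\ hausdorff_measure s A = 0]].

End Hausdorff.

Section Manifold.
Variable R : realType.
Local Notation E := 'rV[R]_4.
Local Notation C := R[i].

(* A smooth structure and an orientation, given by an oriented atlas.
   [param i] inverts [chart i]; only its values on the image of [chart i]
   matter.  [chart_at] selects a chart around each point.  In the convention of
   the library, ('J f y) a b is the partial derivative along the a-th
   coordinate of the b-th component of f. *)
Record oriented_atlas (M : topologicalType) (I : Type) := OrientedAtlas {
  chart_dom : I -> set M;
  chart : I -> M -> E;
  param : I -> E -> M;
  chart_at : M -> I;
  chart_dom_open : forall i, open (chart_dom i);
  mem_chart_at : forall x, chart_dom (chart_at x) x;
  img_open : forall i, open (chart i @` chart_dom i);
  chartK : forall i x, chart_dom i x -> param i (chart i x) = x;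
  chart_continuous : forall i, {within chart_dom i, continuous (chart i)};
  param_continuous : forall i,
    {within chart i @` chart_dom i, continuous (param i)};
  transition_smooth : forall i j b,
    Ck None (chart i @` (chart_dom i `&` chart_dom j))
      (fun y => chart j (param i y) 0 b);
  transition_oriented : forall i j x, chart_dom i x -> chart_dom j x ->
    0 < \det ('J (chart j \o param i) (chart i x))
}.

Variables (M : ptopologicalType) (I : Type) (X : oriented_atlas M I).

Definition img (i : I) : set E := chart X i @` chart_dom X i.

Definition Jac (i j : I) (x : M) : 'M[R]_4 :=
  'J (chart X j \o param X i) (chart X i x).

(* The Hausdorff dimension of a subset of a manifold, for the bi-Lipschitz
   structure defined by the charts (the one of any Riemannian distance). *)
Definition manifold_hausdorff_dim (Z : set M) : \bar R :=
  ereal_sup [set hausdorff_dim (chart X i @` (Z `&` chart_dom X i)) |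
    i in [set: I]].

(* [metric i y] is the Gram matrix at [y] of the coordinate frame of the i-th
   chart. *)
Record riemannian_metric (r : regularity) := RiemannianMetric {
  metric :> I -> E -> 'M[R]_4;
  metric_sym : forall i y, img i y -> (metric i y)^T = metric i y;
  metric_pos : forall i y (v : 'rV[R]_4), img i y -> v != 0 ->
    0 < (v *m metric i y *m v^T) 0 0;
  metric_Ck : forall i a b, Ck r (img i) (fun y => metric i y a b);
  metric_change : forall i j x, chart_dom X i x -> chart_dom X j x ->
    metric i (chart X i x) =
      Jac i j x *m metric j (chart X j x) *m (Jac i j x)^T
}.

(* A Hermitian line bundle trivialized by unitary frames e_i over the domains
   of the atlas: e_j = tf i j e_i, with values of [tf] in the unit circle.
   As the atlas is arbitrary, the charts may always be taken so small that a
   given bundle is trivial over each of them. *)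
Record hermitian_line_bundle := HermitianLineBundle {
  tf : I -> I -> M -> C;
  tf_unitary : forall i j x, chart_dom X i x -> chart_dom X j x ->
    tf i j x * (tf i j x)^*%C = 1;
  tf_cocycle : forall i j k x,
    chart_dom X i x -> chart_dom X j x -> chart_dom X k x ->
    tf i j x * tf j k x = tf i k x;
  tf_smooth : forall i j,
    CkC None (chart X i @` (chart_dom X i `&` chart_dom X j))
      (fun y => tf i j (param X i y))
}.

Variable S : hermitian_line_bundle.

(* A^0(S): the component s_i of a section is defined by s = s_i e_i. *)
Record form0 (k : regularity) := Form0 {
  form0_val :> I -> E -> C;
  form0_Ck : forall i, CkC k (img i) (form0_val i);
  form0_change : forall i j x, chart_dom X i x -> chart_dom X j x ->
    form0_val i (chart X i x) = tf S i j x * form0_val j (chart X j x)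
}.

(* A^1(S): beta = (sum_a beta_{i,a} dy^a) e_i in the i-th chart. *)
Record form1 (k : regularity) := Form1 {
  form1_val :> I -> E -> 'rV[C]_4;
  form1_Ck : forall i a, CkC k (img i) (fun y => form1_val i y 0 a);
  form1_change : forall i j x, chart_dom X i x -> chart_dom X j x ->
    form1_val i (chart X i x) =
      tf S i j x *: (form1_val j (chart X j x) *m (RtoC_mx (Jac i j x))^T)
}.

(* A unitary connection is d + A_i in the frame e_i, where A_i is a 1-form
   with purely imaginary values; the last axiom is the change of gauge
   A_i = A_j - u^-1 du for u = tf i j. *)
Record unitary_connection (k : regularity) := UnitaryConnection {
  conn :> I -> E -> 'rV[C]_4;
  conn_unitary : forall i y a, img i y -> (conn i y 0 a)^*%C = - conn i y 0 a;
  conn_Ck : forall i a, CkC k (img i) (fun y => conn i y 0 a);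
  conn_change : forall i j x a, chart_dom X i x -> chart_dom X j x ->
    conn i (chart X i x) 0 a =
      (conn j (chart X j x) *m (RtoC_mx (Jac i j x))^T) 0 a
      - (tf S i j x)^-1 * pdC a (fun y => tf S i j (param X i y)) (chart X i x)
}.

(* 2-forms are represented by the skew-symmetric matrices of their
   components. *)

Definition curvature k (sigma : unitary_connection k) (i : I) (y : E)
    : 'M[C]_4 :=
  \matrix_(a, b) (pdC a (fun z => sigma i z 0 b) y
                  - pdC b (fun z => sigma i z 0 a) y).

Definition flat k (sigma : unitary_connection k) : Prop :=
  forall i x, chart_dom X i x -> curvature sigma i (chart X i x) = 0.

Definition vanishing_locus k (sigma : unitary_connection k) : set M :=
  [set x | forall i, chart_dom X i x -> curvature sigma i (chart X i x) = 0].

Definition dsigma0 k l (sigma : unitary_connection k) (f : form0 l)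
    (i : I) (y : E) : 'rV[C]_4 :=
  \row_a (pdC a (f i) y + sigma i y 0 a * f i y).

Definition dsigma1 k l (sigma : unitary_connection k) (beta : form1 l)
    (i : I) (y : E) : 'M[C]_4 :=
  \matrix_(a, b) (pdC a (fun z => beta i z 0 b) y
                  - pdC b (fun z => beta i z 0 a) y
                  + (sigma i y 0 a * beta i y 0 b
                     - sigma i y 0 b * beta i y 0 a)).

(* (star w)_{ab} = 1/2 sqrt(det G) eps_{abcd} w^{cd} with indices raised by G;
   the permutation s enumerates the (a, b, c, d) with eps_{abcd} <> 0. *)
Definition hodge (G : 'M[R]_4) (w : 'M[C]_4) : 'M[C]_4 :=
  let w' := RtoC_mx (invmx G) *m w *m RtoC_mx (invmx G) in
  \matrix_(a, b) ((Num.sqrt (\det G) / 2)%:C *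
    \sum_(s : 'S_4 | (s (inord 0) == a) && (s (inord 1) == b))
       (-1) ^+ s * w' (s (inord 2)) (s (inord 3))).

Definition selfdual_part (G : 'M[R]_4) (w : 'M[C]_4) : 'M[C]_4 :=
  2^-1 *: (w + hodge G w).

Definition anti_selfdual r k (g : riemannian_metric r)
    (sigma : unitary_connection k) : Prop :=
  forall i x, chart_dom X i x ->
    selfdual_part (g i (chart X i x)) (curvature sigma i (chart X i x)) = 0.

Definition dsigma_plus r k l (g : riemannian_metric r)
    (sigma : unitary_connection k) (beta : form1 l) (i : I) (y : E) : 'M[C]_4 :=
  selfdual_part (g i y) (dsigma1 sigma beta i y).

Definition borel_type := g_sigma_algebraType (@open M).

(* The Riemannian measure: sqrt(det g) dy^0 dy^1 dy^2 dy^3 in every chart.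
   It is unique, and it is finite when M is compact. *)
Definition lebesgue4 : set (R * R * (R * R)) -> \bar R :=
  (((@lebesgue_measure R) \x (@lebesgue_measure R)) \x
   ((@lebesgue_measure R) \x (@lebesgue_measure R)))%E.

Definition row4 (t : R * R * (R * R)) : E :=
  \row_a [:: t.1.1; t.1.2; t.2.1; t.2.2]`_a.

Definition is_riemannian_measure r (g : riemannian_metric r)
    (vol : {measure set borel_type -> \bar R}) : Prop :=
  forall i (B : set borel_type), measurable B -> B `<=` chart_dom X i ->
    vol B = (\int[lebesgue4]_(t in row4 @^-1` (chart X i @` B))
               (Num.sqrt (\det (g i (row4 t))))%:E)%E.

Definition integralC (vol : {measure set borel_type -> \bar R}) (f : M -> C)
    : C :=
  (Rintegral vol setT (fun x : borel_type => complex.Re (f x))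
   +i* Rintegral vol setT (fun x : borel_type => complex.Im (f x)))%C.

(* Pointwise Hermitian products, computed in the chart selected at each point
   (they do not depend on the chart). *)
Definition herm0 (f h : I -> E -> C) (x : M) : C :=
  let i := chart_at X x in let y := chart X i x in f i y * (h i y)^*%C.

Definition herm1 r (g : riemannian_metric r) (al be : I -> E -> 'rV[C]_4)
    (x : M) : C :=
  let i := chart_at X x in let y := chart X i x in
  (al i y *m RtoC_mx (invmx (g i y)) *m (map_mx (@conjc R) (be i y))^T) 0 0.

(* [u] is the value at [beta] of the formal adjoint of d_sigma : A^0 -> A^1. *)
Definition is_dsigma_star r k l (g : riemannian_metric r)
    (vol : {measure set borel_type -> \bar R})
    (sigma : unitary_connection k) (beta : form1 l) (u : I -> E -> C) : Prop :=
  forall f : form0 l,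
    integralC vol (herm1 g (dsigma0 sigma f) beta) =
    integralC vol (herm0 f u).

End Manifold.

(* Main.v *)
Require Import Defs.
From HB Require Import structures.
From mathcomp Require Import all_boot all_order all_algebra all_fingroup.
From mathcomp Require Import complex.
From mathcomp Require Import all_classical all_reals all_analysis.
From mathcomp Require Import ring lra.

Set Implicit Arguments.
Unset Strict Implicit.
Unset Printing Implicit Defensive.

Import Order.TTheory GRing.Theory Num.Theory.
Import numFieldNormedType.Exports.

Local Open Scope classical_set_scope.
Local Open Scope complex_scope.
Local Open Scope ring_scope.

(** Where F := F_sigma does not vanish, write d_sigma beta = F zeta.  The Bianchi
    identity gives F /\ (d_sigma zeta - beta) = 0, and wedging with a nonzero
    anti-selfdual form is injective on 1-forms, so d_sigma zeta = beta there.  As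
    sigma is unitary, |d ln(1 + |zeta|^2)| <= |beta|; and since the zero set Z of F
    is H^3-null, almost every segment avoids it, so that zeta is bounded and then
    Lipschitz off Z.  Its continuous extension satisfies d_sigma zeta = beta
    everywhere (again by integrating along segments avoiding Z), hence is as regular
    as beta and may be used as a test section for d_sigma^* beta = 0: the integral of
    |beta|^2 vanishes.  *)

(** * Differential calculus on R^4 *)

(** The obstacle is that [zeta] is a quotient by [F] and may a priori blow up at the zeros of [F].
    The equation [d zeta = beta - A zeta] bounds the gradient only in terms of [zeta] itself;
    passing to the logarithm turns this into a bound independent of [zeta], so that one value off
    [Z] controls all nearby ones. The dimension enters through one count. Translating [Z] along all
    points of a segment raises its dimension by at most one, and dimension at most 2 leaves an
    exponent [s < 3], so the swept set is Lebesgue-null in dimension 4. Arbitrarily small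
    translations thus free any segment from [Z]; as both ends move by the same vector, the increment
    is unchanged and mean value estimates survive in the limit. Extending [zeta] across [Z] is
    forced by the meaning of [d_sigma^* beta = 0]: it is only known against global sections of the
    same class as [beta]. The quotient loses a derivative, and the equation [d_sigma zeta = beta]
    gives it back. Injectivity of the wedge product comes from the matrix form of anti-selfduality:
    a nonzero imaginary anti-selfdual form is invertible, its product with the metric dual being a
    nonzero scalar. *)

Section DirectionalDerivatives.
Variable R : realType.
Local Notation E := 'rV[R]_4.
Local Notation C := R[i].
Local Notation e_ a := (delta_mx 0 a : E).

Lemma ler_coord_norm (x : E) a : `|x 0 a| <= `|x|.
Proof.
rewrite [leRHS]/Num.Def.normr/= mx_normrE.
exact: (le_bigmax _ (fun i => `|x i.1 i.2|) (0, a)).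
Qed.

Lemma norm_rV_le (x : E) (r : R) : 0 <= r ->
  (forall a, `|x 0 a| <= r) -> `|x| <= r.
Proof.
move=> r0 h; rewrite [leLHS]/Num.Def.normr/= mx_normrE.
by apply: bigmax_le => //= -[i a] _ /=; rewrite (ord1 i).
Qed.

Lemma norm_rV_lt (x : E) (r : R) : 0 < r ->
  (forall a, `|x 0 a| < r) -> `|x| < r.
Proof.
move=> r0 h; rewrite [ltLHS]/Num.Def.normr/= mx_normrE.
by apply: bigmax_lt => //= -[i a] _ /=; rewrite (ord1 i).
Qed.

Lemma norm_delta (a : 'I_4) : `|e_ a| <= 1.
Proof.
by apply: norm_rV_le => // b; rewrite !mxE /=; case: eqP; rewrite ?normr1 ?normr0.
Qed.

Lemma continuous_sumR (T : topologicalType) (J : Type) (r : seq J) (P : pred J)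
    (F : J -> T -> R) x :
  (forall i, P i -> {for x, continuous (F i)}) ->
  {for x, continuous (fun y => \sum_(i <- r | P i) F i y)}.
Proof.
move=> H; exact: (@cvg_big R J +%R 0 P (@add_continuous R) T (nbhs x) r
  (fun i => F i) (F ^~ x) _ H).
Qed.

Lemma continuous_prodR (T : topologicalType) (J : Type) (r : seq J) (P : pred J)
    (F : J -> T -> R) x :
  (forall i, P i -> {for x, continuous (F i)}) ->
  {for x, continuous (fun y => \prod_(i <- r | P i) F i y)}.
Proof.
move=> H; exact: (@cvg_big R J *%R 1 P (@mul_continuous R) T (nbhs x) r
  (fun i => F i) (F ^~ x) _ H).
Qed.

Lemma is_derive_line (f : E -> R) (x v : E) (t : R) :
  derivable f (x + t *: v) v ->
  is_derive t (1 : R) (fun s : R => f (x + s *: v)) ('D_v f (x + t *: v)).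
Proof.
move=> df; have H : (fun h : R => h^-1 *: (f (h *: v + (x + t *: v)) - f (x + t *: v)))
  = (fun h : R => h^-1 *: (f (x + (h *: (1 : R) + t) *: v) - f (x + t *: v))).
  apply/funext => h; congr (_ *: (f _ - _)).
  by rewrite scalerDl [h *: (1 : R)]mulr1 addrCA.
by apply: DeriveDef; rewrite /derivable /derive -H.
Qed.

Lemma line_MVT (f : E -> R) (x v : E) :
  (forall t : R, 0 <= t <= 1 -> derivable f (x + t *: v) v) ->
  exists2 t : R, 0 <= t <= 1 & f (x + v) - f x = 'D_v f (x + t *: v).
Proof.
move=> df; pose g (s : R) := f (x + s *: v).
have dg (t : R) : 0 <= t <= 1 -> is_derive t 1 g ('D_v f (x + t *: v)).
  by move=> ht; apply: is_derive_line; exact: df.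
have [||t ht] := @MVT_segment R g (fun t => 'D_v f (x + t *: v)) 0 1 ler01.
- by move=> t /[!in_itv] /= /andP[t0 t1]; apply: dg; rewrite !ltW.
- apply: derivable_within_continuous => t; rewrite in_itv /= => ht.
  exact: (@ex_derive _ _ _ _ _ _ _ (dg t ht)).
rewrite /g scale1r scale0r addr0 subr0 mulr1 => e.
by exists t => //; move: ht; rewrite in_itv.
Qed.

(** Mere derivability along [v] gives no additivity in the direction, but it gives homogeneity: the
    factor [c] is absorbed by reparametrizing the line. *)
Lemma deriveZv (f : E -> R) (y v : E) (c : R) : derivable f y v ->
  derivable f y (c *: v) /\ 'D_(c *: v) f y = c * 'D_v f y.
Proof.
have [->|c0] := eqVneq c 0.
  by rewrite scale0r mul0r; split; [exact: derivable0 | exact: derive0].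
move=> dfy.
have H := (is_derive_line (x := y) (v := v) (t := 0)).
rewrite scale0r addr0 in H; have {}H := H f dfy.
have dl : is_derive (0 : R) (1 : R) ( *%R c) c.
  have -> : ( *%R c) = (c *: id) by apply/funext => t.
  by apply: is_derive_eq; rewrite [_%:A]mulr1.
have H2 : is_derive (0 : R) (1 : R) (fun s : R => f (y + s *: (c *: v))) (c * 'D_v f y).
  have -> : (fun s : R => f (y + s *: (c *: v))) =
      (fun s : R => f (y + s *: v)) \o *%R c.
    by apply/funext => t; rewrite /= scalerA mulrC.
  rewrite mulrC; apply: is_derive1_comp; rewrite mulr0; exact: H.
have E1 : (fun h : R => h^-1 *: (f (h *: (c *: v) + y) - f y))
  = (fun h : R => h^-1 *: (f (y + (h *: (1 : R) + 0) *: (c *: v))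
                           - f (y + 0 *: (c *: v)))).
  apply/funext => h; congr (_ *: (f _ - f _)); last by rewrite scale0r addr0.
  by rewrite addr0 [h *: (1 : R)]mulr1 addrC.
by case: H2 => d1 d2; split; rewrite /derivable /derive E1.
Qed.

Lemma coord_linear_is_linear (c : E) : linear (fun h : E => \sum_a h 0 a * c 0 a : R).
Proof.
move=> k u v; rewrite /= scaler_sumr -big_split /=; apply: eq_bigr => a _.
by rewrite !mxE mulrDl /GRing.scale /= mulrA.
Qed.

Lemma diff_of_small (g : E -> R) (y : E) :
  (forall eps, 0 < eps -> \forall h \near (0 : E), `|g (h + y) - g y| <= eps * `|h|) ->
  differentiable g y /\ 'd g y = (fun=> 0) :> (E -> R).
Proof.
move=> H; pose z : {linear E -> R} := \0.
have cz : continuous z by exact: (@cst_continuous _ _ (0 : R)).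
have eqo : g \o shift y = cst (g y) + z +o_ (0 : E) id.
  apply/eqaddoP => eps e0; near=> h.
  rewrite [X in `|X|](_ : _ = g (h + y) - g y); last by rewrite /z !fctE /= addr0.
  by near: h; exact: H.
have dz := diff_unique cz eqo.
split=> //; apply/diff_locallyP; split; first by rewrite dz.
by rewrite dz.
Unshelve. all: by end_near. Qed.

(** Subtracting the linear form with coefficients [c], which is continuous, reduces the claim to a
    zero differential. *)
Lemma diff_of_linear_approx (f : E -> R) (y c : E) :
  (forall eps, 0 < eps -> \forall h \near (0 : E),
     `|f (h + y) - f y - \sum_a h 0 a * c 0 a| <= eps * `|h|) ->
  differentiable f y /\ forall a, pd a f y = c 0 a.
Proof.
pose l0 (h : E) : R := \sum_a h 0 a * c 0 a.
pose lM := GRing.isLinear.Build _ _ _ _ l0 (coord_linear_is_linear c).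
pose l : {linear E -> R} := HB.pack l0 lM.
have cl : continuous l.
  move=> x; apply: (continuous_sumR (F := fun a (h : E) => h 0 a * c 0 a)) => a _.
  by apply: continuousM; [exact: (@coord_continuous R 1 4 0 a) | exact: cst_continuous].
move=> H.
pose g := f - (l : E -> R).
have [dg g0] : differentiable g y /\ 'd g y = (fun=> 0) :> (E -> R).
  apply: diff_of_small => eps e0; near=> h.
  have -> : g (h + y) - g y = f (h + y) - f y - \sum_a h 0 a * c 0 a.
    have gE x : g x = f x - l x by [].
    rewrite !gE linearD -[\sum_a _]/(l h); ring.
  by near: h; exact: H.
have dl : differentiable l y by exact: linear_differentiable.
have fE : f = g + l by rewrite /g subrK.
have df : differentiable f y by rewrite fE; exact: differentiableD.
split=> // a; rewrite /pd deriveE // fE (diffD dg dl) /= g0 add0r.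
rewrite [X in X _ = _](diff_lin y cl).
rewrite /l /= /l0 (bigD1 a) //= big1 ?addr0 ?mxE ?eqxx ?mul1r// => b /negPf ba.
by rewrite mxE ba andbF mul0r.
Unshelve. all: by end_near. Qed.

End DirectionalDerivatives.

(** * Continuous partial derivatives: differentiability and symmetry of second derivatives *)

Section PartialDerivatives.
Variable R : realType.
Local Notation E := 'rV[R]_4.
Local Notation C := R[i].
Local Notation e_ a := (delta_mx 0 a : E).

Lemma axis_MVT (f : E -> R) (x : E) (a : 'I_4) (s : R) :
  (forall t : R, 0 <= t <= 1 -> derivable f (x + (t * s) *: e_ a) (e_ a)) ->
  exists2 t : R, 0 <= t <= 1 &
    f (x + s *: e_ a) - f x = s * pd a f (x + (t * s) *: e_ a).
Proof.
move=> df.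
have [|t t01 ->] := @line_MVT R f x (s *: e_ a).
  by move=> t t01; rewrite scalerA; apply: (deriveZv s (df t t01)).1.
by exists t => //; rewrite scalerA (deriveZv s (df t t01)).2.
Qed.

(** A staircase from [y] at [j = 0] to [h + y] at [j = 4] that moves one coordinate at a time, so
    that only partial derivatives are met. *)
Let step (y h : E) (j : nat) : E := \row_a (y 0 a + (if (a < j)%N then h 0 a else 0)).

Let stepS y h (j : 'I_4) : step y h j.+1 = step y h j + h 0 j *: e_ j.
Proof.
apply/rowP => a; rewrite !mxE /= ltnS leq_eqVlt.
have [->|ne] := eqVneq a j; first by rewrite eqxx ltnn /= addr0 mulr1.
by rewrite (negPf ne : (a == j :> nat) = false) /= mulr0 addr0.
Qed.

Let step_near y h (j : 'I_4) (t : R) : 0 <= t <= 1 ->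
  `|step y h j + (t * h 0 j) *: e_ j - y| <= `|h|.
Proof.
move=> /andP[t0 t1]; apply: norm_rV_le => // a; rewrite !mxE /=.
have [->|ne] := eqVneq a j.
  rewrite ltnn /= addr0 mulr1 addrAC subrr add0r normrM ger0_norm //.
  by rewrite (le_trans _ (ler_coord_norm h j)) // ler_piMl.
rewrite mulr0 addr0 addrAC subrr add0r.
by case: ifP => _; rewrite ?normr0 ?ler_coord_norm.
Qed.

(** The increment telescopes along the staircase [step], and the mean value theorem applies to each
    edge; the factor 4 counts the edges. *)
Lemma increment_bound (f : E -> R) (c y : E) (r eps : R) :
  (forall z, `|z - y| < r -> forall a,
     derivable f z (e_ a) /\ `|pd a f z - c 0 a| <= eps) ->
  forall h, `|h| < r ->
    `|f (h + y) - f y - \sum_a h 0 a * c 0 a| <= 4 * eps * `|h|.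
Proof.
move=> H h hr.
have s0 : step y h 0 = y by apply/rowP => a; rewrite !mxE ltn0 addr0.
have s4 : step y h 4 = h + y by apply/rowP => a; rewrite !mxE ltn_ord addrC.
have -> : f (h + y) - f y - \sum_a h 0 a * c 0 a =
    \sum_(j < 4) (f (step y h j.+1) - f (step y h j) - h 0 j * c 0 j).
  rewrite sumrB -(big_mkord xpredT (fun j => f (step y h j.+1) - f (step y h j))).
  by rewrite (telescope_sumr (fun j => f (step y h j))) // s0 s4.
apply: (le_trans (ler_norm_sum _ _ _)).
have -> : 4 * eps * `|h| = \sum_(j < 4) eps * `|h|.
  by rewrite sumr_const card_ord -mulrA mulr_natl.
apply: ler_sum => j _.
have nr t : 0 <= t <= 1 -> `|step y h j + (t * h 0 j) *: e_ j - y| < r.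
  by move=> t01; exact: le_lt_trans (step_near _ _ _ t01) hr.
rewrite stepS; have [|t t01 ->] := @axis_MVT f (step y h j) j (h 0 j).
  by move=> t t01; exact: (H _ (nr _ t01) j).1.
rewrite -mulrBr normrM mulrC.
by apply: ler_pM => //; [exact: (H _ (nr _ t01) j).2 | exact: ler_coord_norm].
Qed.

Lemma diff_of_pd (f : E -> R) (y : E) :
  (\forall z \near y, forall a, derivable f z (e_ a)) ->
  (forall a, {for y, continuous (pd a f)}) -> differentiable f y.
Proof.
move=> df cf; pose c : E := \row_a pd a f y.
suff H : forall eps, 0 < eps -> \forall h \near (0 : E),
     `|f (h + y) - f y - \sum_a h 0 a * c 0 a| <= eps * `|h|.
  by have [] := diff_of_linear_approx H.
move=> eps e0.
have e4 : 0 < eps / 4 by rewrite divr_gt0.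
have : \forall z \near y, forall a, derivable f z (e_ a) /\ `|pd a f z - c 0 a| <= eps / 4.
  apply: (@filter_forall E _
      (fun a z => derivable f z (e_ a) /\ `|pd a f z - c 0 a| <= eps / 4) (nbhs y)) => a.
  near=> z; split.
    by near: z; apply: filterS df => z; apply.
  rewrite mxE distrC; near: z.
  by have /cvgrPdist_le := cf a; apply.
move=> /nbhs_ballP[r /= r0 br].
near=> h.
have hr : `|h| < r.
  near: h; apply/nbhs_ballP; exists r => //= h.
    by rewrite -ball_normE /= sub0r normrN.
rewrite (_ : eps * _ = 4 * (eps / 4) * `|h|); last by field.
apply: (increment_bound (r := r)) => // z zr; apply: br.
by rewrite -ball_normE /= distrC.
Unshelve. all: by end_near. Qed.

Lemma Cn1_differentiable (n : nat) (U : set E) (f : E -> R) (y : E) :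
  open U -> Cn n.+1 U f -> U y -> differentiable f y.
Proof.
move=> oU [cf [df cdf]] Uy; apply: diff_of_pd.
  apply: filterS (open_nbhs_nbhs (conj oU Uy)) => z Uz a; exact: df.
by move=> a; case: n cdf => [|n] /(_ a) [] /(_ y Uy).
Qed.

Lemma pd_diff (f : E -> R) (y v : E) : differentiable f y ->
  'd f y v = \sum_a v 0 a * pd a f y.
Proof.
move=> df; rewrite [v in LHS](_ : v = \sum_a v 0 a *: e_ a); last first.
  by rewrite {1}[v]row_sum_delta.
by rewrite linear_sum; apply: eq_bigr => a _; rewrite linearZ /= /pd deriveE.
Qed.

Lemma derive_pd (f : E -> R) (y v : E) : differentiable f y ->
  'D_v f y = \sum_a v 0 a * pd a f y.
Proof. by move=> df; rewrite deriveE // pd_diff. Qed.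

Lemma near_pair (U : set E) (p q : E -> R) (y : E) (eps : R) :
  open U -> U y -> {for y, continuous p} -> {for y, continuous q} -> 0 < eps ->
  exists2 r, 0 < r & forall z, `|z - y| < r ->
    U z /\ (`|p z - p y| <= eps /\ `|q z - q y| <= eps).
Proof.
move=> oU Uy /cvgrPdist_le cp /cvgrPdist_le cq e0.
have : \forall z \near y, U z /\ (`|p y - p z| <= eps /\ `|q y - q z| <= eps).
  exact: filterI (open_nbhs_nbhs (conj oU Uy)) (filterI (cp _ e0) (cq _ e0)).
move=> /nbhs_ballP[r /= r0 br].
exists r => // z zr; have [|Uz [pz qz]] := br z; first by rewrite -ball_normE /= distrC.
by split=> //; rewrite [`|p z - _|]distrC [`|q z - _|]distrC.
Qed.

(* Both mixed derivatives are limits of the same second difference quotient. *)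
Lemma pd_comm (U : set E) (f : E -> R) (y : E) a b :
  open U -> Cn 2 U f -> U y -> pd a (pd b f) y = pd b (pd a f) y.
Proof.
move=> oU cf Uy.
suff key : forall eps, 0 < eps -> `|pd a (pd b f) y - pd b (pd a f) y| <= eps + eps.
  apply/eqP; rewrite -subr_eq0 -normr_le0; apply/ler_addgt0Pl => eps e0.
  by rewrite addr0 (le_trans (key _ (_ : 0 < eps / 2))) ?divr_gt0 // -splitr.
move=> eps e0.
have [_ [df cdf]] := cf.
have nbU : \forall z \near y, U z by exact: open_nbhs_nbhs.
have cc a' b' : {for y, continuous (pd a' (pd b' f))}.
  by have [_ [_ /(_ a')[+ _]]] := cdf b'; exact.
have [r r0 br] := near_pair oU Uy (cc a b) (cc b a) e0.
pose s := r / 3; have s0 : 0 < s by rewrite divr_gt0.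
have in_ball (u v : R) a' b' : 0 <= u <= 1 -> 0 <= v <= 1 ->
    `|y + (u * s) *: e_ a' + (v * s) *: e_ b' - y| < r.
  move=> /andP[u0 u1] /andP[v0 v1].
  rewrite -[y + _ + _]addrA [y + _]addrC addrK.
  have sr : s + s < r by rewrite /s; lra.
  apply: le_lt_trans sr; apply: (le_trans (ler_normD _ _)).
  have aux (w : R) c : 0 <= w -> w <= 1 -> `|(w * s) *: e_ c| <= s.
    move=> w0 w1; rewrite normrZ (ger0_norm (mulr_ge0 w0 (ltW s0))) -[leRHS]mulr1.
    apply: ler_pM => //; first by rewrite mulr_ge0 // ltW.
      by rewrite ler_piMl // ltW.
    exact: norm_delta.
  by apply: lerD; exact: aux.
(* The mean value theorem is used twice: in direction [a'] for the increment of [f] by [s *: e_ b'],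
   then in direction [b'] for [pd a' f]. Exchanging [a'] and [b'] only reorders the four values of
   [f]. *)
have quot a' b' : exists z, `|z - y| < r /\
   f (y + s *: e_ a' + s *: e_ b') - f (y + s *: e_ a') - (f (y + s *: e_ b') - f y) =
   s * s * pd b' (pd a' f) z.
  pose g := fun z => f (z + s *: e_ b') - f z.
  have i01 : 0 <= (1 : R) <= 1 by rewrite ler01 lexx.
  have i00 : 0 <= (0 : R) <= 1 by rewrite ler01 lexx.
  have dsh z : derivable f (z + s *: e_ b') (e_ a') ->
     is_derive z (e_ a') (fun w => f (w + s *: e_ b')) (pd a' f (z + s *: e_ b')).
    move=> d.
    have HE : (fun h : R => h^-1 *: (f (h *: e_ a' + z + s *: e_ b') - f (z + s *: e_ b')))
       = (fun h : R => h^-1 *: (f (h *: e_ a' + (z + s *: e_ b')) - f (z + s *: e_ b'))).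
      by apply/funext => h; rewrite addrA.
    by apply: DeriveDef; rewrite /derivable /derive /= HE.
  have [t t01|t t01] := @axis_MVT g y a' s.
    apply: derivableB; last first.
      apply: df; have [] := br (y + (t * s) *: e_ a') => //.
      by have := in_ball t 0 a' b' t01 i00; rewrite mul0r scale0r addr0.
    apply: (@ex_derive _ _ _ _ _ _ _ (dsh _ _)); apply: df.
    by have := in_ball t 1 a' b' t01 i01; rewrite mul1r => /br [].
  rewrite /g => gE.
  have pgE : pd a' g (y + (t * s) *: e_ a') = pd a' f (y + (t * s) *: e_ a' + s *: e_ b')
      - pd a' f (y + (t * s) *: e_ a').
    rewrite /g /pd.
    have d1 : is_derive (y + (t * s) *: e_ a') (e_ a') (fun w => f (w + s *: e_ b'))
        (pd a' f (y + (t * s) *: e_ a' + s *: e_ b')).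
      apply: dsh; apply: df.
      by have := in_ball t 1 a' b' t01 i01; rewrite mul1r => /br [].
    have d2 : derivable f (y + (t * s) *: e_ a') (e_ a').
      apply: df; have [] := br (y + (t * s) *: e_ a') => //.
      by have := in_ball t 0 a' b' t01 i00; rewrite mul0r scale0r addr0.
    rewrite (deriveB (@ex_derive _ _ _ _ _ _ _ d1) d2).
    by rewrite (@derive_val _ _ _ _ _ _ _ d1).
  have [_ [df' _]] := cdf a'.
  have [u u01|u u01 uE] := @axis_MVT (pd a' f) (y + (t * s) *: e_ a') b' s.
    by apply: df'; have /br [] := in_ball t u a' b' t01 u01.
  exists (y + (t * s) *: e_ a' + (u * s) *: e_ b'); split; first exact: in_ball.
  by rewrite gE pgE uE mulrA.
have [z1 [/br[_ [z1r _]] q1]] := quot b a.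
have [z2 [/br[_ [_ z2r]] q2]] := quot a b.
have eq12 : pd a (pd b f) z1 = pd b (pd a f) z2.
  have ss : s * s != 0 by rewrite mulf_neq0 ?gt_eqF.
  move: q1 q2; rewrite [y + s *: e_ b + _]addrAC.
  move: (pd a (pd b f) z1) (pd b (pd a f) z2) => A B q1 q2.
  by apply: (mulfI ss); rewrite -q1 -q2; ring.
move: z1r z2r; rewrite eq12.
move: (pd a (pd b f) y) (pd b (pd a f) y) (pd b (pd a f) z2) => A B D h1 h2.
have -> : A - B = (D - B) - (D - A) by ring.
by apply: (le_trans (ler_normB _ _)); exact: lerD.
Qed.

End PartialDerivatives.

(** * The classes C^n on an open set *)

Section CnTheory.
Variable R : realType.
Local Notation E := 'rV[R]_4.
Local Notation C := R[i].
Local Notation e_ a := (delta_mx 0 a : E).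
Implicit Types (f g : E -> R) (U V : set E).

Lemma CnS n U f : Cn n.+1 U f -> Cn n U f.
Proof.
elim: n f => [|n IH] f [cf [df cdf]]; split=> //.
by split=> // a; exact: IH.
Qed.

Lemma Cn_continuous n U f y : Cn n U f -> U y -> {for y, continuous f}.
Proof. by case: n => [|n] [cf _]; exact: cf. Qed.

Lemma Cn_subset n U V f : V `<=` U -> Cn n U f -> Cn n V f.
Proof.
move=> VU; elim: n f => [|n IH] f [cf H]; first by split=> // y /VU; exact: cf.
split=> [y /VU|]; first exact: cf.
by case: H => df cdf; split=> [a y /VU|a]; [exact: df | exact: IH (cdf a)].
Qed.

Lemma pd_near f g y a : {near y, f =1 g} -> pd a f y = pd a g y.
Proof. exact: near_eq_derive. Qed.

Lemma near_open U f g y : open U -> U y -> (forall z, U z -> f z = g z) ->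
  {near y, f =1 g}.
Proof.
by move=> oU Uy fg; apply: filterS (open_nbhs_nbhs (conj oU Uy)) => z; exact: fg.
Qed.

Lemma continuous_near (T : topologicalType) (g : E -> T) (h : E -> T) y :
  {near y, h =1 g} -> {for y, continuous h} -> {for y, continuous g}.
Proof.
move=> hg ch; rewrite /prop_for /continuous_at -(nbhs_singleton hg).
exact: cvg_trans (near_eq_cvg hg) ch.
Qed.

Lemma Cn_ext n U f g : open U -> (forall y, U y -> f y = g y) ->
  Cn n U f -> Cn n U g.
Proof.
move=> oU; elim: n f g => [|n IH] f g fg [cf H].
  by split=> // y Uy; apply: continuous_near (cf y Uy); exact: near_open oU Uy fg.
split=> [y Uy|].
  by apply: continuous_near (cf y Uy); exact: near_open oU Uy fg.
case: H => df cdf; split=> [a y Uy|a].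
  by apply: near_eq_derivable (df a y Uy); exact: near_open oU Uy fg.
by apply: IH (cdf a) => y Uy; apply: pd_near; exact: near_open oU Uy fg.
Qed.

Lemma Cn_cst n U (c : R) : Cn n U (fun=> c).
Proof.
elim: n c => [|n IH] c; first by split=> // y _; exact: cst_continuous.
split=> [y _|]; first exact: cst_continuous.
split=> [a y _|a]; first exact: derivable_cst.
rewrite (_ : pd a _ = fun=> 0) //; apply/funext => y; exact: derive_cst.
Qed.

Lemma CnD n U f g : open U -> Cn n U f -> Cn n U g -> Cn n U (fun y => f y + g y).
Proof.
move=> oU; elim: n f g => [|n IH] f g [cf Hf] [cg Hg].
  by split=> // y Uy; apply: continuousD; [exact: cf | exact: cg].
split=> [y Uy|]; first by apply: continuousD; [exact: cf | exact: cg].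
case: Hf Hg => df cdf [dg cdg]; split=> [a y Uy|a].
  by apply: derivableD; [exact: df | exact: dg].
apply: Cn_ext (IH _ _ (cdf a) (cdg a)) => // y Uy.
by rewrite /pd -deriveD //; [exact: df | exact: dg].
Qed.

Lemma CnM n U f g : open U -> Cn n U f -> Cn n U g -> Cn n U (fun y => f y * g y).
Proof.
move=> oU; elim: n f g => [|n IH] f g Hf Hg.
  by split=> // y Uy; apply: continuousM; [exact: Hf.1 | exact: Hg.1].
have [cf [df cdf]] := Hf; have [cg [dg cdg]] := Hg.
split=> [y Uy|]; first by apply: continuousM; [exact: cf | exact: cg].
split=> [a y Uy|a]; first by apply: derivableM; [exact: df | exact: dg].
apply: Cn_ext (CnD oU (IH _ _ (CnS Hf) (cdg a)) (IH _ _ (CnS Hg) (cdf a))) => // y Uy.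
exact: esym (deriveM (df a y Uy) (dg a y Uy)).
Qed.

Lemma CnN n U f : open U -> Cn n U f -> Cn n U (fun y => - f y).
Proof.
move=> oU Hf; apply: Cn_ext (CnM oU (Cn_cst n U (-1)) Hf) => // y _.
by rewrite mulN1r.
Qed.

Lemma CnB n U f g : open U -> Cn n U f -> Cn n U g -> Cn n U (fun y => f y - g y).
Proof. by move=> oU Hf Hg; apply: CnD => //; exact: CnN. Qed.

Lemma CnV n U f : open U -> (forall y, U y -> f y != 0) -> Cn n U f ->
  Cn n U (fun y => (f y)^-1).
Proof.
move=> oU f0; elim: n => [|n IH] Hf.
  by split=> // y Uy; apply: continuousV; [exact: f0 y Uy | exact: Hf.1].
have [cf [df cdf]] := Hf.
split=> [y Uy|]; first by apply: continuousV; [exact: f0 y Uy | exact: cf].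
split=> [a y Uy|a]; first by apply: derivableV; [exact: f0 | exact: df].
have IHf := IH (CnS Hf).
apply: Cn_ext (CnN oU (CnM oU (CnM oU IHf IHf) (cdf a))) => // y Uy.
rewrite -expr2 exprVn -mulNr.
exact: esym (deriveV (f0 y Uy) (df a y Uy)).
Qed.

End CnTheory.

(** * Complex-valued functions of four real variables *)

Section ComplexCalculus.
Variable R : realType.
Local Notation E := 'rV[R]_4.
Local Notation C := R[i].
Local Notation Re := (@complex.Re R).
Local Notation Im := (@complex.Im R).
Local Notation e_ a := (delta_mx 0 a : E).
Implicit Types (f g : E -> C) (U V : set E) (y : E).

Lemma ReD (x y : C) : Re (x + y) = Re x + Re y. Proof. by case: x; case: y. Qed.
Lemma ImD (x y : C) : Im (x + y) = Im x + Im y. Proof. by case: x; case: y. Qed.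
Lemma ReN (x : C) : Re (- x) = - Re x. Proof. by case: x. Qed.
Lemma ImN (x : C) : Im (- x) = - Im x. Proof. by case: x. Qed.
Lemma ReB (x y : C) : Re (x - y) = Re x - Re y. Proof. by rewrite ReD ReN. Qed.
Lemma ImB (x y : C) : Im (x - y) = Im x - Im y. Proof. by rewrite ImD ImN. Qed.
Lemma ReM (x y : C) : Re (x * y) = Re x * Re y - Im x * Im y.
Proof. by case: x; case: y. Qed.
Lemma ImM (x y : C) : Im (x * y) = Re x * Im y + Im x * Re y.
Proof. by case: x; case: y. Qed.
Lemma ReC (c : R) : Re c%:C = c. Proof. by []. Qed.
Lemma ImC (c : R) : Im c%:C = 0. Proof. by []. Qed.
Lemma Re_conj (x : C) : Re x^*%C = Re x. Proof. by case: x. Qed.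
Lemma Im_conj (x : C) : Im x^*%C = - Im x. Proof. by case: x. Qed.
Lemma Re_sum (J : Type) (r : seq J) (P : pred J) (F : J -> C) :
  Re (\sum_(j <- r | P j) F j) = \sum_(j <- r | P j) Re (F j).
Proof. exact: (big_morph Re ReD). Qed.
Lemma Im_sum (J : Type) (r : seq J) (P : pred J) (F : J -> C) :
  Im (\sum_(j <- r | P j) F j) = \sum_(j <- r | P j) Im (F j).
Proof. exact: (big_morph Im ImD). Qed.

Lemma C_ext (x y : C) : Re x = Re y -> Im x = Im y -> x = y.
Proof. by case: x => a b; case: y => c d /= -> ->. Qed.

Definition CnC n U f := Cn n U (Re \o f) /\ Cn n U (Im \o f).

Lemma CkC_CnC k U f : CkC k U f <-> forall n, at_least n k -> CnC n U f.
Proof.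
split=> [[h1 h2] n kn|h]; first by split; [exact: h1 | exact: h2].
by split=> n kn; case: (h n kn).
Qed.

(** Real differentiability, with the complex values regarded as a plane. *)
Definition Cdiff f y := differentiable (Re \o f) y /\ differentiable (Im \o f) y.

Lemma CnC_Cdiff n U f y : open U -> CnC n.+1 U f -> U y -> Cdiff f y.
Proof.
move=> oU [h1 h2] Uy; split; first exact: Cn1_differentiable h1 Uy.
exact: Cn1_differentiable h2 Uy.
Qed.

Lemma CnCS n U f : CnC n.+1 U f -> CnC n U f.
Proof. by case=> h1 h2; split; exact: CnS. Qed.

Lemma CnC_subset n U V f : V `<=` U -> CnC n U f -> CnC n V f.
Proof. by move=> VU [h1 h2]; split; exact: Cn_subset VU _. Qed.

Lemma CnC_ext n U f g : open U -> (forall y, U y -> f y = g y) ->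
  CnC n U f -> CnC n U g.
Proof.
move=> oU fg [h1 h2]; split.
  by apply: Cn_ext h1 => // y Uy /=; rewrite fg.
by apply: Cn_ext h2 => // y Uy /=; rewrite fg.
Qed.

Lemma CnC_cst n U (c : C) : CnC n U (fun=> c).
Proof. by split; exact: Cn_cst. Qed.

Lemma CnCD n U f g : open U -> CnC n U f -> CnC n U g -> CnC n U (fun y => f y + g y).
Proof.
move=> oU [f1 f2] [g1 g2]; split.
  by apply: Cn_ext (CnD oU f1 g1) => // y _ /=; rewrite ReD.
by apply: Cn_ext (CnD oU f2 g2) => // y _ /=; rewrite ImD.
Qed.

Lemma CnCM n U f g : open U -> CnC n U f -> CnC n U g -> CnC n U (fun y => f y * g y).
Proof.
move=> oU [f1 f2] [g1 g2]; split.
  by apply: Cn_ext (CnB oU (CnM oU f1 g1) (CnM oU f2 g2)) => // y _ /=; rewrite ReM.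
by apply: Cn_ext (CnD oU (CnM oU f1 g2) (CnM oU f2 g1)) => // y _ /=; rewrite ImM.
Qed.

Lemma CnCN n U f : open U -> CnC n U f -> CnC n U (fun y => - f y).
Proof.
move=> oU [f1 f2]; split.
  by apply: Cn_ext (CnN oU f1) => // y _ /=; rewrite ReN.
by apply: Cn_ext (CnN oU f2) => // y _ /=; rewrite ImN.
Qed.

Lemma CnCB n U f g : open U -> CnC n U f -> CnC n U g -> CnC n U (fun y => f y - g y).
Proof. by move=> oU hf hg; apply: CnCD => //; exact: CnCN. Qed.

Lemma CnC_sum n U (J : Type) (r : seq J) (F : J -> E -> C) : open U ->
  (forall j, CnC n U (F j)) -> CnC n U (fun y => \sum_(j <- r) F j y).
Proof.
move=> oU H; elim: r => [|j r IH].
  by apply: CnC_ext (CnC_cst n U 0) => // y _; rewrite big_nil.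
by apply: CnC_ext (CnCD oU (H j) IH) => // y _; rewrite big_cons.
Qed.

Lemma CnC_real n U (f : E -> R) : Cn n U f -> CnC n U (fun y => (f y)%:C).
Proof. by move=> h; split=> //; exact: Cn_cst. Qed.

Lemma CnC_pd n U f a : CnC n.+1 U f -> CnC n U (pdC a f).
Proof. by case=> [[_ [_ h1]] [_ [_ h2]]]; split; [exact: h1 | exact: h2]. Qed.

Lemma pdC_comm U f y a b : open U -> CnC 2 U f -> U y ->
  pdC a (pdC b f) y = pdC b (pdC a f) y.
Proof.
move=> oU [h1 h2] Uy; rewrite /pdC /=.
by rewrite (pd_comm a b oU h1 Uy) (pd_comm a b oU h2 Uy).
Qed.

Lemma pdC_near f g y a : {near y, f =1 g} -> pdC a f y = pdC a g y.
Proof.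
move=> fg; rewrite /pdC; congr (_ +i* _)%C; apply: pd_near;
  by apply: filterS fg => z ->.
Qed.

Lemma near_openC U f g y : open U -> U y -> (forall z, U z -> f z = g z) ->
  {near y, f =1 g}.
Proof.
by move=> oU Uy fg; apply: filterS (open_nbhs_nbhs (conj oU Uy)) => z; exact: fg.
Qed.

Lemma pdCE U f g y a : open U -> U y -> (forall z, U z -> f z = g z) ->
  pdC a f y = pdC a g y.
Proof. by move=> oU Uy fg; apply: pdC_near; exact: near_openC fg. Qed.

Let dd (h : E -> R) y a : differentiable h y -> derivable h y (e_ a).
Proof. by move=> ?; exact: diff_derivable. Qed.

Lemma CdiffD f g y : Cdiff f y -> Cdiff g y -> Cdiff (fun z => f z + g z) y.
Proof.
move=> [f1 f2] [g1 g2]; split.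
  rewrite (_ : _ \o _ = (Re \o f) + (Re \o g)); first exact: differentiableD.
  by apply/funext => z /=; rewrite ReD.
rewrite (_ : _ \o _ = (Im \o f) + (Im \o g)); first exact: differentiableD.
by apply/funext => z /=; rewrite ImD.
Qed.

Lemma CdiffN f y : Cdiff f y -> Cdiff (fun z => - f z) y.
Proof.
move=> [f1 f2]; split.
  rewrite (_ : _ \o _ = - (Re \o f)); first exact: differentiableN.
  by apply/funext => z /=; rewrite ReN.
rewrite (_ : _ \o _ = - (Im \o f)); first exact: differentiableN.
by apply/funext => z /=; rewrite ImN.
Qed.

Lemma CdiffM f g y : Cdiff f y -> Cdiff g y -> Cdiff (fun z => f z * g z) y.
Proof.
move=> [f1 f2] [g1 g2]; split.
  rewrite (_ : _ \o _ = (Re \o f) * (Re \o g) - (Im \o f) * (Im \o g)).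
    by apply: differentiableB; exact: differentiableM.
  by apply/funext => z /=; rewrite ReM.
rewrite (_ : _ \o _ = (Re \o f) * (Im \o g) + (Im \o f) * (Re \o g)).
  by apply: differentiableD; exact: differentiableM.
by apply/funext => z /=; rewrite ImM.
Qed.

Lemma Cdiff_cst (c : C) y : Cdiff (fun=> c) y.
Proof. by split; exact: differentiable_cst. Qed.

Lemma Cdiff_sum (J : Type) (r : seq J) (F : J -> E -> C) y :
  (forall j, Cdiff (F j) y) -> Cdiff (fun z => \sum_(j <- r) F j z) y.
Proof.
move=> H; elim: r => [|j r IH].
  rewrite (_ : (fun _ => _) = fun=> 0); first exact: Cdiff_cst.
  by apply/funext => z; rewrite big_nil.
rewrite (_ : (fun _ => _) = fun z => F j z + \sum_(k <- r) F k z).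
  exact: CdiffD.
by apply/funext => z; rewrite big_cons.
Qed.

Lemma pdC_cst (c : C) a y : pdC a (fun=> c) y = 0.
Proof. by rewrite /pdC /pd !derive_cst. Qed.

Lemma pdD (f g : E -> R) a y : differentiable f y -> differentiable g y ->
  pd a (fun z => f z + g z) y = pd a f y + pd a g y.
Proof. by move=> df dg; exact: (deriveD (dd df) (dd dg)). Qed.

Lemma pdN (f : E -> R) a y : differentiable f y ->
  pd a (fun z => - f z) y = - pd a f y.
Proof. by move=> df; exact: (deriveN (dd df)). Qed.

Lemma pdCD f g a y : Cdiff f y -> Cdiff g y ->
  pdC a (fun z => f z + g z) y = pdC a f y + pdC a g y.
Proof.
move=> [f1 f2] [g1 g2]; apply: C_ext.
  rewrite ReD; apply: etrans (pdD a f1 g1).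
  by congr (pd a _ y); apply/funext => z; exact: ReD.
rewrite ImD; apply: etrans (pdD a f2 g2).
by congr (pd a _ y); apply/funext => z; exact: ImD.
Qed.

Lemma pdCN f a y : Cdiff f y -> pdC a (fun z => - f z) y = - pdC a f y.
Proof.
move=> [f1 f2]; apply: C_ext.
  rewrite ReN; apply: etrans (pdN a f1).
  by congr (pd a _ y); apply/funext => z; exact: ReN.
rewrite ImN; apply: etrans (pdN a f2).
by congr (pd a _ y); apply/funext => z; exact: ImN.
Qed.

Lemma pdCB f g a y : Cdiff f y -> Cdiff g y ->
  pdC a (fun z => f z - g z) y = pdC a f y - pdC a g y.
Proof.
by move=> hf hg; rewrite (pdCD a hf (CdiffN hg)) pdCN.
Qed.

Lemma pdM (f g : E -> R) a y : differentiable f y -> differentiable g y ->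
  pd a (fun z => f z * g z) y = f y * pd a g y + g y * pd a f y.
Proof. by move=> df dg; rewrite /pd; exact: (deriveM (dd df) (dd dg)). Qed.

Lemma pdCM f g a y : Cdiff f y -> Cdiff g y ->
  pdC a (fun z => f z * g z) y = pdC a f y * g y + f y * pdC a g y.
Proof.
move=> [f1 f2] [g1 g2].
have m (u v : E -> R) : differentiable u y -> differentiable v y ->
    derivable (fun z => u z * v z) y (e_ a).
  by move=> du dv; apply: dd; exact: differentiableM.
apply: C_ext.
  rewrite ReD !ReM /=.
  transitivity (pd a (fun z => Re (f z) * Re (g z) - Im (f z) * Im (g z)) y).
    by congr (pd a _ y); apply/funext => z; rewrite ReM.
  rewrite /pd deriveB; [|exact: m|exact: m].
  rewrite -!/(pd _ _ _) (pdM a f1 g1) (pdM a f2 g2) /=; ring.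
rewrite ImD !ImM /=.
transitivity (pd a (fun z => Re (f z) * Im (g z) + Im (f z) * Re (g z)) y).
  by congr (pd a _ y); apply/funext => z; rewrite ImM.
rewrite /pd deriveD; [|exact: m|exact: m].
rewrite -!/(pd _ _ _) (pdM a f1 g2) (pdM a f2 g1) /=; ring.
Qed.

Lemma pdC_sum (J : Type) (r : seq J) (F : J -> E -> C) a y :
  (forall j, Cdiff (F j) y) ->
  pdC a (fun z => \sum_(j <- r) F j z) y = \sum_(j <- r) pdC a (F j) y.
Proof.
move=> H; elim: r => [|j r IH].
  rewrite big_nil -[RHS](pdC_cst 0 a y); congr (pdC a _ y).
  by apply/funext => z; rewrite big_nil.
rewrite big_cons -IH -(pdCD a (H j) (Cdiff_sum r H)).
by congr (pdC a _ y); apply/funext => z; rewrite big_cons.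
Qed.

Lemma pdC_real (f : E -> R) a y : pdC a (fun z => (f z)%:C) y = (pd a f y)%:C.
Proof. by apply: C_ext => //=; exact: derive_cst. Qed.

Lemma pdC_conj f a y : Cdiff f y -> pdC a (fun z => (f z)^*%C) y = (pdC a f y)^*%C.
Proof.
move=> [f1 f2]; apply: C_ext.
  by rewrite Re_conj; congr (pd a _ y); apply/funext => z; exact: Re_conj.
rewrite Im_conj; apply: etrans (pdN a f2).
by congr (pd a _ y); apply/funext => z; exact: Im_conj.
Qed.

Lemma Cdiff_conj f y : Cdiff f y -> Cdiff (fun z => (f z)^*%C) y.
Proof.
move=> [f1 f2]; split.
  rewrite (_ : _ \o _ = Re \o f) //.
  by apply/funext => z /=; rewrite Re_conj.
rewrite (_ : _ \o _ = - (Im \o f)); first exact: differentiableN.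
by apply/funext => z /=; rewrite Im_conj.
Qed.

Lemma differentiable_rV (phi : E -> E) y :
  (forall b, differentiable (fun z => phi z 0 b) y) -> differentiable phi y.
Proof.
move=> H.
rewrite (_ : phi = \sum_(b < 4) (fun z => phi z 0 b *: e_ b)); last first.
  by apply/funext => z; rewrite fct_sumE -row_sum_delta.
apply: differentiable_sum => b.
by apply: differentiableZl; exact: H.
Qed.

Lemma jacobian_pd (phi : E -> E) y a b : differentiable phi y ->
  ('J phi y) a b = pd a (fun z => phi z 0 b) y.
Proof.
move=> dphi; have dr : derivable phi y (e_ a) by exact: diff_derivable.
transitivity (('D_(e_ a) phi y) 0 b); last by rewrite derive_mx // mxE.
by rewrite deriveEjacobian // -rowE !mxE.
Qed.

Lemma pd_comp (f : E -> R) (phi : E -> E) y a :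
  differentiable phi y -> differentiable f (phi y) ->
  pd a (f \o phi) y = \sum_b pd a (fun z => phi z 0 b) y * pd b f (phi y).
Proof.
move=> dphi df; rewrite /pd deriveE; last exact: differentiable_comp.
rewrite (diff_comp dphi df) /= pd_diff //; apply: eq_bigr => b _; congr (_ * _).
by rewrite -deriveE // derive_mx ?mxE //; exact: diff_derivable.
Qed.

Lemma Cdiff_comp f (phi : E -> E) y :
  differentiable phi y -> Cdiff f (phi y) -> Cdiff (f \o phi) y.
Proof.
move=> dphi [f1 f2]; split; first exact: (differentiable_comp dphi f1).
exact: (differentiable_comp dphi f2).
Qed.

Lemma pdC_comp f (phi : E -> E) y a :
  differentiable phi y -> Cdiff f (phi y) ->
  pdC a (f \o phi) y = \sum_b (pd a (fun z => phi z 0 b) y)%:C * pdC b f (phi y).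
Proof.
move=> dphi [f1 f2]; apply: C_ext.
  rewrite Re_sum; apply: (etrans (pd_comp a dphi f1)); apply: eq_bigr => b _.
  by rewrite ReM ImC mul0r subr0.
rewrite Im_sum; apply: (etrans (pd_comp a dphi f2)); apply: eq_bigr => b _.
by rewrite ImM ImC mul0r addr0.
Qed.

End ComplexCalculus.

(** * Segments avoiding a set of Hausdorff dimension at most 2 *)

Section Lebesgue4.
Variable R : realType.
Local Notation E := 'rV[R]_4.
Local Notation leb := (@lebesgue_measure R).
Local Open Scope ereal_scope.

(** The integral of a nonnegative function is the supremum over the nonnegative simple functions
    below it, a family that grows with the function. Volume densities and pointwise norms can thus
    be compared with constants without a discussion of measurability. *)
Lemma ge0_le_integral_nomeas d (T : measurableType d)
    (mu : {measure set T -> \bar R}) (D : set T) (f1 f2 : T -> \bar R) :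
  (forall x, D x -> 0 <= f1 x) -> (forall x, D x -> f1 x <= f2 x) ->
  \int[mu]_(x in D) f1 x <= \int[mu]_(x in D) f2 x.
Proof.
move=> f0 f12; rewrite !ge0_integralE //; last first.
  by move=> x Dx; exact: le_trans (f0 x Dx) (f12 x Dx).
apply: le_ereal_sup => _ [h hf <-]; exists h => // x.
apply: le_trans (hf x) _; rewrite /patch.
by case: ifPn => // /set_mem Dx; exact: f12.
Qed.

(* In the library only a product of subprobabilities is canonically sigma-finite,
   whence these copies of lebesgue4 and of its factors. *)
Definition lebesgue2 : set (measurableTypeR R * measurableTypeR R) -> \bar R :=
  leb \x leb.

HB.instance Definition _ := Measure.copy lebesgue2 (leb \x leb).

Lemma lebesgue2_sigma_finite : sigma_finite setT lebesgue2.
Proof.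
have /sigma_finiteP[F [TF ndF Foo]] := sigma_finiteT leb.
exists (fun n => F n `*` F n).
  rewrite -setXTT {1 2}TF predeqE => -[x y]; split.
    move=> [/= [n _ Fnx] [k _ Gky]]; exists (maxn n k) => //; split.
    - by move: x Fnx; exact/subsetPset/ndF/leq_maxl.
    - by move: y Gky; exact/subsetPset/ndF/leq_maxr.
  by move=> [n _ []/= ? ?]; split; exists n.
move=> k; have [mF Fk] := Foo k.
split; first exact: measurableX.
have FfinN : leb (F k) \is a fin_num by rewrite ge0_fin_numE.
by rewrite /lebesgue2 product_measure1E// lte_mul_pinfty.
Qed.

HB.instance Definition _ :=
  Measure_isSigmaFinite.Build _ _ _ lebesgue2 lebesgue2_sigma_finite.

Definition lebesgue4m : set (R * R * (R * R)) -> \bar R := @lebesgue4 R.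

Let lebesgue4m0 : lebesgue4m set0 = 0.
Proof. exact: (measure0 (lebesgue2 \x lebesgue2)). Qed.

Let lebesgue4m_ge0 A : 0 <= lebesgue4m A.
Proof. exact: (measure_ge0 (lebesgue2 \x lebesgue2)). Qed.

Let lebesgue4m_semi_sigma_additive : semi_sigma_additive lebesgue4m.
Proof.
exact: (@measure_semi_sigma_additive _ _ _ (lebesgue2 \x lebesgue2)).
Qed.

HB.instance Definition _ := isMeasure.Build _ _ _ lebesgue4m
  lebesgue4m0 lebesgue4m_ge0 lebesgue4m_semi_sigma_additive.

(** Closed for [b = true], open for [b = false]: closed cubes serve as coverings, open ones are the
    balls of the sup norm. *)
Definition side (b : bool) (c r : R) : set R :=
  [set` Interval (BSide b (c - r)%R) (BSide (~~ b) (c + r)%R)].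

Definition cube (b : bool) (c : E) (r : R) :
    set (R * R * (R * R)) :=
  (side b (c 0%R (@Ordinal 4 0 isT)) r `*` side b (c 0%R (@Ordinal 4 1 isT)) r) `*`
  (side b (c 0%R (@Ordinal 4 2 isT)) r `*` side b (c 0%R (@Ordinal 4 3 isT)) r).

Lemma measurable_side b c r : measurable (side b c r).
Proof. exact: measurable_itv. Qed.

Lemma measurable_cube b c r : measurable (cube b c r).
Proof. by do 2![apply: measurableX]; exact: measurable_side. Qed.

Lemma lebesgue_side b c r : (0 < r)%R -> leb (side b c r) = (2 * r)%:E.
Proof.
move=> r0; rewrite /side lebesgue_measure_itv /= lte_fin ifT; last by lra.
by rewrite -EFinD; congr _%:E; ring.
Qed.

Lemma lebesgue4_cube b c r : (0 < r)%R -> lebesgue4m (cube b c r) = ((2 * r) ^+ 4)%:E.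
Proof.
move=> r0.
have m2 c1 c2 : measurable (side b c1 r `*` side b c2 r).
  by apply: measurableX; exact: measurable_side.
have e2 c1 c2 : lebesgue2 (side b c1 r `*` side b c2 r) = ((2 * r) * (2 * r))%:E.
  apply: (etrans (product_measure1E leb leb (measurable_side b c1 r) (measurable_side b c2 r))).
  by rewrite EFinM; congr (_ * _); exact: lebesgue_side.
apply: (etrans (product_measure1E lebesgue2 lebesgue2 (m2 _ _) (m2 _ _))).
rewrite (_ : (2 * r) ^+ 4 = (2 * r * (2 * r)) * (2 * r * (2 * r)))%R; last by ring.
by rewrite EFinM; congr (_ * _); exact: e2.
Qed.

Lemma side_in b c r x :
  side b c r x <-> (if b then `|x - c| <= r else `|x - c| < r)%R.
Proof.
rewrite /side /= in_itv /=; case: b => /=.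
  by rewrite ler_distl.
by rewrite ltr_distl.
Qed.

Lemma forall_I4 (P : 'I_4 -> Prop) :
  P (@Ordinal 4 0 isT) -> P (@Ordinal 4 1 isT) -> P (@Ordinal 4 2 isT) ->
  P (@Ordinal 4 3 isT) -> forall i, P i.
Proof.
by move=> p0 p1 p2 p3; case=> [[|[|[|[|//]]]] i]; rewrite (bool_irrelevance i isT).
Qed.

Lemma cube_in b c r t : cube b c r t <->
  forall a, (if b then `|row4 t 0 a - c 0 a| <= r else `|row4 t 0 a - c 0 a| < r)%R.
Proof.
split.
  by move=> [[/side_in h0 /side_in h1] [/side_in h2 /side_in h3]];
    apply: forall_I4; rewrite mxE.
move=> H; split; split; apply/side_in.
- by have := H (@Ordinal 4 0 isT); rewrite mxE.
- by have := H (@Ordinal 4 1 isT); rewrite mxE.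
- by have := H (@Ordinal 4 2 isT); rewrite mxE.
- by have := H (@Ordinal 4 3 isT); rewrite mxE.
Qed.

Lemma row4_ball (c : E) r : (0 < r)%R -> @row4 R @^-1` ball c r = cube false c r.
Proof.
move=> r0; apply/seteqP; split=> t /=; rewrite -ball_normE /= distrC.
  move=> h; apply/cube_in => a; apply: le_lt_trans h.
  by have := ler_coord_norm (row4 t - c) a; rewrite !mxE.
by move/cube_in => h; apply: norm_rV_lt => // a; have := h a; rewrite !mxE.
Qed.

End Lebesgue4.

(** * Sets avoided by small translates of every segment *)

Section Sweep.
Variable R : realType.
Local Notation E := 'rV[R]_4.

(** Only the base point is perturbed: the vector [v], hence the increment along the segment, is
    kept. The case [v = 0] is the density of the complement of [Z]. *)
Definition thin (Z : set E) := forall (w v : E) (eps : R), 0 < eps ->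
  exists2 w', `|w' - w| < eps & forall t : R, 0 <= t <= 1 -> ~ Z (w' + t *: v).

(** The measure is the supremum of the contents over all scales, so the content at scale 1 already
    vanishes. *)
Lemma hausdorff_cover (Z : set E) (s eta : R) :
  hausdorff_measure s Z = 0%E -> 0 < eta ->
  exists U : nat -> set E, [/\ forall n, (ediam (U n) <= 1%:E)%E,
    Z `<=` \bigcup_n U n & (\sum_(0 <= n <oo) (ediam (U n) `^ s) < eta%:E)%E].
Proof.
move=> H eta0.
have : (hausdorff_content s 1 Z < eta%:E)%E.
  apply: (@le_lt_trans _ _ 0%E); last by rewrite lte_fin.
  by rewrite -H; apply: ereal_sup_ubound; exists 1 => /=.
by move=> /ereal_inf_lt[_ [U [U1 ZU] <-] Us]; exists U.
Qed.

Lemma ediam_ge0 (A : set E) : (0 <= ediam A)%E.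
Proof. by apply: ereal_sup_ubound; left. Qed.

Lemma le_ediam (A : set E) x y : A x -> A y -> ((`|x - y|)%:E <= ediam A)%E.
Proof. by move=> Ax Ay; apply: ereal_sup_ubound; right; exists x => //; exists y. Qed.

(** For a diameter [0 < D <= 1], [s <= 3] gives [D ^ 3 <= D ^ s]. A set of diameter 0 provides no
    positive radius of its own; [eta] pays for an artificial one. *)
Lemma radius_choice (A : set E) (s eta : R) : 0 < s -> s <= 3 -> 0 < eta ->
  (ediam A <= 1%:E)%E ->
  exists (x : E) (d : R), [/\ 0 < d, d <= 1, forall y, A y -> `|y - x| <= d &
     ((d ^+ 3)%:E <= ediam A `^ s + eta%:E)%E].
Proof.
move=> s0 s3 eta0 dA.
have dAfin : ediam A \is a fin_num.
  by rewrite ge0_fin_numE ?ediam_ge0 //; apply: le_lt_trans dA _; exact: ltry.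
have [D DE] : exists D : R, ediam A = D%:E by exists (fine (ediam A)); rewrite fineK.
have D0 : 0 <= D by rewrite -lee_fin -DE ediam_ge0.
have D1 : D <= 1 by rewrite -lee_fin -DE.
have [x Ax] : exists x, forall y, A y -> `|y - x| <= D.
  have [[x Ax]|nA] := pselect (exists x, A x).
    by exists x => y Ay; rewrite -lee_fin -DE; exact: le_ediam.
  by exists 0 => y Ay; case: nA; exists y.
rewrite DE poweR_EFin.
have [D00|Dpos] := eqVneq D 0.
  (* With this radius, [d ^ 3 <= d <= eta]. *)
  exists x, (Num.min 1 eta); split=> //.
  - by rewrite lt_min ltr01 eta0.
  - by rewrite ge_min lexx.
  - by move=> y /Ax; rewrite D00 => h; rewrite (le_trans h) // le_min ler01 ltW.
  rewrite -EFinD lee_fin; apply: (@le_trans _ _ (Num.min 1 eta)).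
    rewrite exprS ler_piMr // ?exprn_ile1 ?ge_min ?lexx // ?le_min ?ler01 ?ltW //.
  by rewrite (@le_trans _ _ eta) // ?ge_min ?lexx ?orbT // lerDr powR_ge0.
have Dp : 0 < D by rewrite lt_def Dpos.
exists x, D; split=> //.
rewrite -EFinD lee_fin -powR_mulrn //; apply: (@le_trans _ _ (D `^ s)).
  by apply: ger_powR => //; rewrite Dp D1.
by rewrite lerDl ltW.
Qed.

(** If [w + u *: v] is within [d] of [x] for some [u] in [0, 1], rounding [u] down to a multiple
    [j d] costs at most [d |v|], so that [w] lies in the [j]-th cube. The multiples involved are at
    most 1, whence the range of [j]. *)
Let sweep_cubes (v x : E) (d : R) : set (_ * _) :=
  \big[setU/set0]_(j < (Num.truncn d^-1).+1)
     cube true (x - (j%:R * d) *: v) ((1 + `|v|) * d).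

Let measurable_sweep v x d : measurable (sweep_cubes v x d).
Proof. by apply: bigsetU_measurable => j _; exact: measurable_cube. Qed.

(** There are at most [1 / d + 1 <= 2 / d] cubes, each of volume [(2 (1 + |v|) d) ^ 4]; the constant
    is [32 = 2 * 2 ^ 4]. *)
Let sweep_measure v x d : 0 < d -> d <= 1 ->
  (lebesgue4m (sweep_cubes v x d) <= (32 * (1 + `|v|) ^+ 4 * d ^+ 3)%:E)%E.
Proof.
move=> d0 d1; set L := 1 + `|v|.
have L0 : 0 < L by rewrite ltr_wpDr.
have /le_trans := @Boole_inequality _ _ _ (@lebesgue4m R)
  (fun j : nat => cube true (x - (j%:R * d) *: v) (L * d)) (Num.truncn d^-1).+1
  (fun j _ => measurable_cube _ _ _); apply.
rewrite (eq_bigr (fun=> ((2 * (L * d)) ^+ 4)%:E)); last first.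
  by move=> j _; apply: lebesgue4_cube; rewrite mulr_gt0.
rewrite sumEFin lee_fin sumr_const card_ord -[_ *+ (Num.truncn _).+1]mulr_natr.
have id1 : 1 <= d^-1 by rewrite invf_ge1.
have K : (Num.truncn d^-1).+1%:R <= 2 * d^-1.
  have := truncn_itv (le_trans ler01 id1) => /andP[h _].
  by rewrite -natr1; lra.
apply: (@le_trans _ _ ((2 * (L * d)) ^+ 4 * (2 * d^-1))).
  by rewrite ler_pM2l // exprn_gt0 // !mulr_gt0.
by rewrite le_eqVlt; apply/orP; left; apply/eqP; field; rewrite gt_eqF.
Qed.

(* Sweeping a set of diameter d along a segment produces a set covered by O(1/d)
   cubes of side O(d), so that an H^3-null set sweeps out a Lebesgue-null one. *)
Lemma thin_of_null (Z : set E) (s : R) : 0 < s -> s <= 3 ->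
  hausdorff_measure s Z = 0%E -> thin Z.
Proof.
move=> s0 s3 HZ w v eps e0; apply: contrapT => nex.
have bad w' : `|w' - w| < eps -> exists2 t : R, 0 <= t <= 1 & Z (w' + t *: v).
  move=> w'e; apply: contrapT => nt; apply: nex; exists w' => // t t01 Zt.
  by apply: nt; exists t.
set L := 1 + `|v|.
have L0 : 0 < L by rewrite ltr_wpDr.
pose c := 32 * L ^+ 4.
have c0 : 0 < c by rewrite mulr_gt0 // exprn_gt0.
(* The swept cubes will have total volume less than [c (eta + eta)], half that of the open cube of
   radius [eps]. One [eta] bounds the sum of the diameters to the power [s], the other the
   corrections [eta / 2 ^ (n + 1)]. *)
pose eta := (2 * eps) ^+ 4 / (4 * c).
have eta0 : 0 < eta by rewrite divr_gt0 ?exprn_gt0 ?mulr_gt0.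
have [U [U1 ZU Us]] := hausdorff_cover HZ eta0.
have etan n : 0 < eta / (2 ^ n.+1)%:R by rewrite divr_gt0 // ltr0n expn_gt0.
have /choice[x /choice[d Hxd]] := fun n => radius_choice s0 s3 (etan n) (U1 n).
(* If the lemma failed, each base point within [eps] of [w] would start a segment meeting [Z], and
   so lie in the swept set. *)
have cov : cube false w eps `<=` \bigcup_n sweep_cubes v (x n) (d n).
  rewrite -row4_ball // => t; rewrite /= -ball_normE /= distrC => /bad[u u01 /ZU[n _ Un]].
  have [d0 d1 Ux _] := Hxd n.
  exists n => //; rewrite /sweep_cubes -(bigcup_mkord _
    (fun j : nat => cube true (x n - (j%:R * d n) *: v) (L * d n))).
  have ud0 : 0 <= u / d n by case/andP: u01 => u0 _; apply: divr_ge0 => //; exact: ltW.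
  have /andP[jl ju] := truncn_itv ud0.
  set j := Num.truncn (u / d n) in jl ju.
  exists j.
    rewrite /= ltnS; apply: le_truncn.
    by rewrite ler_pdivrMr // mulVf ?gt_eqF //; case/andP: u01.
  apply/cube_in => a.
  suff : `|row4 t - (x n - (j%:R * d n) *: v)| <= L * d n.
    apply: le_trans.
    by have := ler_coord_norm (row4 t - (x n - (j%:R * d n) *: v)) a; rewrite !mxE.
  have -> : row4 t - (x n - (j%:R * d n) *: v) =
     (row4 t + u *: v - x n) - (u - j%:R * d n) *: v.
    by rewrite scalerBl !opprB !addrA; apply/rowP => b; rewrite !mxE; ring.
  apply: (le_trans (ler_normB _ _)); rewrite mulrDl mul1r lerD //; first exact: Ux.
  rewrite normrZ mulrC ler_wpM2l //.
  rewrite ler_pdivlMr // in jl; rewrite ltr_pdivrMr // -natr1 in ju.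
  by rewrite ler_norml; apply/andP; split; lra.
have mc n : measurable (sweep_cubes v (x n) (d n)) by exact: measurable_sweep.
have := measure_sigma_subadditive (@lebesgue4m R) mc (measurable_cube false w eps) cov.
have -> : (@lebesgue4m R : {measure set _ -> \bar R}) (cube false w eps) = ((2 * eps) ^+ 4)%:E.
  exact: lebesgue4_cube.
suff lt4 : (\sum_(0 <= n <oo) lebesgue4m (sweep_cubes v (x n) (d n)) < ((2 * eps) ^+ 4)%:E)%E.
  by move=> /le_lt_trans /(_ lt4); rewrite ltxx.
apply: (@le_lt_trans _ _
  (c%:E * (\sum_(0 <= n <oo) (ediam (U n) `^ s + (eta / (2 ^ n.+1)%:R)%:E)))%E).
  rewrite -nneseriesZl; last first.
    by move=> n _; rewrite adde_ge0 ?poweR_ge0 // lee_fin ltW.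
  apply: lee_nneseries => [n _ _|n _]; first exact: measure_ge0.
  have [d0 d1 _ d3] := Hxd n.
  apply: (le_trans (sweep_measure v (x n) d0 d1)).
  by rewrite EFinM lee_pmul2l // lte_fin.
apply: (@le_lt_trans _ _ (c%:E * (eta + eta)%:E)%E).
  rewrite lee_pmul2l ?lte_fin //.
  apply: le_trans (epsilon_trick _ _ _) _ => //; [by move=> n; exact: poweR_ge0|exact: ltW|].
  by rewrite EFinD leeD2r // ltW.
rewrite -EFinM lte_fin /eta.
have p4 : 0 < (2 * eps) ^+ 4 by rewrite exprn_gt0 // mulr_gt0.
have -> : c * ((2 * eps) ^+ 4 / (4 * c) + (2 * eps) ^+ 4 / (4 * c)) = (2 * eps) ^+ 4 / 2.
  by field; rewrite gt_eqF.
by rewrite ltr_pdivrMr // ltr_pMr // ltr1n.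
Qed.

(** The infimum defining the dimension is below 3, so some exponent [s < 3] has null measure; the
    measure at exponent 2 itself may be positive or infinite. *)
Lemma thin_of_dim (Z : set E) : (hausdorff_dim Z <= 2%:E)%E -> thin Z.
Proof.
move=> H; have : (hausdorff_dim Z < 3%:E)%E.
  by apply: le_lt_trans H _; rewrite lte_fin ltr_nat.
move=> /ereal_inf_lt[_ [s [s0 Hs] <-]]; rewrite lte_fin => /ltW s3.
exact: thin_of_null s0 s3 Hs.
Qed.

End Sweep.

(** * Functions controlled off a thin set, and their extension *)

Section ThinCalculus.
Variable R : realType.
Local Notation E := 'rV[R]_4.
Variable (Z : set E).
Hypothesis thinZ : thin Z.

Lemma thin_dense (w : E) (eps : R) : 0 < eps -> exists2 w', `|w' - w| < eps & ~ Z w'.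
Proof.
move=> e0; have [w' w'e H] := thinZ w 0 e0; exists w' => //.
by have := H 0; rewrite lexx ler01 scale0r addr0; exact.
Qed.

Lemma continuous_normP (f : E -> R) (y : E) : {for y, continuous f} ->
  forall eps, 0 < eps -> exists2 d, 0 < d & forall z, `|z - y| < d -> `|f z - f y| <= eps.
Proof.
move=> /cvgrPdist_le cf eps e0; have /nbhs_ballP[d /= d0 bd] := cf _ e0.
exists d => // z zd; rewrite distrC; apply: bd; by rewrite -ball_normE /= distrC.
Qed.

Lemma ball_segment (y0 x v : E) (r : R) (t : R) : 0 <= t <= 1 ->
  `|x - y0| < r -> `|x + v - y0| < r -> `|x + t *: v - y0| < r.
Proof.
move=> /andP[t0 t1] h1 h2.
have -> : x + t *: v - y0 = (1 - t) *: (x - y0) + t *: (x + v - y0).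
  by apply/rowP => a; rewrite !mxE; ring.
apply: (le_lt_trans (ler_normD _ _)); rewrite !normrZ !ger0_norm ?subr_ge0 //.
have [->|tp] := eqVneq t 0; first by rewrite subr0 mul1r mul0r addr0.
rewrite [ltRHS](_ : r = (1 - t) * r + t * r); last by ring.
apply: ler_ltD; first by rewrite ler_wpM2l ?subr_ge0 // ltW.
by rewrite ltr_pM2l // lt_def tp.
Qed.

(* The mean value inequality on the segments avoiding Z extends to all of them by
   continuity. *)
Lemma thin_increment (y0 : E) (r L : R) (c : E) (f : E -> R) :
  (forall z, `|z - y0| < r -> ~ Z z ->
     differentiable f z /\ forall a, `|pd a f z - c 0 a| <= L) ->
  forall x y, `|x - y0| < r -> `|y - y0| < r ->
    {for x, continuous f} -> {for y, continuous f} ->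
    `|f y - f x - \sum_a (y - x) 0 a * c 0 a| <= 4 * L * `|y - x|.
Proof.
move=> H x y xr yr /continuous_normP cx /continuous_normP cy.
apply/ler_addgt0Pl => eps e0.
have e2 : 0 < eps / 2 by rewrite divr_gt0.
have [dx dx0 hx] := cx _ e2; have [dy dy0 hy] := cy _ e2.
(* A translation by less than [d] keeps both ends in the ball, hence by convexity the whole segment,
   and changes [f] by at most [eps / 2] at each end. *)
pose d := Num.min (Num.min dx dy) (Num.min (r - `|x - y0|) (r - `|y - y0|)).
have d0 : 0 < d by rewrite !lt_min dx0 dy0 !subr_gt0 xr yr.
have [x' x'd nZ] := thinZ x (y - x) d0.
move: x'd; rewrite !lt_min => /andP[/andP[xdx xdy] /andP[xrx xry]].
set y' := x' + (y - x).
have yx : y' - y = x' - x by rewrite /y'; apply/rowP => a; rewrite !mxE; ring.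
have x'r : `|x' - y0| < r.
  rewrite -(subrK x x') -addrA; apply: (le_lt_trans (ler_normD _ _)); lra.
have y'r : `|y' - y0| < r.
  rewrite -(subrK y y') -addrA; apply: (le_lt_trans (ler_normD _ _)); rewrite yx; lra.
have seg t : 0 <= t <= 1 -> differentiable f (x' + t *: (y - x)) /\
    forall a, `|pd a f (x' + t *: (y - x)) - c 0 a| <= L.
  by move=> t01; apply: H; [exact: ball_segment | exact: nZ].
have [|t t01 ft] := @line_MVT R f x' (y - x).
  by move=> t t01; apply: diff_derivable; case: (seg t t01).
have [df bnd] := seg t t01.
have main : `|f y' - f x' - \sum_a (y - x) 0 a * c 0 a| <= 4 * L * `|y - x|.
  rewrite ft derive_pd // -sumrB; apply: (le_trans (ler_norm_sum _ _ _)).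
  have -> : 4 * L * `|y - x| = \sum_(j < 4) L * `|y - x|.
    by rewrite sumr_const card_ord -mulrA mulr_natl.
  apply: ler_sum => j _; rewrite -mulrBr normrM mulrC.
  by apply: ler_pM => //; exact: ler_coord_norm.
have fx : `|f x' - f x| <= eps / 2 by exact: hx.
have fy : `|f y' - f y| <= eps / 2 by apply: hy; rewrite yx.
have -> : f y - f x - \sum_a (y - x) 0 a * c 0 a =
  (f y' - f x' - \sum_a (y - x) 0 a * c 0 a) - (f y' - f y) + (f x' - f x) by ring.
apply: (le_trans (ler_normD _ _)); rewrite [eps in leRHS]splitr.
have h1 := ler_normB (f y' - f x' - \sum_a (y - x) 0 a * c 0 a) (f y' - f y); lra.
Qed.

Lemma thin_lipschitz (y0 : E) (r L : R) (f : E -> R) :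
  (forall z, `|z - y0| < r -> ~ Z z ->
     differentiable f z /\ forall a, `|pd a f z| <= L) ->
  forall x y, `|x - y0| < r -> `|y - y0| < r -> ~ Z x -> ~ Z y ->
    `|f y - f x| <= 4 * L * `|y - x|.
Proof.
move=> H x y xr yr Zx Zy.
have H0 z : `|z - y0| < r -> ~ Z z ->
    differentiable f z /\ forall a, `|pd a f z - (0 : E) 0 a| <= L.
  by move=> zr nZ; have [dz bz] := H z zr nZ; split=> // a; rewrite mxE subr0.
have := thin_increment H0 xr yr.
rewrite big1 ?subr0; last by move=> a _; rewrite !mxE mulr0.
by apply; apply: differentiable_continuous; [case: (H x xr Zx) | case: (H y yr Zy)].
Qed.

Definition lipschitz_off (f : E -> R) (y0 : E) := exists r L : R,
  [/\ 0 < r, 0 <= L & forall x y, `|x - y0| < r -> `|y - y0| < r ->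
    ~ Z x -> ~ Z y -> `|f y - f x| <= L * `|y - x|].

Definition extend_off (f : E -> R) (y : E) : R := lim (f @ within (~` Z) (nbhs y)).

Let within_proper (y : E) : ProperFilter (within (~` Z) (nbhs y)).
Proof.
apply: within_nbhs_proper => B /nbhs_ballP[d /= d0 bd].
have [w wd nZ] := thin_dense y d0.
by exists w; split=> //; apply: bd; rewrite -ball_normE /= distrC.
Qed.

(** The Lipschitz bound makes the image filter Cauchy, and density of the complement of [Z] makes it
    proper, so that it converges by completeness. *)
Lemma extend_off_cvg (f : E -> R) (y0 : E) : lipschitz_off f y0 ->
  f @ within (~` Z) (nbhs y0) --> extend_off f y0.
Proof.
move=> [r [L [r0 L0 H]]]; have PF := within_proper y0.
apply: cauchy_cvg; apply: cauchy_exP => e e0.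
(* Two points within [d] of [y0] are at distance at most [2 d]; the extra 1 makes the resulting
   bound strict and allows [L = 0]. *)
pose d := Num.min r (e / (2 * L + 1)).
have L1 : 0 < 2 * L + 1 by lra.
have d0 : 0 < d by rewrite lt_min r0 divr_gt0.
have [x xd nZx] := thin_dense y0 d0.
exists (f x).
suff : \forall z \near y0, (~` Z) z -> ball (f x) e (f z) by [].
apply/nbhs_ballP; exists d => // z; rewrite -ball_normE /= distrC => zd nZz.
have [xr zr] : `|x - y0| < r /\ `|z - y0| < r.
  by move: xd zd; rewrite !lt_min => /andP[-> _] /andP[-> _].
rewrite -ball_normE /= distrC; apply: (le_lt_trans (H _ _ xr zr nZx nZz)).
have zx : `|z - x| <= d + d.
  rewrite -(subrK y0 z) -addrA; apply: (le_trans (ler_normD _ _)).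
  by rewrite lerD // ltW // distrC.
have de : d * (2 * L + 1) <= e by rewrite -ler_pdivlMr // ge_min lexx orbT.
have : L * `|z - x| <= L * (d + d) by rewrite ler_wpM2l.
lra.
Qed.

(** Only [y] may lie in [Z]. This mixed form is enough: two values of the extension are compared
    through an auxiliary point off [Z], and [x = y] shows that the extension agrees with [f]
    there. *)
Lemma extend_off_lip (f : E -> R) (y0 : E) (r L : R) : 0 < r -> 0 <= L ->
  (forall x y, `|x - y0| < r -> `|y - y0| < r ->
    ~ Z x -> ~ Z y -> `|f y - f x| <= L * `|y - x|) ->
  forall x y, `|x - y0| < r -> `|y - y0| < r -> ~ Z x ->
    `|extend_off f y - f x| <= L * `|y - x|.
Proof.
move=> r0 L0 H x y xr yr nZx.
have lip : lipschitz_off f y.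
  exists (r - `|y - y0|), L; split=> //; first by rewrite subr_gt0.
  move=> u v ur vr; apply: H.
    by rewrite -(subrK y u) -addrA; apply: (le_lt_trans (ler_normD _ _)); lra.
  by rewrite -(subrK y v) -addrA; apply: (le_lt_trans (ler_normD _ _)); lra.
have /cvgrPdist_le C := extend_off_cvg lip.
apply/ler_addgt0Pl => eps e0.
(* One [eta] for replacing the limit at [y] by a value at a nearby [z], and [L * eta] for the
   displacement from [y] to [z]. *)
pose eta := eps / (1 + L).
have L1 : 0 < 1 + L by lra.
have eta0 : 0 < eta by rewrite divr_gt0.
have /nbhs_ballP[d /= d0 bd] := C _ eta0.
pose d' := Num.min d (Num.min eta (r - `|y - y0|)).
have d'0 : 0 < d' by rewrite !lt_min d0 eta0 subr_gt0.
have [z zd nZz] := thin_dense y d'0.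
move: zd; rewrite !lt_min => /andP[zd /andP[ze zr]].
have fz : `|extend_off f y - f z| <= eta by apply: bd => //; rewrite -ball_normE /= distrC.
have zr' : `|z - y0| < r.
  by rewrite -(subrK y z) -addrA; apply: (le_lt_trans (ler_normD _ _)); lra.
have h := H _ _ xr zr' nZx nZz.
have zx : `|z - x| <= eta + `|y - x|.
  rewrite -(subrK y z) -addrA; apply: (le_trans (ler_normD _ _)).
  by rewrite lerD2r ltW.
have eE : eta + L * eta = eps by rewrite /eta; field; rewrite gt_eqF.
have hL : L * `|z - x| <= L * (eta + `|y - x|) by rewrite ler_wpM2l.
rewrite -(subrK (f z) (extend_off f y)) -addrA; apply: (le_trans (ler_normD _ _)).
rewrite mulrDr in hL; lra.
Qed.

Lemma extend_off_id (f : E -> R) (y0 : E) : lipschitz_off f y0 -> ~ Z y0 ->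
  extend_off f y0 = f y0.
Proof.
move=> [r [L [r0 L0 H]]] nZ; have y0r : `|y0 - y0| < r by rewrite subrr normr0.
have := extend_off_lip r0 L0 H y0r y0r nZ.
by rewrite subrr normr0 mulr0 normr_le0 subr_eq0 => /eqP.
Qed.

Lemma extend_off_continuous (f : E -> R) (y0 : E) : lipschitz_off f y0 ->
  {for y0, continuous (extend_off f)}.
Proof.
move=> [r [L [r0 L0 H]]].
suff : extend_off f y @[y --> y0] --> extend_off f y0 by [].
apply/(@cvgrPdist_le R R^o E (nbhs y0) (nbhs_filter y0)) => e e0.
have y0r : `|y0 - y0| < r by rewrite subrr normr0.
(* Through [x], the path costs [L d] from [y0] and [2 L d] from [y]. *)
pose d := Num.min r (e / (3 * L + 1)).
have L1 : 0 < 3 * L + 1 by lra.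
have d0 : 0 < d by rewrite lt_min r0 divr_gt0.
apply/nbhs_ballP; exists d => // y; rewrite -ball_normE /= distrC => yd.
have [x xd nZx] := thin_dense y0 d0.
have [xr yr] : `|x - y0| < r /\ `|y - y0| < r.
  by move: xd yd; rewrite !lt_min => /andP[-> _] /andP[-> _].
have h1 := extend_off_lip r0 L0 H xr y0r nZx.
have h2 := extend_off_lip r0 L0 H xr yr nZx.
have de : d * (3 * L + 1) <= e by rewrite -ler_pdivlMr // ge_min lexx orbT.
rewrite -(subrK (f x) (extend_off f y0)) -addrA; apply: (le_trans (ler_normD _ _)).
rewrite [`|f x - _|]distrC.
have k1 : L * `|y0 - x| <= L * d by rewrite ler_wpM2l // distrC ltW.
have k2 : L * `|y - x| <= L * (d + d).
  rewrite ler_wpM2l // -(subrK y0 y) -addrA; apply: (le_trans (ler_normD _ _)).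
  by rewrite lerD // ltW // distrC.
lra.
Qed.

(** Near [y] the partial derivatives off [Z] are within [eps / 4] of [b a y], and [thin_increment]
    turns this into a first-order expansion of [g] at [y], even for [y] in [Z]. Thinness excludes
    the behaviour of the Cantor function, which grows entirely on a null set. *)
Lemma thin_C1 (U : set E) (g : E -> R) (b : 'I_4 -> E -> R) : open U ->
  (forall y, U y -> {for y, continuous g}) ->
  (forall y a, U y -> {for y, continuous (b a)}) ->
  (forall y, U y -> ~ Z y -> differentiable g y /\ forall a, pd a g y = b a y) ->
  forall y, U y -> differentiable g y /\ forall a, pd a g y = b a y.
Proof.
move=> oU cg cb dg y Uy; pose c : E := \row_a b a y.
suff H : forall eps, 0 < eps -> \forall h \near (0 : E),
     `|g (h + y) - g y - \sum_a h 0 a * c 0 a| <= eps * `|h|.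
  by have [dgy pdg] := diff_of_linear_approx H; split=> // a; rewrite pdg mxE.
move=> eps e0; have e4 : 0 < eps / 4 by rewrite divr_gt0.
have : \forall z \near y, U z /\ forall a, `|b a y - b a z| <= eps / 4.
  apply: filterI; first exact: open_nbhs_nbhs.
  apply: (@filter_forall E _ (fun a z => `|b a y - b a z| <= eps / 4) (nbhs y)) => a.
  by have /cvgrPdist_le := cb y a Uy; apply.
move=> /nbhs_ballP[r /= r0 br].
have {}br z : `|z - y| < r -> U z /\ forall a, `|b a y - b a z| <= eps / 4.
  by move=> zr; apply: br; rewrite -ball_normE /= distrC.
apply/nbhs_ballP; exists r => // h; rewrite -ball_normE /= sub0r normrN => hr.
have bz z : `|z - y| < r -> ~ Z z ->
     differentiable g z /\ forall a, `|pd a g z - c 0 a| <= eps / 4.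
  move=> zr nZ; have [Uz bbz] := br z zr; have [dz pz] := dg z Uz nZ.
  by split=> // a; rewrite pz mxE distrC.
have hyr : `|h + y - y| < r by rewrite addrK.
have yr : `|y - y| < r by rewrite subrr normr0.
have := thin_increment bz yr hyr (cg _ Uy) (cg _ (br _ hyr).1).
by rewrite addrK [4 * _](_ : _ = eps) //; field.
Qed.

End ThinCalculus.

(** * Extension of the potential across the zero set *)

Section ParallelExtension.
Variable R : realType.
Local Notation E := 'rV[R]_4.
Local Notation C := R[i].
Local Notation Re := (@complex.Re R).
Local Notation Im := (@complex.Im R).

Lemma pd_ln (h : E -> R) (y : E) : differentiable h y -> 0 < h y ->
  differentiable (@ln R \o h) y /\ forall a, pd a (@ln R \o h) y = (h y)^-1 * pd a h y.
Proof.
move=> dh hy; have dl := is_derive1_ln hy.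
have dln : differentiable (@ln R) (h y).
  by apply/derivable1_diffP; exact: (@ex_derive _ _ _ _ _ _ _ dl).
split=> [|a]; first exact: differentiable_comp.
rewrite /pd deriveE; last exact: differentiable_comp.
rewrite (diff_comp dh dln) /= (diff1E dln) derive1E (@derive_val _ _ _ _ _ _ _ dl).
by rewrite -deriveE // mulrC.
Qed.

Lemma near_eq_differentiable (f g : E -> R) (y : E) :
  {near y, f =1 g} -> differentiable f y -> differentiable g y.
Proof.
move=> fg df; rewrite -(subrK f g) addrC; apply: differentiableD => //.
apply: (diff_of_small _).1 => eps e0.
have : \forall h \near (0 : E), f (h + y) = g (h + y).
  have /nbhs_ballP[r /= r0 br] := fg.
  apply/nbhs_ballP; exists r => // h; rewrite -ball_normE /= sub0r normrN => hr.
  by apply: br; rewrite -ball_normE /= distrC addrK.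
apply: filterS => h fgh.
have gf z : (g - f) z = g z - f z by [].
by rewrite !gf fgh (nbhs_singleton fg) !subrr normr0 mulr_ge0 // ltW.
Qed.

Lemma continuous_near_bound (I : finType) (F : I -> E -> R) (y0 : E) (U : set E) :
  open U -> U y0 -> (forall i, {for y0, continuous (F i)}) ->
  exists r K, [/\ 0 < r, 0 <= K & forall z, `|z - y0| < r -> U z /\ forall i, `|F i z| <= K].
Proof.
move=> oU Uy cF.
have : \forall z \near y0, U z /\ forall i, `|F i y0 - F i z| <= 1.
  apply: filterI; first exact: open_nbhs_nbhs.
  apply: (@filter_forall E _ (fun i z => `|F i y0 - F i z| <= 1) (nbhs y0)) => i.
  by have /cvgrPdist_le := cF i; apply.
move=> /nbhs_ballP[r /= r0 br].
exists r, (1 + \sum_i `|F i y0|); split=> //; first by rewrite addr_ge0 // sumr_ge0.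
move=> z zr; have [|Uz bz] := br z; first by rewrite -ball_normE /= distrC.
split=> // i; rewrite (bigD1 i) //=.
have h := bz i.
have s0 : 0 <= \sum_(j | j != i) `|F j y0| by exact: sumr_ge0.
have : `|F i z| <= `|F i y0| + 1.
  rewrite -[in leLHS](subrK (F i y0) (F i z)); apply: (le_trans (ler_normD _ _)).
  by rewrite addrC lerD2l distrC.
lra.
Qed.

Variables (U Z : set E) (A beta : 'I_4 -> E -> C) (zeta : E -> C).
Hypothesis (oU : open U) (thinZ : thin Z) (oUZ : open (U `&` ~` Z)).
Hypothesis (A0 : forall a, CnC 0 U (A a)) (beta0 : forall a, CnC 0 U (beta a)).
Hypothesis (A_im : forall a y, U y -> (A a y)^*%C = - A a y).
Hypothesis zeta_par : forall y, U y -> ~ Z y ->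
  Cdiff zeta y /\ forall a, pdC a zeta y = beta a y - A a y * zeta y.

Let Re_A a y : U y -> Re (A a y) = 0.
Proof.
move=> /(A_im a) /(congr1 Re); rewrite Re_conj ReN => /eqP.
by rewrite -addr_eq0 -mulr2n mulrn_eq0 /= => /eqP.
Qed.

Let pd_Re a y : U y -> ~ Z y ->
  pd a (Re \o zeta) y = Re (beta a y) + Im (A a y) * Im (zeta y).
Proof.
move=> Uy nZ; have [_ /(_ a) /(congr1 Re)] := zeta_par Uy nZ.
by rewrite ReB ReM Re_A // mul0r sub0r opprK => <-.
Qed.

Let pd_Im a y : U y -> ~ Z y ->
  pd a (Im \o zeta) y = Im (beta a y) - Im (A a y) * Re (zeta y).
Proof.
move=> Uy nZ; have [_ /(_ a) /(congr1 Im)] := zeta_par Uy nZ.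
by rewrite ImB ImM Re_A // mul0r add0r => <-.
Qed.

(* As A is imaginary, the gradient of ln (1 + |zeta|^2) is bounded in terms of beta
   alone; hence zeta, and then its derivatives, are bounded near y0. *)
Let zeta_lipschitz y0 : U y0 ->
  lipschitz_off Z (Re \o zeta) y0 /\ lipschitz_off Z (Im \o zeta) y0.
Proof.
move=> Uy0.
(* The twelve functions [Re beta], [Im beta] and [Im A] are gathered in one family to obtain a
   common radius [r] and a common bound [K]. *)
pose F (i : 'I_4 * 'I_3) z := if i.2 == 0 :> nat then Re (beta i.1 z) else
  if i.2 == 1 :> nat then Im (beta i.1 z) else Im (A i.1 z).
have cF i : {for y0, continuous (F i)}.
  case: i => a j; have [[b1 _] [b2 _]] := beta0 a; have [_ [b3 _]] := A0 a.
  by case: j => [[|[|[|//]]] jlt]; [exact: b1 | exact: b2 | exact: b3].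
have [r [K [r0 K0 brK]]] := continuous_near_bound oU Uy0 cF.
have bU z : `|z - y0| < r -> U z by move=> /brK[].
have bR a z : `|z - y0| < r -> `|Re (beta a z)| <= K.
  by move=> /brK[_ /(_ (a, @Ordinal 3 0 isT))].
have bI a z : `|z - y0| < r -> `|Im (beta a z)| <= K.
  by move=> /brK[_ /(_ (a, @Ordinal 3 1 isT))].
have bA a z : `|z - y0| < r -> `|Im (A a z)| <= K.
  by move=> /brK[_ /(_ (a, @Ordinal 3 2 isT))].
pose p := Re \o zeta; pose q := Im \o zeta.
pose h z := 1 + (p z * p z + q z * q z).
have h1 z : 1 <= h z.
  by rewrite /h lerDl addr_ge0 // -expr2 sqr_ge0.
have h_pos z : 0 < h z by exact: lt_le_trans (h1 z).
(* The contributions of [A] are [2 p q Im A] and [- 2 p q Im A], and cancel. *)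
have dh z : `|z - y0| < r -> ~ Z z -> differentiable h z /\
    forall a, pd a h z = 2 * (p z * Re (beta a z) + q z * Im (beta a z)).
  move=> /bU Uz nZ; have [[dp dq] _] := zeta_par Uz nZ.
  have dpp : differentiable (fun z => p z * p z) z by exact: differentiableM.
  have dqq : differentiable (fun z => q z * q z) z by exact: differentiableM.
  have dpq : differentiable (fun z => p z * p z + q z * q z) z by exact: differentiableD.
  split=> [|a]; first by apply: differentiableD => //; exact: differentiable_cst.
  have -> : pd a h z = pd a (fun z => p z * p z) z + pd a (fun z => q z * q z) z.
    rewrite (pdD a (f := fun=> 1) (differentiable_cst _ _) dpq) (pdD a dpp dqq).
    by rewrite [pd a (fun=> 1) z]derive_cst add0r.
  rewrite !pdM // (pd_Re a Uz nZ) (pd_Im a Uz nZ) /p /q /=; ring.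
have phi_bound z : `|z - y0| < r -> ~ Z z -> differentiable (@ln R \o h) z /\
    forall a, `|pd a (@ln R \o h) z| <= 2 * K.
  move=> zr nZ; have [dhz ph] := dh z zr nZ.
  have [dl pl] := pd_ln dhz (h_pos z); split=> // a.
  rewrite pl ph normrM ger0_norm; last by rewrite invr_ge0 ltW.
  rewrite ler_pdivrMl // normrM ger0_norm //.
  have b1 := bR a z zr; have b2 := bI a z zr.
  have t1 : `|p z * Re (beta a z) + q z * Im (beta a z)| <= (`|p z| + `|q z|) * K.
    apply: (le_trans (ler_normD _ _)); rewrite !normrM mulrDl.
    by apply: lerD; rewrite ler_wpM2l.
  (* From [2 |p| <= 1 + p ^ 2] and the same for [q]. The summand 1 of [h] makes this true for small
     [zeta], besides keeping the logarithm defined at its zeros. *)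
  have t2 : `|p z| + `|q z| <= h z.
    rewrite /h -!expr2 -(real_normK (num_real (p z))) -(real_normK (num_real (q z))).
    have := sqr_ge0 (`|p z| - 1); have := sqr_ge0 (`|q z| - 1).
    have := sqr_ge0 `|p z|; have := sqr_ge0 `|q z|; nra.
  have : (`|p z| + `|q z|) * K <= h z * K by rewrite ler_wpM2r.
  lra.
have [x1 x1r nZ1] := thin_dense thinZ y0 r0.
(* [ln h] has gradient bounded by [2 K] off [Z], so [thin_lipschitz] compares it with its value at
   the reference point [x1], which is at distance at most [2 r]. *)
pose N := expR (ln (h x1) + 4 * (2 * K) * (2 * r)).
have hN z : `|z - y0| < r -> ~ Z z -> h z <= N.
  move=> zr nZ; rewrite -[leLHS]lnK; last by rewrite posrE.
  rewrite ler_expR.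
  have := thin_lipschitz thinZ phi_bound x1r zr nZ1 nZ => /=.
  move=> /(le_trans (ler_norm _)) le1.
  have le2 : `|z - x1| <= 2 * r.
    rewrite -(subrK y0 z) -addrA; apply: (le_trans (ler_normD _ _)).
    by rewrite mulr_natl mulr2n lerD // ltW // distrC.
  have : 4 * (2 * K) * `|z - x1| <= 4 * (2 * K) * (2 * r).
    by rewrite ler_wpM2l // !mulr_ge0.
  lra.
have bpq z : `|z - y0| < r -> ~ Z z -> `|p z| <= N /\ `|q z| <= N.
  move=> zr nZ; have := hN z zr nZ.
  rewrite /h -!expr2 -(real_normK (num_real (p z))) -(real_normK (num_real (q z))).
  have := sqr_ge0 (`|p z| - 1); have := sqr_ge0 (`|q z| - 1).
  have := sqr_ge0 `|p z|; have := sqr_ge0 `|q z| => *; split; nra.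
have N0 : 0 <= N by exact: expR_ge0.
(* Now that [zeta] is bounded by [N], the equation bounds its derivatives by [|beta| + |A| N]. *)
have grad (f : E -> R) : (forall z, `|z - y0| < r -> ~ Z z ->
     differentiable f z /\ forall a, `|pd a f z| <= K + K * N) -> lipschitz_off Z f y0.
  move=> H; exists r, (4 * (K + K * N)); split=> //.
    by rewrite mulr_ge0 // addr_ge0 // mulr_ge0.
  exact: thin_lipschitz.
split; apply: grad => z zr nZ; have [[dp dq] _] := zeta_par (bU _ zr) nZ;
  have [bp bq] := bpq z zr nZ; split=> // a.
  rewrite (pd_Re a (bU _ zr) nZ); apply: (le_trans (ler_normD _ _)).
  by apply: lerD; [exact: bR | rewrite normrM; apply: ler_pM => //; exact: bA].
rewrite (pd_Im a (bU _ zr) nZ); apply: (le_trans (ler_normB _ _)).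
by apply: lerD; [exact: bI | rewrite normrM; apply: ler_pM => //; exact: bA].
Qed.

Definition extendC (y : E) : C :=
  (extend_off Z (Re \o zeta) y +i* extend_off Z (Im \o zeta) y)%C.

Lemma extendC_id y : U y -> ~ Z y -> extendC y = zeta y.
Proof.
move=> Uy nZ; have [l1 l2] := zeta_lipschitz Uy.
by apply: C_ext => /=; rewrite extend_off_id.
Qed.

Lemma extendC_continuous : CnC 0 U extendC.
Proof.
split; (split; last exact: I) => y Uy; have [l1 l2] := zeta_lipschitz Uy.
  exact: extend_off_continuous l1.
exact: extend_off_continuous l2.
Qed.

(** Continuity of [extendC] makes the right-hand side continuous on all of [U]. It is therefore an
    admissible candidate for the partial derivatives in [thin_C1], applied to the real and imaginary
    parts. *)
Lemma extendC_par y : U y ->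
  Cdiff extendC y /\ forall a, pdC a extendC y = beta a y - A a y * extendC y.
Proof.
move=> Uy; have [[c1 _] [c2 _]] := extendC_continuous.
have CbA a : CnC 0 U (fun y => beta a y - A a y * extendC y).
  exact: (CnCB oU (beta0 a) (CnCM oU (A0 a) extendC_continuous)).
have off z : U z -> ~ Z z -> {near z, extendC =1 zeta}.
  move=> Uz nZ; apply: filterS (open_nbhs_nbhs (conj oUZ (conj Uz nZ))).
  by move=> w [Uw nZw]; exact: extendC_id.
have offRe z : U z -> ~ Z z -> {near z, Re \o extendC =1 Re \o zeta}.
  by move=> Uz nZ; apply: filterS (off z Uz nZ) => w; exact: congr1.
have offIm z : U z -> ~ Z z -> {near z, Im \o extendC =1 Im \o zeta}.
  by move=> Uz nZ; apply: filterS (off z Uz nZ) => w; exact: congr1.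
have P1 z : U z -> ~ Z z -> differentiable (Re \o extendC) z /\
    forall a, pd a (Re \o extendC) z = Re (beta a z - A a z * extendC z).
  move=> Uz nZ; have [[d1 d2] pz] := zeta_par Uz nZ.
  split; last by move=> a; rewrite (pd_near _ (offRe z Uz nZ)) extendC_id // -pz.
  apply: near_eq_differentiable d1; apply: filterS (off z Uz nZ) => w ew.
  exact: congr1 (esym ew).
have P2 z : U z -> ~ Z z -> differentiable (Im \o extendC) z /\
    forall a, pd a (Im \o extendC) z = Im (beta a z - A a z * extendC z).
  move=> Uz nZ; have [[d1 d2] pz] := zeta_par Uz nZ.
  split; last by move=> a; rewrite (pd_near _ (offIm z Uz nZ)) extendC_id // -pz.
  apply: near_eq_differentiable d2; apply: filterS (off z Uz nZ) => w ew.
  exact: congr1 (esym ew).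
have [dR pR] := thin_C1 thinZ oU c1 (fun z a Uz => Cn_continuous (proj1 (CbA a)) Uz) P1 Uy.
have [dI pI] := thin_C1 thinZ oU c2 (fun z a Uz => Cn_continuous (proj2 (CbA a)) Uz) P2 Uy.
by split=> // a; apply: C_ext; [exact: pR | exact: pI].
Qed.

(** A bootstrap: the equation expresses the first derivatives through [beta], [A] and [extendC]
    itself, so each class reached yields the next one, up to that of [A] and [beta]. *)
Lemma extendC_CnC n : (forall a, CnC n U (A a)) -> (forall a, CnC n U (beta a)) ->
  CnC n U extendC.
Proof.
elim: n => [|n IH] cA cb; first exact: extendC_continuous.
have IHn : CnC n U extendC by apply: IH => a; exact: CnCS.
have H a : CnC n U (pdC a extendC).
  apply: CnC_ext (CnCB oU (CnCS (cb a)) (CnCM oU (CnCS (cA a)) IHn)) => // y Uy.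
  by have [_ ->] := extendC_par Uy.
have [[c1 _] [c2 _]] := extendC_continuous.
split; split; [exact: c1 | | exact: c2 |]; split=> [a y Uy|a].
- by apply: diff_derivable; have [[]] := extendC_par Uy.
- by have [hR _] := H a; exact: hR.
- by apply: diff_derivable; have [[]] := extendC_par Uy.
- by have [_ hI] := H a; exact: hI.
Qed.

End ParallelExtension.

(** * Anti-selfdual forms *)

Section LinearAlgebra.
Variable R : realType.
Local Notation C := R[i].
Local Notation Re := (@complex.Re R).
Local Notation Im := (@complex.Im R).

Local Notation o0 := (@Ordinal 4 0 isT).
Local Notation o1 := (@Ordinal 4 1 isT).
Local Notation o2 := (@Ordinal 4 2 isT).
Local Notation o3 := (@Ordinal 4 3 isT).

Lemma sum_I4 (V : nmodType) (F : 'I_4 -> V) :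
  \sum_(i < 4) F i = F o0 + F o1 + F o2 + F o3.
Proof.
rewrite !big_ord_recl big_ord0 addr0 !addrA.
by congr (F _ + F _ + F _ + F _); apply: val_inj.
Qed.

Lemma posdef_unitmx (n : nat) (G : 'M[R]_n) :
  (forall v : 'rV_n, v != 0 -> 0 < (v *m G *m v^T) 0 0) -> G \in unitmx.
Proof.
move=> pos; rewrite -row_free_unit -kermx_eq0; apply/eqP/row_matrixP => i.
rewrite row0; apply/eqP; apply: contraT => /pos.
by rewrite -row_mul mulmx_ker row0 mul0mx mxE ltxx.
Qed.

Lemma posdef_inv (n : nat) (G : 'M[R]_n) : G^T = G ->
  (forall v : 'rV_n, v != 0 -> 0 < (v *m G *m v^T) 0 0) ->
  forall v : 'rV_n, v != 0 -> 0 < (v *m invmx G *m v^T) 0 0.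
Proof.
move=> symG pos v v0; have uG := posdef_unitmx pos.
have := pos (v *m invmx G); rewrite mulmxKV // trmx_mul trmx_inv symG -mulmxA.
rewrite mulmxA; apply; apply: contra_neq v0 => /(congr1 (mulmx^~ G)).
by rewrite mulmxKV // mul0mx.
Qed.

(** A permutation agreeing with [t] at 0 and 1 is [t] itself or [t] precomposed with the exchange of
    2 and 3, of opposite sign. *)
Lemma sum_star (V : lmodType R) (F : 'I_4 -> 'I_4 -> V) (t : 'S_4) :
  \sum_(s : 'S_4 | (s o0 == t o0) && (s o1 == t o1))
     ((-1) ^+ s : R) *: F (s o2) (s o3) =
  ((-1) ^+ t : R) *: (F (t o2) (t o3) - F (t o3) (t o2)).
Proof.
rewrite (reindex_inj (mulIg t)) /=.
have E (s : 'S_4) : ((s * t)%g o0 == t o0) && ((s * t)%g o1 == t o1) =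
    (s \in [:: 1%g; tperm o2 o3]).
  rewrite !permM !(inj_eq perm_inj) !inE.
  apply/andP/orP => [[/eqP s0 /eqP s1]|[]/eqP ->]; last 2 first.
  - by rewrite !perm1 !eqxx.
  - by rewrite !tpermD.
  have s2 : s o2 = o2 \/ s o2 = o3.
    case E2 : (s o2) => [[|[|[|[|//]]]] i]; [| |
      by left; apply: val_inj|by right; apply: val_inj].
      have : s o2 = s o0 by rewrite s0 E2; apply: val_inj.
      by move/perm_inj.
    have : s o2 = s o1 by rewrite s1 E2; apply: val_inj.
    by move/perm_inj.
  have s3 : s o3 = o2 \/ s o3 = o3.
    case E2 : (s o3) => [[|[|[|[|//]]]] i]; [| |
      by left; apply: val_inj|by right; apply: val_inj].
      have : s o3 = s o0 by rewrite s0 E2; apply: val_inj.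
      by move/perm_inj.
    have : s o3 = s o1 by rewrite s1 E2; apply: val_inj.
    by move/perm_inj.
  case: s2 s3 => s2 [] s3.
  - by have /perm_inj : s o2 = s o3 by rewrite s2 s3.
  - left; apply/eqP/permP; apply: forall_I4; rewrite perm1 //.
  - right; apply/eqP/permP; apply: forall_I4; rewrite ?tpermL ?tpermR ?tpermD //.
  - by have /perm_inj : s o2 = s o3 by rewrite s2 s3.
rewrite (eq_bigl _ _ E) -big_uniq /=; last first.
  rewrite inE andbT; apply/eqP => /permP /(_ o2); rewrite perm1 tpermL.
  by move/(congr1 val).
rewrite !big_cons big_nil addr0 mul1g !permM tpermL tpermR odd_permM odd_tperm /=.
by rewrite signrN scaleNr scalerBr.
Qed.

Section Star.
Variables (A B : 'M[R]_4) (c : R).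
Hypotheses (skewA : A^T = - A) (skewB : B^T = - B).
Hypothesis star : forall t : 'S_4,
  A (t o0) (t o1) = - c * ((-1) ^+ t * B (t o2) (t o3)).

Let AN a b : A a b = - A b a.
Proof. by have /matrixP/(_ b a) := skewA; rewrite !mxE. Qed.

Let BN a b : B a b = - B b a.
Proof. by have /matrixP/(_ b a) := skewB; rewrite !mxE. Qed.

Let diag0 (D : 'M[R]_4) : (forall a b, D a b = - D b a) -> forall a, D a a = 0.
Proof. by move=> h a; have := h a a; lra. Qed.

Let A01 : A o0 o1 = - c * B o2 o3.
Proof. by have := star 1; rewrite !perm1 odd_perm1 expr0 mul1r. Qed.

Let A02 : A o0 o2 = c * B o1 o3.
Proof.
have := star (tperm o1 o2); rewrite odd_tperm /= !permE /= => ->.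
by rewrite expr1; ring.
Qed.

Let A03 : A o0 o3 = - c * B o1 o2.
Proof.
have := star (tperm o1 o3); rewrite odd_tperm /= !permE /= => ->.
by rewrite expr1 [B o2 o1]BN; ring.
Qed.

Let A12 : A o1 o2 = - c * B o0 o3.
Proof.
have := star (tperm o0 o1 * tperm o0 o2).
by rewrite odd_permM !odd_tperm /= !permM !permE /= => ->; rewrite expr0; ring.
Qed.

Let A13 : A o1 o3 = c * B o0 o2.
Proof.
have := star (tperm o0 o1 * tperm o0 o3).
rewrite odd_permM !odd_tperm /= !permM !permE /= => ->; rewrite expr0 [B o2 o0]BN; ring.
Qed.

Let A23 : A o2 o3 = - c * B o0 o1.
Proof.
have := star (tperm o0 o2 * tperm o1 o3).
by rewrite odd_permM !odd_tperm /= !permM !permE /= => ->; rewrite expr0; ring.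
Qed.

(** The Pfaffian of [B]. *)
Let pf := B o0 o1 * B o2 o3 - B o0 o2 * B o1 o3 + B o0 o3 * B o1 o2.

(** For a skew matrix of size 4, the product of its Euclidean star with itself is minus the Pfaffian
    times the identity; here [A] is [- c] times that star. The six relations [A01] to [A23] reduce
    this to an entrywise check. *)
Lemma star_mulmx : A *m B = (c * pf)%:M.
Proof.
apply/matrixP; apply: forall_I4; apply: forall_I4; rewrite !mxE sum_I4 /=;
  rewrite ?(diag0 AN) ?(diag0 BN) ?[A o1 o0]AN ?[A o2 o0]AN ?[A o3 o0]AN ?[A o2 o1]AN
    ?[A o3 o1]AN ?[A o3 o2]AN ?A01 ?A02 ?A03 ?A12 ?A13 ?A23
    ?[B o1 o0]BN ?[B o2 o0]BN ?[B o3 o0]BN ?[B o2 o1]BN ?[B o3 o1]BN ?[B o3 o2]BN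
    ?mulr1n ?mulr0n /pf; ring.
Qed.

Lemma star_eq0 : c = 0 -> A = 0.
Proof.
move=> c0; apply/matrixP; apply: forall_I4; apply: forall_I4; rewrite !mxE;
  rewrite ?(diag0 AN) ?[A o1 o0]AN ?[A o2 o0]AN ?[A o3 o0]AN ?[A o2 o1]AN
    ?[A o3 o1]AN ?[A o3 o2]AN ?A01 ?A02 ?A03 ?A12 ?A13 ?A23 ?c0; ring.
Qed.

(** The hypothesis is [A /\ al = 0] in components. Its four independent components are, up to [c]
    and signs, the rows of [B al = 0]; multiplying by [A] gives [c pf al = 0]. *)
Lemma star_wedge_inj (al : 'I_4 -> C) : c != 0 -> c * pf != 0 ->
  (forall a b d, (A a b)%:C * al d + (A b d)%:C * al a + (A d a)%:C * al b = 0) ->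
  forall a, al a = 0.
Proof.
move=> c0 k0 H.
have cC : c%:C != 0 by rewrite fmorph_eq0.
have D a : \sum_b (B a b)%:C * al b = 0.
  apply: (mulfI cC); rewrite mulr0 sum_I4.
  move: a; apply: forall_I4.
  - have := H o1 o2 o3; rewrite A12 A23 [A o3 o1]AN A13 (diag0 BN).
    by rewrite ?rmorphN ?rmorphM ?rmorphN /= => e; rewrite -[RHS]oppr0 -e; ring.
  - have := H o0 o2 o3; rewrite A02 A23 [A o3 o0]AN A03 (diag0 BN) [B o1 o0]BN.
    by rewrite ?rmorphN ?rmorphM ?rmorphN /= => e; rewrite -e; ring.
  - have := H o0 o1 o3; rewrite A01 A13 [A o3 o0]AN A03 (diag0 BN) [B o2 o0]BN [B o2 o1]BN.
    by rewrite ?rmorphN ?rmorphM ?rmorphN /= => e; rewrite -[RHS]oppr0 -e; ring.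
  - have := H o0 o1 o2; rewrite A01 A12 [A o2 o0]AN A02 (diag0 BN).
    rewrite [B o3 o0]BN [B o3 o1]BN [B o3 o2]BN.
    by rewrite ?rmorphN ?rmorphM ?rmorphN /= => e; rewrite -e; ring.
have kC : (c * pf)%:C != 0 by rewrite fmorph_eq0.
move=> a; apply: (mulfI kC); rewrite mulr0.
have AB b : (\sum_d A a d * B d b)%:C = (a == b)%:R * (c * pf)%:C :> C.
  have /matrixP/(_ a b) := star_mulmx; rewrite !mxE => ->.
  by case: eqP => _; rewrite ?mulr1n ?mulr0n ?mul1r ?mul0r.
transitivity (\sum_b (\sum_d A a d * B d b)%:C * al b).
  under eq_bigr do rewrite AB.
  rewrite (bigD1 a) //= eqxx mul1r big1 ?addr0 // => b /negPf ba.
  by rewrite eq_sym ba !mul0r.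
under eq_bigr do rewrite rmorph_sum /= mulr_suml.
rewrite exchange_big /= big1 // => d _.
under eq_bigr do rewrite rmorphM /= -mulrA.
by rewrite -mulr_sumr D mulr0.
Qed.

End Star.

(* For w = i A and B = G^-1 A G^-1, anti-selfduality says that A is - sqrt(det G)
   times the Euclidean star of B, so that A B is a multiple of the identity by the
   Pfaffian of B.  If that multiple is 0 then A G^-1 A^T = 0, whence A = 0. *)
Section Antiselfdual.
Variables (G : 'M[R]_4) (A : 'M[R]_4).
Hypotheses (symG : G^T = G) (skewA : A^T = - A).
Hypothesis posG : forall v : 'rV_4, v != 0 -> 0 < (v *m G *m v^T) 0 0.
Local Notation imag := (fun t : R => (0 +i* t)%C).
Hypothesis asd : selfdual_part G (map_mx imag A) = 0.

Let B := invmx G *m A *m invmx G.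
Let c := Num.sqrt (\det G).

Let skewB : B^T = - B.
Proof.
by rewrite /B !trmx_mul trmx_inv symG skewA mulNmx mulmxN mulmxA.
Qed.

Let imagB : RtoC_mx (invmx G) *m map_mx imag A *m RtoC_mx (invmx G) = map_mx imag B.
Proof.
have imE m (D : 'M[R]_(m, 4)) : map_mx imag D = imag 1 *: RtoC_mx D.
  by apply/matrixP => a b; rewrite !mxE; apply: C_ext; rewrite ?ReM ?ImM /=; ring.
by rewrite !imE /B /RtoC_mx !map_mxM -scalemxAr -scalemxAl.
Qed.

(** As [B] is skew, the two terms left by [sum_star] are equal, which absorbs the factor 1/2 in
    [hodge]. *)
Let asd_star (t : 'S_4) : A (t o0) (t o1) = - c * ((-1) ^+ t * B (t o2) (t o3)).
Proof.
move: imagB skewB; move: B => B0 imB skB.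
have inE k (lt4 : (k < 4)%N) : inord k = @Ordinal 4 k lt4.
  by apply: val_inj; rewrite /= inordK.
have : map_mx imag A = - hodge G (map_mx imag A).
  move/eqP: asd; rewrite /selfdual_part scaler_eq0 invr_eq0 pnatr_eq0 /=.
  by rewrite addr_eq0 => /eqP.
move=> /matrixP/(_ (t o0) (t o1)) /(congr1 Im).
rewrite /hodge imB !mxE ImN ImM ImC mul0r addr0 Im_sum.
rewrite (inE 0 isT) (inE 1 isT) (inE 2 isT) (inE 3 isT) ReC.
rewrite (eq_bigr (fun s : 'S_4 => ((-1) ^+ s : R) *: (B0 (s o2) (s o3) : R^o))); last first.
  move=> s _; rewrite mxE.
  by case: (odd_perm s); rewrite ?expr1 ?expr0 ImM /= /GRing.scale /=; ring.
rewrite sum_star => E1; apply: (etrans E1) => {E1}.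
have -> : B0 (t o3) (t o2) = - B0 (t o2) (t o3).
  by have /matrixP/(_ (t o2) (t o3)) := skB; rewrite !mxE.
rewrite -/c /GRing.scale /=.
by move: (B0 (t o2) (t o3)) ((-1) ^+ t) c => b e d; field.
Qed.

Hypothesis A_neq0 : A != 0.

(** [Num.sqrt] vanishes on nonpositive reals, and a vanishing factor in the star relation would
    force [A = 0]. Positivity of the determinant is thus read off from a nonzero anti-selfdual
    form. *)
Lemma asd_det_gt0 : 0 < \det G.
Proof.
rewrite -sqrtr_gt0 lt_def sqrtr_ge0 andbT; apply: contra_neq A_neq0.
exact: star_eq0 skewA skewB asd_star.
Qed.

Lemma asd_wedge_inj (al : 'I_4 -> C) :
  (forall a b d, (A a b)%:C * al d + (A b d)%:C * al a + (A d a)%:C * al b = 0) ->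
  forall a, al a = 0.
Proof.
apply: (star_wedge_inj skewA skewB asd_star).
  by rewrite gt_eqF // sqrtr_gt0 asd_det_gt0.
apply: contra_neq A_neq0 => k0; have uG := posdef_unitmx posG.
have H : A *m invmx G *m A = 0.
  have := star_mulmx skewA skewB asd_star.
  rewrite k0 raddf0 /B !mulmxA => /(congr1 (mulmx^~ G)).
  by rewrite mulmxKV // mul0mx.
apply/row_matrixP => a; rewrite row0; apply/eqP.
apply: contraT => /(posdef_inv symG posG).
have -> : (row a A)^T = - (A *m (delta_mx a 0 : 'cV_4)).
  by rewrite tr_row skewA colE mulNmx.
by rewrite mulmxN mulmxA -!row_mul H mul0mx row0 oppr0 mxE ltxx.
Qed.

End Antiselfdual.

End LinearAlgebra.

(** * Changes of chart and gauge, Bianchi identity *)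

Section ExteriorDerivative.
Variable R : realType.
Local Notation E := 'rV[R]_4.
Local Notation C := R[i].
Implicit Types (al ga : 'I_4 -> E -> C).

Definition dform al (y : E) : 'M[C]_4 :=
  \matrix_(a, b) (pdC a (al b) y - pdC b (al a) y).

Definition wedge al ga (y : E) : 'M[C]_4 :=
  \matrix_(a, b) (al a y * ga b y - al b y * ga a y).

Definition pull (phi : E -> E) al (a : 'I_4) (y : E) : C :=
  \sum_b (pd a (fun z => phi z 0 b) y)%:C * al b (phi y).

Definition Jmx (phi : E -> E) (y : E) : 'M[R]_4 :=
  \matrix_(a, b) pd a (fun z => phi z 0 b) y.

Lemma congr_mxE (J : 'M[R]_4) (w : 'M[C]_4) a b :
  (RtoC_mx J *m w *m (RtoC_mx J)^T) a b =
  \sum_c \sum_d (J a c)%:C * (J b d)%:C * w c d.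
Proof.
rewrite mxE exchange_big; apply: eq_bigr => d _.
rewrite !mxE mulr_suml; apply: eq_bigr => c _; rewrite !mxE; ring.
Qed.

Lemma wedge_pull phi al ga y : wedge (pull phi al) (pull phi ga) y =
  RtoC_mx (Jmx phi y) *m wedge al ga (phi y) *m (RtoC_mx (Jmx phi y))^T.
Proof.
apply/matrixP => a b; rewrite congr_mxE mxE /pull.
have H u v : (\sum_c (pd u (fun z => phi z 0 c) y)%:C * al c (phi y)) *
    (\sum_d (pd v (fun z => phi z 0 d) y)%:C * ga d (phi y)) =
   \sum_c \sum_d (Jmx phi y u c)%:C * (Jmx phi y v d)%:C * (al c (phi y) * ga d (phi y)).
  rewrite mulr_suml; apply: eq_bigr => c _; rewrite mulr_sumr; apply: eq_bigr => d _.
  by rewrite !mxE; ring.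
apply: (etrans (congr2 (fun s t => s - t) (H a b) (H b a))).
rewrite [X in _ - X]exchange_big -sumrB; apply: eq_bigr => c _.
by rewrite -sumrB; apply: eq_bigr => d _; rewrite !mxE; ring.
Qed.

Section Pullback.
Variables (V W : set E) (phi : E -> E).
Hypotheses (oV : open V) (oW : open W).
Hypothesis phi_C2 : forall b, Cn 2 V (fun z => phi z 0 b).
Hypothesis phiV : forall y, V y -> W (phi y).

Lemma phi_diff y : V y -> differentiable phi y.
Proof. by move=> Vy; apply: differentiable_rV => b; exact: Cn1_differentiable (phi_C2 b) Vy. Qed.

Lemma Cdiff_comp_phi (f : E -> C) y : CnC 1 W f -> V y -> Cdiff (f \o phi) y.
Proof.
move=> cf Vy; apply: Cdiff_comp; first exact: phi_diff.
by apply: CnC_Cdiff cf _ => //; exact: phiV.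
Qed.

Let Cdiff_J a b y : V y -> Cdiff (fun z => (pd a (fun w => phi w 0 b) z)%:C) y.
Proof.
move=> Vy; have [_ [_ /(_ a) c1]] := phi_C2 b.
have {}c1 : Cn 1 V (pd a (fun w => phi w 0 b)) by exact: c1.
exact: (CnC_Cdiff oV (CnC_real c1) Vy).
Qed.

Lemma Cdiff_pull al a y : (forall b, CnC 1 W (al b)) -> V y -> Cdiff (pull phi al a) y.
Proof.
move=> cal Vy; apply: Cdiff_sum => b; apply: CdiffM; first exact: Cdiff_J.
exact: Cdiff_comp_phi.
Qed.

(* The second derivatives of phi cancel by symmetry. *)
Lemma dform_pull al y : (forall b, CnC 1 W (al b)) -> V y ->
  dform (pull phi al) y =
  RtoC_mx (Jmx phi y) *m dform al (phi y) *m (RtoC_mx (Jmx phi y))^T.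
Proof.
move=> cal Vy; apply/matrixP => a b; rewrite congr_mxE mxE.
have [T Tsym H] : exists2 T : 'I_4 -> 'I_4 -> C, T a b = T b a &
    forall u v, pdC u (pull phi al v) y = T u v +
      \sum_c \sum_d (Jmx phi y u c)%:C * (Jmx phi y v d)%:C * pdC c (al d) (phi y).
  exists (fun u v => \sum_d (pd u (pd v (fun z => phi z 0 d)) y)%:C * al d (phi y)).
    apply: eq_bigr => d _.
    have e := pd_comm a b oV (phi_C2 d) Vy.
    exact: (congr1 (fun t : R => t%:C * al d (phi y)) e).
  move=> u v; rewrite exchange_big -big_split /= /pull pdC_sum; last first.
    by move=> d; apply: CdiffM; [exact: Cdiff_J | exact: Cdiff_comp_phi].
  apply: eq_bigr => d _; rewrite pdCM; [|exact: Cdiff_J|exact: Cdiff_comp_phi].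
  rewrite pdC_real; congr (_ + _).
  rewrite (pdC_comp u (phi_diff Vy) (CnC_Cdiff oW (cal d) (phiV Vy))) mulr_sumr.
  by apply: eq_bigr => c _; rewrite !mxE; ring.
rewrite (H a b) (H b a) Tsym opprD addrACA subrr add0r.
rewrite [X in _ - X]exchange_big -sumrB; apply: eq_bigr => c _.
by rewrite -sumrB; apply: eq_bigr => d _; rewrite [dform _ _ _ _]mxE; ring.
Qed.

Variable u : E -> C.
Hypothesis u_C2 : CnC 2 V u.
Hypothesis u_unit : forall y, V y -> u y * (u y)^*%C = 1.

Let Cdiff_u y : V y -> Cdiff u y.
Proof. by move=> Vy; exact: (CnC_Cdiff oV u_C2 Vy). Qed.

Let Cdiff_pdu a y : V y -> Cdiff (pdC a u) y.
Proof. by move=> Vy; exact: (CnC_Cdiff oV (CnC_pd a u_C2) Vy). Qed.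

(** The conjugate of a unit complex number is its inverse, so this is the derivative [- u^-2 du] of
    an inverse. *)
Lemma pdC_conj_unit a y : V y ->
  pdC a (fun z => (u z)^*%C) y = - ((u y)^*%C * (u y)^*%C * pdC a u y).
Proof.
move=> Vy; have dc : Cdiff (fun z => (u z)^*%C) y by apply: Cdiff_conj; exact: Cdiff_u.
have : pdC a (fun z => u z * (u z)^*%C) y = 0.
  by rewrite (pdCE a oV Vy u_unit) pdC_cst.
rewrite (pdCM a (Cdiff_u Vy) dc) => h.
rewrite -[LHS]mul1r -(u_unit Vy); apply/eqP; rewrite -subr_eq0; apply/eqP.
transitivity ((u y)^*%C * (pdC a u y * (u y)^*%C + u y * pdC a (fun z => (u z)^*%C) y)).
  ring.
by rewrite h mulr0.
Qed.

(** The form [u^-1 du], with the inverse written as a conjugate. *)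
Definition gauge (a : 'I_4) (y : E) : C := (u y)^*%C * pdC a u y.

Lemma Cdiff_gauge a y : V y -> Cdiff (gauge a) y.
Proof.
by move=> Vy; apply: CdiffM; [apply: Cdiff_conj; exact: Cdiff_u | exact: Cdiff_pdu].
Qed.

(** Locally this form is [d (log u)]. In the direct computation the product of the two first
    derivatives of [u] is symmetric in the indices, and the second derivatives commute. *)
Lemma dform_gauge y : V y -> dform gauge y = 0.
Proof.
move=> Vy; apply/matrixP => a b; rewrite !mxE.
have dc : Cdiff (fun z => (u z)^*%C) y by apply: Cdiff_conj; exact: Cdiff_u.
rewrite /gauge !pdCM //; try exact: Cdiff_pdu.
rewrite !pdC_conj_unit // (pdC_comm a b oV u_C2 Vy); ring.
Qed.

(** The gauge term is closed, so the curvature of a line bundle changes by pull-back alone. *)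
Lemma dform_gauge_change al A' y : (forall b, CnC 1 W (al b)) -> V y ->
  (forall z a, V z -> A' a z = pull phi al a z - gauge a z) ->
  dform A' y = RtoC_mx (Jmx phi y) *m dform al (phi y) *m (RtoC_mx (Jmx phi y))^T.
Proof.
move=> cal Vy A'E; rewrite -dform_pull //.
apply/matrixP => a b; have /matrixP/(_ a b) := dform_gauge Vy; rewrite !mxE => g0.
have H c d : pdC c (A' d) y = pdC c (pull phi al d) y - pdC c (gauge d) y.
  rewrite -pdCB; [|exact: Cdiff_pull|exact: Cdiff_gauge].
  by apply: (pdCE c oV Vy) => z Vz; exact: A'E.
rewrite !H; move: g0.
move: (pdC a (gauge b) y) (pdC b (gauge a) y).
move: (pdC a (pull phi al b) y) (pdC b (pull phi al a) y) => p1 p2 g1 g2 g0.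
have -> : p1 - g1 - (p2 - g2) = p1 - p2 - (g1 - g2) by ring.
by rewrite g0 subr0.
Qed.

(** Differentiating the factor [u] of [be'] creates a term [du /\ be]; the gauge term of [A'],
    wedged with [u be], removes it because [u] has modulus 1. *)
Lemma dsigma_gauge_change al be A' be' y :
  (forall b, CnC 1 W (al b)) -> (forall b, CnC 1 W (be b)) -> V y ->
  (forall z a, V z -> A' a z = pull phi al a z - gauge a z) ->
  (forall z a, V z -> be' a z = u z * pull phi be a z) ->
  dform be' y + wedge A' be' y =
  u y *: (RtoC_mx (Jmx phi y) *m (dform be (phi y) + wedge al be (phi y)) *m
     (RtoC_mx (Jmx phi y))^T).
Proof.
move=> cal cbe Vy A'E be'E.
rewrite mulmxDr mulmxDl -dform_pull // -wedge_pull.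
apply/matrixP => a b; rewrite !mxE.
have H c d : pdC c (be' d) y = pdC c u y * pull phi be d y + u y * pdC c (pull phi be d) y.
  rewrite -pdCM; [|exact: Cdiff_u|exact: Cdiff_pull].
  by apply: (pdCE c oV Vy) => z Vz; exact: be'E.
rewrite !H !A'E // !be'E // /gauge.
have := u_unit Vy.
move: (pdC a (pull phi be b) y) (pdC b (pull phi be a) y).
move: (pull phi al a y) (pull phi al b y) (pull phi be a y) (pull phi be b y).
move: (u y) ((u y)^*%C) (pdC a u y) (pdC b u y) => v v' ua ub A1 A2 g1 g2 p1 p2 vv'.
apply/eqP; rewrite -subr_eq0; apply/eqP.
transitivity ((1 - v * v') * (ua * g2 - ub * g1)); first by ring.
by rewrite vv' subrr mul0r.
Qed.

End Pullback.

End ExteriorDerivative.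

(** * The Bianchi identity for a form proportional to the curvature *)

Section CovariantCoefficient.
Variable R : realType.
Local Notation E := 'rV[R]_4.
Local Notation C := R[i].
Local Notation Re := (@complex.Re R).
Local Notation Im := (@complex.Im R).

(** Pure algebra for [covariant_coef]. The letters [aab], [bab] and [za] stand for the derivatives
    along [a] of [A_b], [beta_b] and [z]; [sA] and [sB] are second derivatives, already identified
    by symmetry. The three differentiated equations are added cyclically, and the undifferentiated
    ones enter with factors [A_c], [A_a], [A_b]. *)
Lemma cyclic_identity (Ra Rb Rc Aa Ab Ac Ba Bb Bc z za zb zc
    aab aba abc acb aca aac bab bba bbc bcb bca bac
    sA1 sA2 sA3 sB1 sB2 sB3 : C) :
  sB1 - sB2 + (aca * Bb + Aa * bcb - (acb * Ba + Ab * bca)) =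
    zc * (aab - aba) + z * (sA1 - sA2) ->
  sB3 - sB1 + (aab * Bc + Ab * bac - (aac * Bb + Ac * bab)) =
    za * (abc - acb) + z * (sA3 - sA1) ->
  sB2 - sB3 + (abc * Ba + Ac * bba - (aba * Bc + Aa * bbc)) =
    zb * (aca - aac) + z * (sA2 - sA3) ->
  bab - bba + (Aa * Bb - Ab * Ba) = z * (aab - aba) ->
  bbc - bcb + (Ab * Bc - Ac * Bb) = z * (abc - acb) ->
  bca - bac + (Ac * Ba - Aa * Bc) = z * (aca - aac) ->
  (aab - aba) * (zc + Ac * z - Bc) + (abc - acb) * (za + Aa * z - Ba)
   + (aca - aac) * (zb + Ab * z - Bb) = 0.
Proof.
move=> e1 e2 e3 d1 d2 d3.
transitivity (
 - (sB1 - sB2 + (aca * Bb + Aa * bcb - (acb * Ba + Ab * bca))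
    - (zc * (aab - aba) + z * (sA1 - sA2)))
 - (sB3 - sB1 + (aab * Bc + Ab * bac - (aac * Bb + Ac * bab))
    - (za * (abc - acb) + z * (sA3 - sA1)))
 - (sB2 - sB3 + (abc * Ba + Ac * bba - (aba * Bc + Aa * bbc))
    - (zb * (aca - aac) + z * (sA2 - sA3)))
 - Ac * (bab - bba + (Aa * Bb - Ab * Ba) - z * (aab - aba))
 - Aa * (bbc - bcb + (Ab * Bc - Ac * Bb) - z * (abc - acb))
 - Ab * (bca - bac + (Ac * Ba - Aa * Bc) - z * (aca - aac))); first by ring.
by rewrite e1 e2 e3 d1 d2 d3 !subrr !mulr0 !subr0 oppr0.
Qed.

Variables (U : set E) (A be : 'I_4 -> E -> C) (z : E -> C).
Hypotheses (oU : open U) (A2 : forall a, CnC 2 U (A a)) (be2 : forall a, CnC 2 U (be a)).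
Hypothesis z1 : CnC 1 U z.
Hypothesis D_eq : forall y, U y -> dform be y + wedge A be y = z y *: dform A y.

Let Cd1 (f : E -> C) n y : CnC n.+1 U f -> U y -> Cdiff f y.
Proof. by move=> cf Uy; exact: (CnC_Cdiff oU cf Uy). Qed.

Let Cdp (f : E -> C) a y : CnC 2 U f -> U y -> Cdiff (pdC a f) y.
Proof. by move=> cf Uy; exact: (CnC_Cdiff oU (CnC_pd a cf) Uy). Qed.

Let D_ab y a b : U y -> pdC a (be b) y - pdC b (be a) y + (A a y * be b y - A b y * be a y) =
  z y * (pdC a (A b) y - pdC b (A a) y).
Proof. by move=> /D_eq /matrixP/(_ a b); rewrite !mxE. Qed.

Let pD_ab y a b c : U y ->
  pdC c (pdC a (be b)) y - pdC c (pdC b (be a)) y +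
   (pdC c (A a) y * be b y + A a y * pdC c (be b) y -
    (pdC c (A b) y * be a y + A b y * pdC c (be a) y)) =
  pdC c z y * (pdC a (A b) y - pdC b (A a) y) +
  z y * (pdC c (pdC a (A b)) y - pdC c (pdC b (A a)) y).
Proof.
move=> Uy.
have dA d := Cd1 (A2 d) Uy; have db d := Cd1 (be2 d) Uy.
have dpA d e := Cdp e (A2 d) Uy; have dpb d e := Cdp e (be2 d) Uy.
have dz := Cd1 z1 Uy.
have dD := CdiffD (dpb b a) (CdiffN (dpb a b)).
have dW := CdiffD (CdiffM (dA a) (db b)) (CdiffN (CdiffM (dA b) (db a))).
have dF := CdiffD (dpA b a) (CdiffN (dpA a b)).
transitivity (pdC c (fun w => pdC a (be b) w - pdC b (be a) w +
    (A a w * be b w - A b w * be a w)) y).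
  apply: esym; apply: (etrans (pdCD c dD dW)); congr (_ + _).
    exact: (pdCB c (dpb b a) (dpb a b)).
  apply: (etrans (pdCB c (CdiffM (dA a) (db b)) (CdiffM (dA b) (db a)))).
  by congr (_ - _); [exact: (pdCM c (dA a) (db b)) | exact: (pdCM c (dA b) (db a))].
transitivity (pdC c (fun w => z w * (pdC a (A b) w - pdC b (A a) w)) y).
  by apply: (pdCE c oU Uy) => w Uw; exact: D_ab.
apply: (etrans (pdCM c dz dF)); congr (_ + z y * _).
exact: (pdCB c (dpA b a) (dpA a b)).
Qed.

(* Bianchi: the exterior covariant derivative of D = z F reads
   F /\ be = F /\ (dz + A z). *)
Lemma covariant_coef y a b c : U y ->
  dform A y a b * (pdC c z y + A c y * z y - be c y) +
  dform A y b c * (pdC a z y + A a y * z y - be a y) +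
  dform A y c a * (pdC b z y + A b y * z y - be b y) = 0.
Proof.
move=> Uy; rewrite ![dform A y _ _]mxE.
have e1 := pD_ab a b c Uy; have e2 := pD_ab b c a Uy; have e3 := pD_ab c a b Uy.
rewrite (pdC_comm a b oU (be2 c) Uy) (pdC_comm a b oU (A2 c) Uy) in e2.
rewrite (pdC_comm a c oU (be2 b) Uy) (pdC_comm a c oU (A2 b) Uy) in e2.
rewrite (pdC_comm b c oU (be2 a) Uy) (pdC_comm b c oU (A2 a) Uy) in e3.
exact: (cyclic_identity 0 0 0 e1 e2 e3 (D_ab a b Uy) (D_ab b c Uy) (D_ab c a Uy)).
Qed.

End CovariantCoefficient.

(** * The proportionality coefficient of two matrices *)

Section Coefficient.
Variable R : realType.
Local Notation E := 'rV[R]_4.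
Local Notation C := R[i].
Local Notation Re := (@complex.Re R).
Local Notation Im := (@complex.Im R).

(** Bilinear rather than Hermitian: for imaginary [F] it is minus the squared norm, hence zero only
    for [F = 0]. *)
Definition mx_sqr (F : 'M[C]_4) : C := \sum_a \sum_b F a b * F a b.

(* The z such that D = z F; mx_sqr F is real for F imaginary. *)
Definition mx_coef (D F : 'M[C]_4) : C :=
  (\sum_a \sum_b F a b * D a b) * ((Re (mx_sqr F))^-1)%:C.

Lemma mx_sqr_imag (F : 'M[C]_4) : (forall a b, (F a b)^*%C = - F a b) ->
  mx_sqr F = (Re (mx_sqr F))%:C /\ (F != 0 -> Re (mx_sqr F) != 0).
Proof.
move=> imF.
have Re0 a b : Re (F a b) = 0.
  have /(congr1 Re) := imF a b; rewrite Re_conj ReN => /eqP.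
  by rewrite -addr_eq0 -mulr2n mulrn_eq0 /= => /eqP.
split.
  apply: C_ext => //; rewrite ImC Im_sum big1 // => a _; rewrite Im_sum big1 // => b _.
  by rewrite ImM Re0 mul0r mulr0 addr0.
apply: contra_neq; rewrite Re_sum => h.
have : \sum_a \sum_b Im (F a b) ^+ 2 = 0.
  rewrite -[RHS]oppr0 -[in RHS]h -[RHS]sumrN; apply: eq_bigr => a _.
  rewrite Re_sum -[RHS]sumrN.
  by apply: eq_bigr => b _; rewrite ReM Re0 mul0r sub0r opprK expr2.
move=> /eqP; rewrite psumr_eq0 => [/allP h2|a _]; last first.
  by apply: sumr_ge0 => b _; exact: sqr_ge0.
apply/matrixP => a b; rewrite mxE; apply: C_ext; rewrite ?Re0 //=.
have := h2 a (mem_index_enum _); rewrite /= psumr_eq0 => [/allP h3|c _]; last exact: sqr_ge0.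
by have := h3 b (mem_index_enum _); rewrite /= sqrf_eq0 => /eqP.
Qed.

Lemma mx_coefP (D F : 'M[C]_4) (z : C) : (forall a b, (F a b)^*%C = - F a b) ->
  F != 0 -> D = z *: F -> mx_coef D F = z.
Proof.
move=> imF F0 ->; have [s1 /(_ F0) s2] := mx_sqr_imag imF.
rewrite /mx_coef.
have -> : \sum_a \sum_b F a b * (z *: F) a b = z * mx_sqr F.
  rewrite mulr_sumr; apply: eq_bigr => a _; rewrite mulr_sumr; apply: eq_bigr => b _.
  by rewrite mxE; ring.
rewrite s1 ReC -mulrA -rmorphM /= divff //.
by rewrite mulr1.
Qed.

(** The multiplier in the hypothesis on [beta] is given point by point, with no regularity; the
    explicit quotient is as regular as [D] and [F]. *)
Lemma mx_coef_CnC n (U : set E) (D F : E -> 'M[C]_4) : open U ->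
  (forall a b, CnC n U (fun y => F y a b)) -> (forall a b, CnC n U (fun y => D y a b)) ->
  (forall y a b, U y -> (F y a b)^*%C = - F y a b) -> (forall y, U y -> F y != 0) ->
  CnC n U (fun y => mx_coef (D y) (F y)).
Proof.
move=> oU cF cD imF F0; rewrite /mx_coef; apply: CnCM => //.
  by apply: CnC_sum => // a; apply: CnC_sum => // b; exact: CnCM.
apply: CnC_real; apply: CnV => // [y Uy|].
  by have [_] := mx_sqr_imag (fun a b => imF y a b Uy); apply; exact: F0.
have [] : CnC n U (fun y => mx_sqr (F y)); last by [].
by apply: CnC_sum => // a; apply: CnC_sum => // b; exact: CnCM.
Qed.

End Coefficient.

(** * The potential as a global section *)

Section ChartOverlap.
Variables (R : realType) (M : ptopologicalType) (I : Type) (X : oriented_atlas R M I).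
Local Notation E := 'rV[R]_4.
Local Notation C := R[i].
Local Notation dom := (chart_dom X).
Local Notation chart := (chart X).
Local Notation param := (param X).
Local Notation img := (img X).

Lemma img_chart i x : dom i x -> img i (chart i x).
Proof. by move=> dx; exists x. Qed.

Lemma paramP i y : img i y -> dom i (param i y) /\ chart i (param i y) = y.
Proof. by move=> [x dx <-]; rewrite chartK. Qed.

Lemma chart_cvg i x : dom i x -> chart i z @[z --> x] --> chart i x.
Proof.
move=> dx; have := @chart_continuous _ _ _ X i.
rewrite continuous_open_subspace; last exact: chart_dom_open.
by apply; rewrite inE.
Qed.

Lemma param_cvg i y : img i y -> param i z @[z --> y] --> param i y.
Proof.
move=> iy; have := @param_continuous _ _ _ X i.
rewrite continuous_open_subspace; last exact: img_open.
by apply; rewrite inE.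
Qed.

Definition overlap i j : set E := chart i @` (dom i `&` dom j).

Lemma overlap_img i j : overlap i j `<=` img i.
Proof. by move=> _ [x [dx _] <-]; exists x. Qed.

Lemma overlap_chart i j x : dom i x -> dom j x -> overlap i j (chart i x).
Proof. by move=> ix jx; exists x. Qed.

Lemma overlap_param i j y : overlap i j y ->
  [/\ dom i (param i y), dom j (param i y) & chart i (param i y) = y].
Proof. by move=> [x [ix jx] <-]; rewrite chartK. Qed.

Lemma overlap_open i j : open (overlap i j).
Proof.
rewrite openE => y oy; have [ix jx e] := overlap_param oy.
have iy := overlap_img oy.
have n1 : \forall z \near y, img i z.
  by apply: open_nbhs_nbhs; split => //; exact: img_open.
have n2 : \forall z \near y, dom j (param i z).
  by apply: (param_cvg iy); apply: open_nbhs_nbhs; split => //; exact: chart_dom_open.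
apply: filterS2 n1 n2 => z iz jz; have [dz ez] := paramP iz.
by exists (param i z).
Qed.

Definition transition i j (y : E) : E := chart j (param i y).

Lemma transition_chart i j x : dom i x -> transition i j (chart i x) = chart j x.
Proof. by move=> ix; rewrite /transition chartK. Qed.

Lemma transition_Cn n i j b : Cn n (overlap i j) (fun z => transition i j z 0 b).
Proof. exact: (transition_smooth X i j b). Qed.

Lemma transition_img i j y : overlap i j y -> img j (transition i j y).
Proof. by move=> oy; have [_ jx _] := overlap_param oy; exact: img_chart. Qed.

Lemma Jac_Jmx i j x : dom i x -> dom j x ->
  Jac X i j x = Jmx (transition i j) (chart i x).
Proof.
move=> ix jx; apply/matrixP => a b; rewrite [RHS]mxE /Jac jacobian_pd //.
apply: differentiable_rV => c.
exact: (Cn1_differentiable (@overlap_open i j) (@transition_Cn 1 i j c) (overlap_chart ix jx)).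
Qed.

End ChartOverlap.

(** * Curvature and covariant derivative on overlaps; the zero set in a chart *)

Section Bundle.
Variables (R : realType) (M : ptopologicalType) (I : Type) (X : oriented_atlas R M I).
Variables (S : hermitian_line_bundle X) (k : regularity) (sigma : unitary_connection S k).
Local Notation E := 'rV[R]_4.
Local Notation C := R[i].
Local Notation dom := (chart_dom X).
Local Notation chart := (chart X).
Local Notation param := (param X).
Local Notation img := (img X).
Hypothesis k_ge2 : at_least 2 k.

Definition conn_form i (a : 'I_4) (y : E) : C := sigma i y 0 a.

Definition tf_coord i j (y : E) : C := tf S i j (param i y).

Lemma conn_form_CnC n i a : at_least n k -> CnC n (img i) (conn_form i a).
Proof. by move=> nk; exact: (proj1 (CkC_CnC _ _ _) (conn_Ck sigma i a)). Qed.

Lemma conn_form_imag i a y : img i y -> (conn_form i a y)^*%C = - conn_form i a y.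
Proof. exact: conn_unitary. Qed.

Lemma at_least_leq m n : (m <= n)%N -> at_least n k -> at_least m k.
Proof. by case: (k) => // p mn /=; exact: leq_trans. Qed.

Lemma tf_coord_CnC n i j : CnC n (overlap X i j) (tf_coord i j).
Proof. exact: (proj1 (CkC_CnC _ _ _) (tf_smooth S i j)). Qed.

Lemma tf_coord_unit i j y : overlap X i j y -> tf_coord i j y * (tf_coord i j y)^*%C = 1.
Proof. by move=> oy; have [ix jx _] := overlap_param oy; exact: tf_unitary. Qed.

Lemma curvatureE i y : curvature sigma i y = dform (conn_form i) y.
Proof. by []. Qed.

Lemma curvature_CnC n i a b : at_least n.+1 k ->
  CnC n (img i) (fun y => curvature sigma i y a b).
Proof.
move=> nk; apply: CnC_ext (CnCB _ (CnC_pd a (conn_form_CnC i b nk))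
  (CnC_pd b (conn_form_CnC i a nk))); try exact: img_open.
by move=> y _; rewrite mxE.
Qed.

Lemma conn_form_change i j y a : overlap X i j y ->
  conn_form i a y = pull (transition X i j) (conn_form j) a y - gauge (tf_coord i j) a y.
Proof.
move=> oy; have [ix jx e] := overlap_param oy.
have := conn_change sigma a ix jx; rewrite e => h.
rewrite /conn_form h; congr (_ - _).
  rewrite (Jac_Jmx ix jx) e mxE; apply: eq_bigr => b _.
  by rewrite !mxE mulrC.
rewrite /gauge; congr (_ * _).
have u0 := tf_unitary S ix jx.
have un : tf S i j (param i y) != 0.
  by apply: contra_eq_neq u0 => ->; rewrite mul0r eq_sym oner_eq0.
by apply: (mulfI un); rewrite mulfV.
Qed.

Lemma curvature_change i j x : dom i x -> dom j x ->
  curvature sigma i (chart i x) =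
  RtoC_mx (Jac X i j x) *m curvature sigma j (chart j x) *m (RtoC_mx (Jac X i j x))^T.
Proof.
move=> ix jx; rewrite (Jac_Jmx ix jx) -(transition_chart j ix) !curvatureE.
have k1 := at_least_leq (isT : (1 <= 2)%N) k_ge2.
exact: (dform_gauge_change (@overlap_open _ _ _ X i j) (@img_open _ _ _ X j)
  (@transition_Cn _ _ _ X 2 i j) (@transition_img _ _ _ X i j) (@tf_coord_CnC 2 i j)
  (@tf_coord_unit i j) (fun b => conn_form_CnC j b k1) (overlap_chart ix jx)
  (fun z a => @conn_form_change i j z a)).
Qed.

Lemma curvature_eq0 i j x : dom i x -> dom j x ->
  curvature sigma j (chart j x) = 0 -> curvature sigma i (chart i x) = 0.
Proof. by move=> ix jx h; rewrite (curvature_change ix jx) h mulmx0 mul0mx. Qed.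

Definition zero_coord i : set E := chart i @` (vanishing_locus sigma `&` dom i).

(** [vanishing_locus] quantifies over all charts at a point; by the transformation law of the
    curvature one chart decides. *)
Lemma zero_coordP i y : img i y -> zero_coord i y <-> curvature sigma i y = 0.
Proof.
move=> iy; have [dy ey] := paramP iy; split=> [[x [Zx dx] <-]|F0]; first exact: Zx.
exists (param i y) => //; split=> // j jx.
by apply: curvature_eq0 jx dy _; rewrite ey.
Qed.

Lemma zero_coord_thin i :
  (manifold_hausdorff_dim X (vanishing_locus sigma) <= 2%:E)%E -> thin (zero_coord i).
Proof.
move=> H; apply: thin_of_dim; apply: le_trans H; apply: ereal_sup_ubound.
by exists i.
Qed.

Lemma curvature_imag i y a b : img i y ->
  (curvature sigma i y a b)^*%C = - curvature sigma i y a b.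
Proof.
move=> iy; have k1 := at_least_leq (isT : (1 <= 2)%N) k_ge2.
have dc c := CnC_Cdiff (@img_open _ _ _ X i) (conn_form_CnC i c k1) iy.
have pdc c d : (pdC c (conn_form i d) y)^*%C = - pdC c (conn_form i d) y.
  rewrite -pdC_conj // -pdCN //.
  by apply: (pdCE c (@img_open _ _ _ X i) iy) => z iz; exact: conn_form_imag.
have cB (x z : C) : (x - z)^*%C = x^*%C - z^*%C by exact: rmorphB.
by rewrite curvatureE mxE cB !pdc opprB opprK addrC.
Qed.

(** [Re (mx_sqr F)] is continuous and vanishes exactly with [F]; where it varies by at most half of
    its absolute value at [y], it cannot reach 0. *)
Lemma curvature_open i : open (img i `&` ~` zero_coord i).
Proof.
rewrite openE => y [iy nZ].
have k1 := at_least_leq (isT : (1 <= 2)%N) k_ge2.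
pose N z := complex.Re (mx_sqr (curvature sigma i z)).
have cN : {for y, continuous N}.
  have [c1 _] : CnC 0 (img i) (fun z => mx_sqr (curvature sigma i z)).
    apply: CnC_sum; first exact: img_open.
    move=> a; apply: CnC_sum; first exact: img_open.
    by move=> b; apply: CnCM; [exact: img_open|exact: curvature_CnC|exact: curvature_CnC].
  exact: Cn_continuous c1 iy.
have N0 : N y != 0.
  have [_] := mx_sqr_imag (fun a b => curvature_imag a b iy); apply.
  by apply/eqP => F0; apply: nZ; apply/zero_coordP.
have N02 : 0 < `|N y| / 2 by rewrite divr_gt0 // normr_gt0.
have [d d0 hd] := continuous_normP cN N02.
have n1 : \forall z \near y, img i z.
  by apply: open_nbhs_nbhs; split => //; exact: img_open.
have n2 : \forall z \near y, `|z - y| < d.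
  by apply/nbhs_ballP; exists d => // z; rewrite -ball_normE /= distrC.
apply: filterS2 n1 n2 => z iz zd; split=> // /(zero_coordP iz) F0.
have := hd z zd; rewrite /N F0.
have -> : mx_sqr (0 : 'M[C]_4) = 0.
  by rewrite /mx_sqr big1 // => a _; rewrite big1 // => b _; rewrite mxE mul0r.
have := N02; rewrite /= sub0r normrN -/(N y); lra.
Qed.

Variable beta : form1 S k.

Definition beta_form i (a : 'I_4) (y : E) : C := beta i y 0 a.

Lemma beta_form_CnC n i a : at_least n k -> CnC n (img i) (beta_form i a).
Proof. by move=> nk; exact: (proj1 (CkC_CnC _ _ _) (form1_Ck beta i a)). Qed.

Lemma dsigma1E i y : dsigma1 sigma beta i y =
  dform (beta_form i) y + wedge (conn_form i) (beta_form i) y.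
Proof. by apply/matrixP => a b; rewrite !mxE. Qed.

Lemma beta_form_change i j y a : overlap X i j y ->
  beta_form i a y = tf_coord i j y * pull (transition X i j) (beta_form j) a y.
Proof.
move=> oy; have [ix jx e] := overlap_param oy.
have := form1_change beta ix jx; rewrite e => h.
rewrite /beta_form h mxE; congr (_ * _).
rewrite (Jac_Jmx ix jx) e mxE; apply: eq_bigr => b _.
by rewrite !mxE mulrC.
Qed.

Lemma dsigma1_change i j x : dom i x -> dom j x ->
  dsigma1 sigma beta i (chart i x) =
  tf S i j x *: (RtoC_mx (Jac X i j x) *m dsigma1 sigma beta j (chart j x) *m
    (RtoC_mx (Jac X i j x))^T).
Proof.
move=> ix jx; rewrite (Jac_Jmx ix jx) -(transition_chart j ix) !dsigma1E.
have k1 := at_least_leq (isT : (1 <= 2)%N) k_ge2.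
have -> : tf S i j x = tf_coord i j (chart i x) by rewrite /tf_coord chartK.
exact: (dsigma_gauge_change (@overlap_open _ _ _ X i j) (@img_open _ _ _ X j)
  (@transition_Cn _ _ _ X 2 i j) (@transition_img _ _ _ X i j) (@tf_coord_CnC 2 i j)
  (@tf_coord_unit i j) (fun b => conn_form_CnC j b k1) (fun b => beta_form_CnC j b k1)
  (overlap_chart ix jx)
  (fun z a => @conn_form_change i j z a) (fun z a => @beta_form_change i j z a)).
Qed.

End Bundle.

(** * Construction of the global section [zeta] *)

Section Potential.
Variables (R : realType) (M : ptopologicalType) (I : Type) (X : oriented_atlas R M I).
Variables (S : hermitian_line_bundle X) (r k : regularity).
Variables (g : riemannian_metric X r) (sigma : unitary_connection S k) (beta : form1 S k).
Local Notation E := 'rV[R]_4.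
Local Notation C := R[i].
Local Notation dom := (chart_dom X).
Local Notation chart := (chart X).
Local Notation param := (param X).
Local Notation img := (img X).
Local Notation Z := (zero_coord sigma).
Hypothesis k_ge2 : at_least 2 k.
Hypothesis sigma_ASD : anti_selfdual g sigma.
Hypothesis Z_dim : (manifold_hausdorff_dim X (vanishing_locus sigma) <= 2%:E)%E.
Hypothesis beta_multiple : forall i x, dom i x ->
  curvature sigma i (chart i x) != 0 ->
  exists zeta : R[i], dsigma1 sigma beta i (chart i x) =
    zeta *: curvature sigma i (chart i x).

Let k_ge0 : at_least 0 k := at_least_leq (isT : (0 <= 2)%N) k_ge2.

Definition potential_off i (y : E) : C :=
  mx_coef (dsigma1 sigma beta i y) (curvature sigma i y).

Let oU i : open (img i) := @img_open _ _ _ X i.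
Let oUZ i : open (img i `&` ~` Z i).
Proof. exact: curvature_open. Qed.

Let F_imag i y a b : img i y ->
  (curvature sigma i y a b)^*%C = - curvature sigma i y a b.
Proof. exact: curvature_imag. Qed.

Let A_imag i a y : img i y -> (conn_form sigma i a y)^*%C = - conn_form sigma i a y.
Proof. exact: conn_form_imag. Qed.

Let A_CnC n i a : at_least n k -> CnC n (img i) (conn_form sigma i a).
Proof. exact: conn_form_CnC. Qed.

Let b_CnC n i a : at_least n k -> CnC n (img i) (beta_form beta i a).
Proof. exact: beta_form_CnC. Qed.

Let Z_spec i y : img i y -> Z i y <-> curvature sigma i y = 0.
Proof. exact: zero_coordP. Qed.

Let Z_thin i : thin (Z i).
Proof. exact: zero_coord_thin. Qed.

Let curvature_neq0 i y : img i y -> ~ Z i y -> curvature sigma i y != 0.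
Proof. by move=> iy nZ; apply/eqP => F0; apply: nZ; apply/zero_coordP. Qed.

Lemma potential_off_spec i y : img i y -> ~ Z i y ->
  dsigma1 sigma beta i y = potential_off i y *: curvature sigma i y.
Proof.
move=> iy nZ; have F0 := curvature_neq0 iy nZ; have [dy ey] := paramP iy.
have F0' : curvature sigma i (chart i (param i y)) != 0 by rewrite ey.
have [z] := beta_multiple dy F0'; rewrite ey => e.
by rewrite /potential_off (mx_coefP (fun a b => F_imag a b iy) F0 e).
Qed.

Let imag_curvature i y : img i y ->
  curvature sigma i y =
  map_mx (fun t : R => (0 +i* t)%C) (map_mx (@complex.Im R) (curvature sigma i y)).
Proof.
move=> iy; apply/matrixP => a b; rewrite [RHS]mxE [in RHS]mxE.
have /(congr1 (@complex.Re R)) := F_imag a b iy.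
rewrite Re_conj ReN => h; apply: C_ext => //=; move: h.
by move: (complex.Re _) => u; lra.
Qed.

(** One derivative of [sigma] and [beta] is spent, so class 2 leaves class 1, enough to
    differentiate the multiplier. Higher regularity comes later from the bootstrap in [extendC_CnC],
    without loss. *)
Lemma potential_off_CnC i : CnC 1 (img i `&` ~` Z i) (potential_off i).
Proof.
have sub : img i `&` ~` Z i `<=` img i by move=> y [].
apply: mx_coef_CnC.
- exact: oUZ.
- by move=> a b; apply: CnC_subset sub _; exact: curvature_CnC.
- move=> a b; apply: CnC_subset sub _.
  have cb c := b_CnC i c k_ge2; have cA c := A_CnC i c k_ge2.
  have cw : CnC 1 (img i) (fun y => conn_form sigma i a y * beta_form beta i b y -
      conn_form sigma i b y * beta_form beta i a y).
    have m c d := CnCM (@oU i) (CnCS (cA c)) (CnCS (cb d)).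
    exact: (CnCB (@oU i) (m a b) (m b a)).
  have cD := CnCD (@oU i) (CnCB (@oU i) (CnC_pd a (cb b)) (CnC_pd b (cb a))) cw.
  have e y : img i y -> pdC a (beta_form beta i b) y - pdC b (beta_form beta i a) y +
      (conn_form sigma i a y * beta_form beta i b y -
       conn_form sigma i b y * beta_form beta i a y) = dsigma1 sigma beta i y a b.
    by rewrite [RHS]mxE.
  exact: (CnC_ext (@oU i) e cD).
- by move=> y a b [iy _]; exact: F_imag.
- by move=> y [iy nZ]; exact: curvature_neq0.
Qed.

Lemma potential_off_par i y : img i y -> ~ Z i y ->
  Cdiff (potential_off i) y /\ forall a,
    pdC a (potential_off i) y = beta_form beta i a y - conn_form sigma i a y * potential_off i y.
Proof.
move=> iy nZ; have Uy : (img i `&` ~` Z i) y by split.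
split; first exact: (CnC_Cdiff (@oUZ i) (potential_off_CnC i) Uy).
have sub : img i `&` ~` Z i `<=` img i by move=> z [].
have D_eq z : (img i `&` ~` Z i) z ->
   dform (beta_form beta i) z + wedge (conn_form sigma i) (beta_form beta i) z =
   potential_off i z *: dform (conn_form sigma i) z.
  by move=> [iz nZz]; rewrite -dsigma1E; exact: potential_off_spec.
have cyc := covariant_coef (@oUZ i)
  (fun a => CnC_subset sub (A_CnC i a k_ge2))
  (fun a => CnC_subset sub (b_CnC i a k_ge2)) (potential_off_CnC i) D_eq.
have [dy ey] := paramP iy.
(* The curvature is [i A] with [A] real; positivity of the metric applies to the rows of this real
   matrix. *)
pose A := map_mx (@complex.Im R) (curvature sigma i y).
have FE : curvature sigma i y = map_mx (fun t : R => (0 +i* t)%C) A := imag_curvature iy.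
have skewA : A^T = - A.
  apply/matrixP => a b; rewrite ![in LHS]mxE ![in RHS]mxE -ImN; congr (complex.Im _).
  by rewrite opprB.
have asd := sigma_ASD dy; rewrite ey FE in asd.
have A0 : A != 0.
  apply: contra_neq (curvature_neq0 iy nZ) => A0; rewrite FE A0.
  by apply/matrixP => a b; rewrite !mxE.
pose al a := pdC a (potential_off i) y + conn_form sigma i a y * potential_off i y
  - beta_form beta i a y.
suff al0 a : al a = 0.
  move=> a; have := al0 a; rewrite /al => /eqP.
  by rewrite subr_eq0 => /eqP <-; rewrite addrK.
have winj := asd_wedge_inj (Defs.metric_sym g iy) skewA
  (fun v => @Defs.metric_pos _ _ _ _ _ g i y v iy) asd A0 (al := al).
apply: winj.
have FA c d : dform (conn_form sigma i) y c d = (0 +i* 1)%C * (A c d)%:C.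
  rewrite -curvatureE FE mxE; apply: C_ext; rewrite ?ReM ?ImM /=; ring.
move=> a1 b1 c1.
have h : dform (conn_form sigma i) y a1 b1 * al c1 + dform (conn_form sigma i) y b1 c1 * al a1
   + dform (conn_form sigma i) y c1 a1 * al b1 = 0 := cyc y a1 b1 c1 Uy.
rewrite !FA in h; move: h; move: (al a1) (al b1) (al c1) => x1 x2 x3 h.
have i0 : (0 +i* 1)%C != 0 :> C by rewrite eq_complex /= oner_eq0 andbF.
by apply: (mulfI i0); rewrite mulr0 -h; ring.
Qed.

Definition potential i : E -> C := extendC (Z i) (potential_off i).

Lemma potential_id i y : img i y -> ~ Z i y -> potential i y = potential_off i y.
Proof.
move=> iy nZ.
exact: (extendC_id (@oU i) (@Z_thin i)
  (fun a => A_CnC i a k_ge0) (fun a => b_CnC i a k_ge0)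
  (@A_imag i)
  (@potential_off_par i) iy nZ).
Qed.

Lemma potential_par i y : img i y -> Cdiff (potential i) y /\ forall a,
    pdC a (potential i) y = beta_form beta i a y - conn_form sigma i a y * potential i y.
Proof.
move=> iy.
exact: (extendC_par (@oU i) (@Z_thin i) (@oUZ i)
  (fun a => A_CnC i a k_ge0) (fun a => b_CnC i a k_ge0)
  (@A_imag i)
  (@potential_off_par i) iy).
Qed.

Lemma potential_Ck i : CkC k (img i) (potential i).
Proof.
apply/CkC_CnC => n nk.
exact: (extendC_CnC (@oU i) (@Z_thin i) (@oUZ i)
  (fun a => A_CnC i a k_ge0) (fun a => b_CnC i a k_ge0)
  (@A_imag i)
  (@potential_off_par i)
  (fun a => A_CnC i a nk) (fun a => b_CnC i a nk)).
Qed.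

Lemma Cdiff_eq0_thin (V W : set E) (f : E -> C) y : open V -> thin W ->
  (forall z, V z -> Cdiff f z) -> (forall z, V z -> ~ W z -> f z = 0) -> V y -> f y = 0.
Proof.
move=> oV tW df f0 Vy.
have key (h : E -> R) : differentiable h y -> (forall z, V z -> ~ W z -> h z = 0) -> h y = 0.
  move=> /differentiable_continuous/continuous_normP ch h0.
  apply/eqP; rewrite -normr_le0; apply/ler_addgt0Pl => eps e0; rewrite addr0.
  have [d d0 hd] := ch _ e0.
  have : \forall z \near y, V z by apply: open_nbhs_nbhs.
  move=> /nbhs_ballP[d' /= d'0 bd'].
  have dd : 0 < Num.min d d' by rewrite lt_min d0.
  have [z zd nW] := thin_dense tW y dd.
  move: zd; rewrite lt_min => /andP[zd zd'].
  have Vz : V z by apply: bd'; rewrite -ball_normE /= distrC.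
  by have := hd z zd; rewrite (h0 z Vz nW) sub0r normrN.
have [d1 d2] := df y Vy.
by apply: C_ext; [apply: (key _ d1)|apply: (key _ d2)] => z Vz nW /=; rewrite f0.
Qed.

(** The extension is made chart by chart, so gluing has to be checked. Off the zero set,
    [d_sigma beta] and [F] undergo the same pull-back and only the former acquires the factor [tf],
    so the multipliers differ by it; continuity and density give the rest. *)
Lemma potential_change i j x : dom i x -> dom j x ->
  potential i (chart i x) = tf S i j x * potential j (chart j x).
Proof.
move=> ix jx.
pose u := tf_coord S i j; pose phi := transition X i j.
have dphi y : overlap X i j y -> differentiable phi y.
  move=> oy; apply: differentiable_rV => c.
  exact: (Cn1_differentiable (@overlap_open _ _ _ X i j) (@transition_Cn _ _ _ X 1 i j c) oy).
have du y : overlap X i j y -> Cdiff u y.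
  move=> oy.
  exact: (CnC_Cdiff (@overlap_open _ _ _ X i j) (@tf_coord_CnC _ _ _ _ S 1 i j) oy).
suff : potential i (chart i x) - u (chart i x) * (potential j \o phi) (chart i x) = 0.
  move=> /eqP; rewrite subr_eq0 => /eqP ->.
  by rewrite /= /phi transition_chart // /u /tf_coord chartK.
apply: (@Cdiff_eq0_thin (overlap X i j) (Z i)
  (fun y => potential i y - u y * (potential j \o phi) y)).
- exact: overlap_open.
- exact: Z_thin.
- move=> y oy; apply: CdiffD; first by have [] := potential_par (overlap_img oy).
  apply: CdiffN; apply: CdiffM; first exact: du.
  apply: Cdiff_comp; first exact: dphi.
  by have [] := potential_par (transition_img oy).
- move=> y oy nZ; have iy := overlap_img oy; have [ip jp e] := overlap_param oy.
  have jy := transition_img oy.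
  have nZj : ~ Z j (phi y).
    move=> /(Z_spec jy); rewrite /phi /transition => F0; apply: nZ.
    by apply/(Z_spec iy); rewrite -e; exact: curvature_eq0 ip jp F0.
  rewrite /= !potential_id //.
  have := dsigma1_change sigma k_ge2 beta ip jp.
  rewrite e (potential_off_spec jy nZj) -scalemxAr -scalemxAl scalerA.
  rewrite -(curvature_change sigma k_ge2 ip jp) e => h.
  apply/eqP; rewrite subr_eq0; apply/eqP.
  exact: (mx_coefP (fun a b => F_imag a b iy) (curvature_neq0 iy nZ) h).
- exact: overlap_chart.
Qed.

Definition potential_form : form0 S k := Form0 potential_Ck potential_change.

Lemma dsigma0_potential i y : img i y -> dsigma0 sigma potential_form i y = beta i y.
Proof.
move=> iy; apply/rowP => a; rewrite mxE /=.
by have [_ ->] := potential_par iy; rewrite subrK.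
Qed.

Lemma metric_det_gt0 i y : img i y -> ~ Z i y -> 0 < \det (g i y).
Proof.
move=> iy nZ; have [dy ey] := paramP iy.
pose A := map_mx (@complex.Im R) (curvature sigma i y).
have FE : curvature sigma i y = map_mx (fun t : R => (0 +i* t)%C) A := imag_curvature iy.
have skewA : A^T = - A.
  apply/matrixP => a b; rewrite ![in LHS]mxE ![in RHS]mxE -ImN; congr (complex.Im _).
  by rewrite opprB.
have asd := sigma_ASD dy; rewrite ey FE in asd.
apply: (asd_det_gt0 (Defs.metric_sym g iy) skewA asd).
apply: contra_neq (curvature_neq0 iy nZ) => A0; rewrite FE A0.
by apply/matrixP => a b; rewrite !mxE.
Qed.

End Potential.

(** * Integration of |beta|^2 *)

Section MatrixContinuity.
Variables (R : realType) (T : topologicalType).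

Lemma continuous_det n (F : T -> 'M[R]_n) x :
  (forall a b, {for x, continuous (fun y => F y a b)}) ->
  {for x, continuous (fun y => \det (F y))}.
Proof.
move=> cF; rewrite /determinant.
apply: (@continuous_sumR R T _ _ _ (fun (s : 'S_n) y => (-1) ^+ s * \prod_i F y i (s i))) => s _.
apply: continuousM; first exact: cst_continuous.
by apply: (@continuous_prodR R T _ _ _ (fun i y => F y i (s i))) => i _; exact: cF.
Qed.

(** Cramer's rule. As [invmx] is defined by cases, invertibility is required in a whole
    neighbourhood. *)
Lemma continuous_invmx n (F : T -> 'M[R]_n) x : (\near x, F x \in unitmx) ->
  (forall a b, {for x, continuous (fun y => F y a b)}) ->
  forall a b, {for x, continuous (fun y => invmx (F y) a b)}.
Proof.
move=> uF cF a b.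
pose h y := (\det (F y))^-1 * cofactor (F y) b a.
have hF : {near x, h =1 (fun y => invmx (F y) a b)}.
  by apply: filterS uF => y uy; rewrite /h /invmx uy !mxE.
have ch : {for x, continuous h}.
  apply: continuousM.
    apply: continuousV; last exact: continuous_det.
    by rewrite -unitfE -unitmxE; exact: nbhs_singleton uF.
  apply: continuousM; first exact: cst_continuous.
  apply: continuous_det => c d.
  rewrite (_ : (fun y => _) = (fun y => F y (lift b c) (lift a d))); first exact: cF.
  by apply/funext => y; rewrite !mxE.
rewrite /prop_for /continuous_at -(nbhs_singleton hF).
exact: cvg_trans (near_eq_cvg hF) ch.
Qed.

End MatrixContinuity.

Lemma RtoC_mxM (R : realType) m n p (A : 'M[R]_(m, n)) (B : 'M[R]_(n, p)) :
  RtoC_mx (A *m B) = RtoC_mx A *m RtoC_mx B.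
Proof. exact: map_mxM. Qed.

Lemma RtoC_mxT (R : realType) m n (A : 'M[R]_(m, n)) : RtoC_mx A^T = (RtoC_mx A)^T.
Proof. by apply/matrixP => a b; rewrite !mxE. Qed.

(** * The pointwise norm of [beta] *)

Section Norm.
Variables (R : realType) (M : ptopologicalType) (I : Type) (X : oriented_atlas R M I).
Variables (S : hermitian_line_bundle X) (r k : regularity).
Variables (g : riemannian_metric X r) (beta : form1 S k).
Local Notation E := 'rV[R]_4.
Local Notation C := R[i].
Local Notation dom := (chart_dom X).
Local Notation chart := (chart X).
Local Notation img := (img X).

Definition norm_coord i (y : E) : R :=
  complex.Re ((beta i y *m RtoC_mx (invmx (g i y)) *m (map_mx (@conjc R) (beta i y))^T) 0 0).

Definition norm_form (x : M) : R := complex.Re (herm1 g beta beta x).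

Lemma norm_coordE i y : norm_coord i y = \sum_a \sum_b invmx (g i y) a b *
  (complex.Re (beta i y 0 a) * complex.Re (beta i y 0 b) +
   complex.Im (beta i y 0 a) * complex.Im (beta i y 0 b)).
Proof.
rewrite /norm_coord mxE Re_sum exchange_big /=; apply: eq_bigr => b _.
rewrite mxE mulr_suml Re_sum; apply: eq_bigr => a _.
rewrite !mxE !ReM ImM ReC ImC Re_conj Im_conj.
by move: (complex.Re _) (complex.Re _) (complex.Im _) (complex.Im _) (invmx _ _ _) => *; ring.
Qed.

(** Splits the Hermitian square into two real quadratic forms, to which positive definiteness of the
    real inverse metric applies. *)
Lemma norm_coord_re_im i y : norm_coord i y =
  (map_mx (@complex.Re R) (beta i y) *m invmx (g i y) *m
     (map_mx (@complex.Re R) (beta i y))^T) 0 0 +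
  (map_mx (@complex.Im R) (beta i y) *m invmx (g i y) *m
     (map_mx (@complex.Im R) (beta i y))^T) 0 0.
Proof.
rewrite norm_coordE !mxE -big_split /= exchange_big; apply: eq_bigr => b _ /=.
rewrite !mxE !mulr_suml -big_split; apply: eq_bigr => a _ /=; rewrite !mxE.
by move: (complex.Re _) (complex.Re _) (complex.Im _) (complex.Im _) (invmx _ _ _) => *; ring.
Qed.

Lemma norm_coord_ge0 i y : img i y -> 0 <= norm_coord i y.
Proof.
move=> iy; have pos := posdef_inv (Defs.metric_sym g iy)
  (fun v => @Defs.metric_pos _ _ _ _ _ g i y v iy).
have H (v : E) : 0 <= (v *m invmx (g i y) *m v^T) 0 0.
  by have [->|/pos/ltW //] := eqVneq v 0; rewrite !mul0mx mxE.
by rewrite norm_coord_re_im addr_ge0.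
Qed.

Lemma norm_coord_eq0 i y : img i y -> norm_coord i y = 0 -> beta i y = 0.
Proof.
move=> iy; have pos := posdef_inv (Defs.metric_sym g iy)
  (fun v => @Defs.metric_pos _ _ _ _ _ g i y v iy).
have H (v : E) : 0 <= (v *m invmx (g i y) *m v^T) 0 0.
  by have [->|/pos/ltW //] := eqVneq v 0; rewrite !mul0mx mxE.
have H0 (v : E) : (v *m invmx (g i y) *m v^T) 0 0 = 0 -> v = 0.
  by move=> h; apply/eqP; apply: contraT => /pos; rewrite h ltxx.
rewrite norm_coord_re_im => /eqP; rewrite paddr_eq0 //.
move=> /andP[/eqP/H0 /matrixP h1 /eqP/H0 /matrixP h2].
apply/rowP => a; rewrite mxE; apply: C_ext.
  by have := h1 0 a; rewrite !mxE.
by have := h2 0 a; rewrite !mxE.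
Qed.

(** The unit factor [u] drops out against its conjugate, and inverting [Gi = J Gj J^T] gives
    [J^T Gi^-1 J = Gj^-1]. Hence [norm_form], computed in the selected charts, can be read in any
    chart. *)
Lemma norm_coord_change i j x : dom i x -> dom j x ->
  norm_coord i (chart i x) = norm_coord j (chart j x).
Proof.
move=> ix jx; rewrite /norm_coord; congr (complex.Re _).
have := metric_change g ix jx; have := form1_change beta ix jx.
set J := Jac X i j x; set Gi := g i _; set Gj := g j _; set u := tf S i j x.
set bi := beta i _; set bj := beta j _ => hb hG.
have uGi : Gi \in unitmx.
  apply: posdef_unitmx => v v0.
  exact: (@Defs.metric_pos _ _ _ _ _ g i _ v (img_chart ix) v0).
have uGj : Gj \in unitmx.
  apply: posdef_unitmx => v v0.
  exact: (@Defs.metric_pos _ _ _ _ _ g j _ v (img_chart jx) v0).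
have uJ : J \in unitmx by move: uGi; rewrite hG !unitmx_mul => /andP[/andP[]].
have eG : J^T *m invmx Gi *m J = invmx Gj.
  have uJT : J^T \in unitmx by rewrite unitmx_tr.
  apply: (can_inj (mulmxK uGj)); rewrite mulVmx //.
  apply: (can_inj (mulmxK uJT)); rewrite mul1mx.
  by rewrite -!mulmxA [J *m (Gj *m _)]mulmxA -hG mulVmx // mulmx1.
have conjJ : map_mx (@conjc R) (RtoC_mx J) = RtoC_mx J.
  by apply/matrixP => a b; rewrite !mxE; apply: C_ext; rewrite ?Re_conj ?Im_conj //= oppr0.
have -> : map_mx (@conjc R) bi = u^*%C *: (map_mx (@conjc R) bj *m (RtoC_mx J)^T).
  by rewrite hb map_mxZ map_mxM -map_trmx conjJ.
rewrite hb !linearZ /= -!scalemxAl trmx_mul trmxK scalerA.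
have uu : u^*%C * u = 1 by rewrite mulrC; exact: tf_unitary.
rewrite uu scale1r.
by rewrite -eG !RtoC_mxM RtoC_mxT !mulmxA.
Qed.

Lemma norm_formE i x : dom i x -> norm_form x = norm_coord i (chart i x).
Proof. by move=> ix; apply: norm_coord_change => //; exact: mem_chart_at. Qed.

Lemma metric_continuous i a b y : img i y -> {for y, continuous (fun z => g i z a b)}.
Proof.
move=> iy; have H : Cn 0 (img i) (fun z => g i z a b).
  by apply: (metric_Ck g i a b); case: (r).
exact: Cn_continuous H iy.
Qed.

Lemma norm_coord_continuous i y : img i y -> {for y, continuous (norm_coord i)}.
Proof.
move=> iy.
have cb a : CnC 0 (img i) (fun z => beta i z 0 a).
  by apply: (proj1 (CkC_CnC _ _ _) (form1_Ck beta i a)); case: (k).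
have -> : norm_coord i = (fun z => \sum_a \sum_b invmx (g i z) a b *
  (complex.Re (beta i z 0 a) * complex.Re (beta i z 0 b) +
   complex.Im (beta i z 0 a) * complex.Im (beta i z 0 b))).
  by apply/funext => z; exact: norm_coordE.
apply: (@continuous_sumR R _ _ _ _ (fun a z => \sum_b invmx (g i z) a b *
  (complex.Re (beta i z 0 a) * complex.Re (beta i z 0 b) +
   complex.Im (beta i z 0 a) * complex.Im (beta i z 0 b)))) => a _.
apply: (@continuous_sumR R _ _ _ _ (fun b z => invmx (g i z) a b *
  (complex.Re (beta i z 0 a) * complex.Re (beta i z 0 b) +
   complex.Im (beta i z 0 a) * complex.Im (beta i z 0 b)))) => b _.
apply: continuousM.
  apply: continuous_invmx => [|c d]; last exact: metric_continuous.
  have : \forall z \near y, img i z.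
    by apply: open_nbhs_nbhs; split => //; exact: img_open.
  apply: filterS => z iz; apply: posdef_unitmx => v v0.
  exact: (@Defs.metric_pos _ _ _ _ _ g i _ v iz v0).
have [[a1 _] [a2 _]] := cb a; have [[b1 _] [b2 _]] := cb b.
apply: continuousD; apply: continuousM.
- exact: a1.
- exact: b1.
- exact: a2.
- exact: b2.
Qed.

Lemma sqrt_det_continuous i y : img i y ->
  {for y, continuous (fun z => Num.sqrt (\det (g i z)))}.
Proof.
move=> iy; apply: continuous_comp; last exact: sqrt_continuous.
by apply: continuous_det => a b; exact: metric_continuous.
Qed.

End Norm.

(** * Volume of coordinate balls and integrals of continuous functions *)

Section Volume.
Variables (R : realType) (M : ptopologicalType) (I : Type) (X : oriented_atlas R M I).
Variables (r : regularity) (g : riemannian_metric X r).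
Variable vol : {measure set (borel_type M) -> \bar R}.
Hypothesis volP : is_riemannian_measure g vol.
Local Notation E := 'rV[R]_4.
Local Notation dom := (chart_dom X).
Local Notation chart := (chart X).
Local Notation img := (img X).

Definition coord_ball i (y : E) (eps : R) : set M := dom i `&` chart i @^-1` ball y eps.

Lemma coord_ball_open i y eps : 0 < eps -> open (coord_ball i y eps).
Proof.
move=> e0; rewrite openE => x [dx bx].
have n1 : \forall z \near x, dom i z.
  by apply: open_nbhs_nbhs; split => //; exact: chart_dom_open.
have n2 : \forall z \near x, ball y eps (chart i z).
  apply: (chart_cvg dx); apply: open_nbhs_nbhs; split => //.
  exact: ball_open.
exact: filterS2 n1 n2.
Qed.

Lemma open_measurable_borel (B : set M) : open B -> measurable (B : set (borel_type M)).
Proof. by move=> oB; exact: sub_sigma_algebra. Qed.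

Lemma vol_coord_ball i y eps : 0 < eps -> ball y eps `<=` img i ->
  vol (coord_ball i y eps) =
  (\int[@lebesgue4m R]_(t in cube false y eps) (Num.sqrt (\det (g i (row4 t))))%:E)%E.
Proof.
move=> e0 sub; have mB := open_measurable_borel (coord_ball_open i y e0).
rewrite (volP mB (i := i)); last by move=> x [].
have -> : chart i @` coord_ball i y eps = ball y eps.
  apply/seteqP; split=> [_ [x [dx bx] <-]//|z bz].
  have [dz ez] := paramP (sub _ bz).
  by exists (param X i z) => //; split=> //; rewrite /preimage /= ez.
by rewrite row4_ball.
Qed.

Lemma vol_coord_ball_le i y eps K : 0 < eps -> ball y eps `<=` img i ->
  (forall z, ball y eps z -> Num.sqrt (\det (g i z)) <= K) ->
  (vol (coord_ball i y eps) <= (K * (2 * eps) ^+ 4)%:E)%E.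
Proof.
move=> e0 sub H; rewrite vol_coord_ball // EFinM -(lebesgue4_cube false y e0).
apply: (@le_trans _ _ (\int[@lebesgue4m R]_(t in cube false y eps) (cst K%:E t))%E).
  apply: ge0_le_integral_nomeas => t ct; first by rewrite lee_fin sqrtr_ge0.
  rewrite lee_fin; apply: H.
  by have : (@row4 R @^-1` ball y eps) t by rewrite row4_ball.
by rewrite integral_cst //; exact: measurable_cube.
Qed.

Lemma vol_coord_ball_ge i y eps c : 0 < eps -> 0 <= c -> ball y eps `<=` img i ->
  (forall z, ball y eps z -> c <= Num.sqrt (\det (g i z))) ->
  ((c * (2 * eps) ^+ 4)%:E <= vol (coord_ball i y eps))%E.
Proof.
move=> e0 c0 sub H; rewrite vol_coord_ball // EFinM -(lebesgue4_cube false y e0).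
apply: (@le_trans _ _ (\int[@lebesgue4m R]_(t in cube false y eps) (cst c%:E t))%E).
  by rewrite integral_cst //; exact: measurable_cube.
apply: ge0_le_integral_nomeas => t ct; rewrite lee_fin //; apply: H.
by have : (@row4 R @^-1` ball y eps) t by rewrite row4_ball.
Qed.

(** A single coordinate ball is chosen on which both the volume density and the coordinate
    expression of [f] are bounded. *)
Lemma locally_finite x (f : M -> R) :
  (forall i z, dom i z -> exists2 h : E -> R, {for chart i z, continuous h} &
     forall w, dom i w -> f w = h (chart i w)) ->
  exists B : set M, [/\ open B, B x, (vol B < +oo)%E & exists K : R, forall z, B z -> f z <= K].
Proof.
move=> Hf; pose i := chart_at X x; have dx : dom i x by exact: mem_chart_at.
have iy := img_chart dx; set y := chart i x in iy.
have [h ch fh] := Hf i x dx.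
pose F (j : 'I_2) (z : E) := if j == 0 :> nat then Num.sqrt (\det (g i z)) else h z.
have cF j : {for y, continuous (F j)}.
  by case: j => [[|[|//]] jlt]; [exact: sqrt_det_continuous | exact: ch].
have [eps [K [e0 K0 bK]]] := continuous_near_bound (@img_open _ _ _ X i) iy cF.
have bK' z : ball y eps z -> img i z /\ forall j, `|F j z| <= K.
  by rewrite -ball_normE /= distrC => /bK.
exists (coord_ball i y eps); split.
- exact: coord_ball_open.
- by split=> //; exact: ballxx.
- apply: (@le_lt_trans _ _ (K * (2 * eps) ^+ 4)%:E); last exact: ltry.
  apply: vol_coord_ball_le => // z /bK'[] // _ /(_ ord0).
  by rewrite /F /= ger0_norm // sqrtr_ge0.
- exists K => z [dz /bK'[_ /(_ (@Ordinal 2 1 isT))]].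
  by rewrite /F /= -fh // => /(le_trans (ler_norm _)).
Qed.

(** [Rintegral] takes the [fine] part of an extended integral, and [fine] sends [+oo] to 0.
    Finiteness is therefore what allows the integral of [|beta|^2] to be concluded zero from its
    real value. By compactness, finitely many sets from [locally_finite] cover [M]. *)
Lemma integral_finite (f : M -> R) : compact [set: M] -> (forall x, 0 <= f x) ->
  (forall i z, dom i z -> exists2 h : E -> R, {for chart i z, continuous h} &
     forall w, dom i w -> f w = h (chart i w)) ->
  (\int[vol]_x (f x)%:E < +oo)%E.
Proof.
move=> cM f0 Hf.
have /choice[B HB] := fun x => locally_finite x Hf.
have : cover_compact [set: M] by rewrite -compact_cover.
move=> /(_ M setT B) [].
- by move=> x _; have [] := HB x.
- by move=> x _; exists x => //; have [] := HB x.
move=> D _ cov.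
have fin (s : seq M) : (vol (\big[setU/set0]_(x <- s) B x) < +oo)%E /\
    exists2 K : R, 0 <= K & forall z, (\big[setU/set0]_(x <- s) B x) z -> f z <= K.
  elim: s => [|x s [v1 [K K0 HK]]].
    by rewrite big_nil measure0; split=> //; exists 0.
  have [oB _ vB [K' HK']] := HB x; rewrite big_cons; split.
    have ms : measurable (\big[setU/set0]_(x <- s) B x : set (borel_type M)).
      apply: bigsetU_measurable => z _; apply: open_measurable_borel.
      by have [] := HB z.
    apply: (le_lt_trans (measureU2 vol (open_measurable_borel oB) ms)).
    by apply: lte_add_pinfty.
  exists (Num.max K K'); first by rewrite le_max K0.
  by move=> z [/HK' h|/HK h]; rewrite le_max h // orbT.
have [vD [K K0 HK]] := fin (finmap.enum_fset D).
have TE : [set: M] = \big[setU/set0]_(x <- finmap.enum_fset D) B x.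
  apply/seteqP; split=> // z /cov [x xD Bz].
  by rewrite -bigcup_seq; exists x.
apply: (@le_lt_trans _ _ (\int[vol]_x (cst K%:E x))%E).
  apply: ge0_le_integral_nomeas => x _; first by rewrite lee_fin.
  by rewrite lee_fin; apply: HK; rewrite -TE.
rewrite integral_cst // [X in vol X]TE.
by apply: lte_mul_pinfty.
Qed.

End Volume.

Lemma integral_pos (R : realType) (M : ptopologicalType) (I : Type)
    (X : oriented_atlas R M I) (r : regularity) (g : riemannian_metric X r)
    (vol : {measure set (borel_type M) -> \bar R}) (volP : is_riemannian_measure g vol)
    (f : M -> R) (i : I) (y : 'rV[R]_4) (eps c c' : R) :
  0 < eps -> 0 < c -> 0 < c' -> ball y eps `<=` img X i ->
  (forall z, ball y eps z -> c <= Num.sqrt (\det (g i z))) ->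
  (forall x, 0 <= f x) -> (forall x, coord_ball X i y eps x -> c' <= f x) ->
  (0 < \int[vol]_x (f x)%:E)%E.
Proof.
move=> e0 c0 c'0 sub H f0 Hf; set B := coord_ball X i y eps.
have mB : measurable (B : set (borel_type M)).
  by apply: open_measurable_borel; exact: coord_ball_open.
have vB : (0 < vol B)%E.
  apply: lt_le_trans (vol_coord_ball_ge volP e0 (ltW c0) sub H).
  by rewrite lte_fin mulr_gt0 // exprn_gt0 // mulr_gt0.
apply: (@lt_le_trans _ _ (\int[vol]_(x in B) (f x)%:E)%E).
  apply: (@lt_le_trans _ _ (\int[vol]_(x in B) (cst c'%:E x))%E).
    by rewrite integral_cst // mule_gt0.
  apply: ge0_le_integral_nomeas => x Bx; rewrite lee_fin; first exact: ltW.
  exact: Hf.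
rewrite integral_mkcond; apply: ge0_le_integral_nomeas => x _.
  by rewrite /patch; case: ifP => _; rewrite lee_fin.
by rewrite /patch; case: ifP => _; rewrite lee_fin.
Qed.

Theorem corollary5p10 (R : realType) (M : ptopologicalType) (I : Type)
    (M_compact : compact [set: M]) (M_hausdorff : hausdorff_space M)
    (X : oriented_atlas R M I)
    (r k : regularity) (r_ge1 : at_least 1 r) (k_ge2 : at_least 2 k)
    (g : riemannian_metric X r)
    (vol : {measure set (borel_type M) -> \bar R})
    (volP : is_riemannian_measure g vol)
    (S : hermitian_line_bundle X) (sigma : unitary_connection S k)
    (sigma_nonflat : ~ flat sigma)
    (sigma_ASD : anti_selfdual g sigma)
    (Z_dim : (manifold_hausdorff_dim X (vanishing_locus sigma) <= 2%:E)%E)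
    (beta : form1 S k)
    (beta_coclosed : is_dsigma_star g vol sigma beta (fun _ _ => 0))
    (beta_plus : forall i x, chart_dom X i x ->
       dsigma_plus g sigma beta i (chart X i x) = 0)
    (beta_multiple : forall i x, chart_dom X i x ->
       curvature sigma i (chart X i x) != 0 ->
       exists zeta : R[i],
         dsigma1 sigma beta i (chart X i x) =
           zeta *: curvature sigma i (chart X i x)) :
  forall i x, chart_dom X i x -> beta i (chart X i x) = 0.
Proof.
pose f := norm_form g beta.
have f0 x : 0 <= f x.
  by rewrite /f (norm_formE g beta (mem_chart_at X x)) norm_coord_ge0 //;
     apply: img_chart; exact: mem_chart_at.
have Hf i z : chart_dom X i z -> exists2 h : 'rV[R]_4 -> R, {for chart X i z, continuous h} &
     forall w, chart_dom X i w -> f w = h (chart X i w).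
  move=> iz; exists (norm_coord g beta i).
    by apply: norm_coord_continuous; exact: img_chart.
  by move=> w iw; exact: norm_formE.
have fin := integral_finite volP M_compact f0 Hf.
have int0 : (\int[vol]_x (f x)%:E = 0)%E.
  (* Tested against this section, coclosedness has [|beta|^2] on the left, because [d_sigma] of the
     section is [beta] at every point, and 0 on the right. *)
  pose pf := potential_form k_ge2 sigma_ASD Z_dim beta_multiple.
  have := congr1 (@complex.Re R) (beta_coclosed pf); rewrite /integralC /=.
  have -> : (fun x : borel_type M => complex.Re (herm1 g (dsigma0 sigma pf) beta x)) = f.
    apply/funext => x; rewrite /f /norm_form /herm1.
    by rewrite dsigma0_potential //; apply: img_chart; exact: mem_chart_at.
  have -> : (fun x : borel_type M => complex.Re (herm0 X pf (fun _ _ => 0) x)) = cst 0.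
    by apply/funext => x; rewrite /herm0 ReM Re_conj Im_conj /=; ring.
  rewrite /Rintegral integral0 /= => h.
  have fn : (\int[vol]_x (f x)%:E \is a fin_num)%E.
    by rewrite ge0_fin_numE // integral_ge0 // => x _; rewrite lee_fin.
  by rewrite -(fineK fn) h.
move=> i x ix; apply: (norm_coord_eq0 (g := g) (img_chart ix)).
apply/eqP; apply: contraT => fx0.
have fx : 0 < norm_coord g beta i (chart X i x).
  by rewrite lt_def fx0 norm_coord_ge0 //; exact: img_chart.
set y := chart X i x in fx.
have iy : img X i y by exact: img_chart.
(* The tolerance is half the value at [y], so the norm stays at least that half within [d]. *)
have /continuous_normP/(_ _ (divr_gt0 fx (ltr0Sn R 1)))[d d0 hd] :=
  norm_coord_continuous (g := g) (beta := beta) iy.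
have oy : \forall z \near y, img X i z by apply: open_nbhs_nbhs; split=> //; exact: img_open.
have /nbhs_ballP[d' /= d'0 sub] := oy.
(* [metric_det_gt0] gives a positive volume density only where the curvature does not vanish, so the
   centre moves to a nearby point off the zero set, where the norm of [beta] is still bounded
   below. *)
have [y1 y1d nZ] : exists2 y1, `|y1 - y| < Num.min d d' & ~ zero_coord sigma i y1.
  by apply: thin_dense; [exact: zero_coord_thin | rewrite lt_min d0].
move: y1d; rewrite lt_min => /andP[y1d y1d'].
have iy1 : img X i y1 by apply: sub; rewrite -ball_normE /= distrC.
have s0 : 0 < Num.sqrt (\det (g i y1)).
  by rewrite sqrtr_gt0; exact: (metric_det_gt0 (sigma := sigma)).
have /continuous_normP/(_ _ (divr_gt0 s0 (ltr0Sn R 1)))[e1 e10 he1] :=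
  sqrt_det_continuous (g := g) iy1.
(* In the ball of radius [e] around [y1] the density and the norm are at least half of their values
   at [y1] and [y] respectively, and the chart is defined. *)
pose e := Num.min e1 (Num.min (d - `|y1 - y|) (d' - `|y1 - y|)).
have e0 : 0 < e by rewrite !lt_min e10 !subr_gt0 y1d.
have ball_e z : ball y1 e z -> [/\ `|z - y1| < e1, `|z - y| < d & `|z - y| < d'].
  rewrite -ball_normE /= distrC !lt_min => /andP[-> /andP[h1 h2]].
  have tri : `|z - y| <= `|z - y1| + `|y1 - y|.
    by rewrite -[in leLHS](subrK y1 z) -addrA; exact: ler_normD.
  by split=> //; apply: (le_lt_trans tri); [move: h1|move: h2]; lra.
have : (0 < \int[vol]_x (f x)%:E)%E.
  apply: (integral_pos volP e0 (divr_gt0 s0 (ltr0Sn R 1))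
    (divr_gt0 fx (ltr0Sn R 1)) (i := i)) => //.
  - by move=> z /ball_e[_ _ zd']; apply: sub; rewrite -ball_normE /= distrC.
  - move=> z /ball_e[ze _ _]; have := he1 z ze.
    by rewrite ler_distl => /andP[h _]; move: h; lra.
  - move=> w [iw /ball_e[_ zd _]]; rewrite /f (norm_formE g beta iw).
    by have := hd _ zd; rewrite ler_distl => /andP[h _]; move: h; lra.
by rewrite int0 ltxx.
Qed.
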